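(* Let $t,\ell$ be given positive integers and let $n$ be sufficiently large (in terms of $t$ and $\ell$). Then, up to isomorphism: (i) $S_{n,2t-1}^{++}$ is the unique extremal graph with respect to $spex(n,tC_4)$; (ii) if $\ell\ge 3$, then $S_{n,\ell t-1}^{+}$ is the unique extremal graph with respect to $spex(n,tC_{2\ell})$.
   Context: All graphs are finite and simple. A graph is $F$-free if it contains no (not necessarily induced) subgraph isomorphic to $F$. $\rho(G)$ is the spectral radius of the adjacency matrix of $G$. $spex(n,F)$ is the maximum of $\rho(G)$ over all $n$-vertex $F$-free graphs $G$; an $n$-vertex $F$-free graph attaining it is called extremal with respect to $spex(n,F)$. $C_k$ is the cycle of length $k$, and $tF$ is the disjoint union of $t$ copies of $F$. $S_{n,k}$ is the join of a clique on $k$ vertices with an independent set of size $n-k$. $S_{n,k}^{+}$ is obtained from $S_{n,k}$ by adding one edge within its independent set, and $S_{n,k}^{++}$ is obtained from $S_{n,k}$ by embedding a maximum matching (i.e. $\lfloor (n-k)/2\rfloor$ independent edges) within its independent set. *)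

(* Defs.v *)
From HB Require Import structures.
From mathcomp Require Import all_boot all_order all_algebra all_field.

Set Implicit Arguments.
Unset Strict Implicit.
Unset Printing Implicit Defensive.

Import Order.TTheory GRing.Theory Num.Theory.
Local Open Scope ring_scope.

(* The eigenvalues are taken with multiplicity, as the roots
   of the characteristic polynomial over the algebraically closed field algC.
   We only use it for integer matrices, all of whose complex eigenvalues are
   algebraic, so nothing is lost by working in algC rather than in the complex
   numbers.  The order on algC is partial, but moduli are pairwise comparable. *)

Definition spectrum (n : nat) (A : 'M[algC]_n) : seq algC :=
  sval (closed_field_poly_normal (char_poly A)).

Definition spectral_radius (n : nat) (A : 'M[algC]_n) : algC :=
  \big[Num.max/0]_(z <- spectrum A) `|z|.

Lemma mem_spectrum (n : nat) (A : 'M[algC]_n) (z : algC) :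
  (z \in spectrum A) = eigenvalue A z.
Proof.
rewrite eigenvalue_root_char /spectrum.
case: closed_field_poly_normal => r /= ->.
by rewrite (monicP (char_poly_monic A)) scale1r root_prod_XsubC.
Qed.

Lemma bigmax_norm_spec (s : seq algC) :
  let m := \big[Num.max/0]_(z <- s) `|z| in
  [/\ m \is Num.real, {in s, forall z, `|z| <= m}
    & s != [::] -> exists2 z, z \in s & m = `|z|].
Proof.
elim: s => [|x s [mR mge mex]] /=; first by rewrite big_nil real0.
rewrite !big_cons; move: mR mge mex; set m := \big[_/_]_(_ <- _) _.
move=> mR mge mex; have xR := normr_real x.
split=> [|z|_].
- by case: (real_ltP xR mR).
- rewrite inE => /predU1P[->|/mge zm]; case: (real_ltP xR mR) => //.
  + exact: ltW.
  + exact: le_trans.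
case: (real_ltP xR mR) => [ltxm|_]; last by exists x; rewrite ?mem_head.
have [s0|/mex[z zs ->]] := eqVneq s [::]; last by exists z; rewrite ?inE ?zs ?orbT.
by move: ltxm; rewrite /m s0 big_nil normr_lt0.
Qed.

Lemma eigenvalue_le_spectral_radius (n : nat) (A : 'M[algC]_n) (z : algC) :
  eigenvalue A z -> `|z| <= spectral_radius A.
Proof.
by rewrite -mem_spectrum; have [_ + _] := bigmax_norm_spec (spectrum A); apply.
Qed.

Lemma spectral_radius_attained (n : nat) (A : 'M[algC]_n) :
  (0 < n)%N -> exists2 z, eigenvalue A z & spectral_radius A = `|z|.
Proof.
move=> n_gt0; have [_ _ H] := bigmax_norm_spec (spectrum A).
case: H => [|z]; last by rewrite mem_spectrum; exists z.
apply/eqP=> s0; have := size_char_poly A; move: s0; rewrite /spectrum.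
case: closed_field_poly_normal => r /= -> ->.
rewrite big_nil (monicP (char_poly_monic A)) scale1r size_poly1 => -[n0].
by rewrite -n0 in n_gt0.
Qed.

Record sgraph := SGraph {
  vertex :> finType;
  adj : rel vertex;
  adj_sym : symmetric adj;
  adj_irrefl : irreflexive adj
}.

Definition adjmx (G : sgraph) : 'M[algC]_#|G| :=
  \matrix_(i, j) (adj (enum_val i : G) (enum_val j))%:R.

Definition rho (G : sgraph) : algC := spectral_radius (adjmx G).

Definition sg_iso (G H : sgraph) : Prop :=
  exists2 f : G -> H, bijective f & forall x y, adj (f x) (f y) = adj x y.

(* A not necessarily induced copy of F inside G. *)
Definition sg_contains (G F : sgraph) : Prop :=
  exists2 f : F -> G, injective f & forall x y, adj x y -> adj (f x) (f y).

Definition sg_free (F G : sgraph) : Prop := ~ sg_contains G F.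

Definition is_spex (n : nat) (F : sgraph) (r : algC) : Prop :=
  (exists G : sgraph, [/\ #|G| = n, sg_free F G & rho G = r]) /\
  (forall G : sgraph, #|G| = n -> sg_free F G -> rho G <= r).

Definition extremal (n : nat) (F G : sgraph) : Prop :=
  [/\ #|G| = n, sg_free F G & is_spex n F (rho G)].

Definition unique_extremal (n : nat) (F G : sgraph) : Prop :=
  extremal n F G /\ forall H : sgraph, extremal n F H -> sg_iso H G.

Local Open Scope nat_scope.

(* The conjunct i != j only matters for k = 1; for k >= 3 this is C_k. *)
Definition cycle_adj (k : nat) : rel 'I_k := fun i j =>
  (i != j) && ((i.+1 %% k == j) || (j.+1 %% k == i)).

Lemma cycle_adj_sym (k : nat) : symmetric (@cycle_adj k).
Proof. by move=> i j; rewrite /cycle_adj eq_sym orbC. Qed.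

Lemma cycle_adj_irrefl (k : nat) : irreflexive (@cycle_adj k).
Proof. by move=> i; rewrite /cycle_adj eqxx. Qed.

Definition cycle_graph (k : nat) : sgraph :=
  SGraph (@cycle_adj_sym k) (@cycle_adj_irrefl k).

Definition copies_adj (t : nat) (F : sgraph) : rel ('I_t * F)%type :=
  fun u v => (u.1 == v.1) && adj u.2 v.2.

Lemma copies_adj_sym (t : nat) (F : sgraph) : symmetric (@copies_adj t F).
Proof. by move=> u v; rewrite /copies_adj eq_sym adj_sym. Qed.

Lemma copies_adj_irrefl (t : nat) (F : sgraph) : irreflexive (@copies_adj t F).
Proof. by move=> u; rewrite /copies_adj adj_irrefl andbF. Qed.

Definition copies (t : nat) (F : sgraph) : sgraph :=
  SGraph (@copies_adj_sym t F) (@copies_adj_irrefl t F).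

Definition complete_adj (k : nat) : rel 'I_k := fun i j => i != j.

Lemma complete_adj_sym (k : nat) : symmetric (@complete_adj k).
Proof. by move=> i j; rewrite /complete_adj eq_sym. Qed.

Lemma complete_adj_irrefl (k : nat) : irreflexive (@complete_adj k).
Proof. by move=> i; rewrite /complete_adj eqxx. Qed.

Definition complete_graph (k : nat) : sgraph :=
  SGraph (@complete_adj_sym k) (@complete_adj_irrefl k).

Definition join_adj (G H : sgraph) : rel (G + H)%type := fun u v =>
  match u, v with
  | inl x, inl y => adj x y
  | inr x, inr y => adj x y
  | _, _ => true
  end.

Lemma join_adj_sym (G H : sgraph) : symmetric (@join_adj G H).
Proof. by move=> [x|x] [y|y] //=; rewrite adj_sym. Qed.

Lemma join_adj_irrefl (G H : sgraph) : irreflexive (@join_adj G H).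
Proof. by move=> [x|x] /=; rewrite adj_irrefl. Qed.

Definition join (G H : sgraph) : sgraph :=
  SGraph (@join_adj_sym G H) (@join_adj_irrefl G H).

(* The single edge {0, 1} and m - 2 isolated vertices (for m >= 2). *)
Definition one_edge_adj (m : nat) : rel 'I_m := fun i j => i + j == 1.

Lemma one_edge_adj_sym (m : nat) : symmetric (@one_edge_adj m).
Proof. by move=> i j; rewrite /one_edge_adj addnC. Qed.

Lemma one_edge_adj_irrefl (m : nat) : irreflexive (@one_edge_adj m).
Proof. by move=> [[|i] ?]; rewrite /one_edge_adj //= addnS. Qed.

Definition one_edge_graph (m : nat) : sgraph :=
  SGraph (@one_edge_adj_sym m) (@one_edge_adj_irrefl m).

(* The edges {0, 1}, {2, 3}, ..., m./2 in all; for m odd, m - 1 is isolated. *)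
Definition matching_adj (m : nat) : rel 'I_m := fun i j =>
  (i != j) && (i./2 == j./2).

Lemma matching_adj_sym (m : nat) : symmetric (@matching_adj m).
Proof. by move=> i j; rewrite /matching_adj eq_sym [_./2 == _]eq_sym. Qed.

Lemma matching_adj_irrefl (m : nat) : irreflexive (@matching_adj m).
Proof. by move=> i; rewrite /matching_adj eqxx. Qed.

Definition matching_graph (m : nat) : sgraph :=
  SGraph (@matching_adj_sym m) (@matching_adj_irrefl m).

(* S_{n,k}^+ and S_{n,k}^{++}, for k <= n: putting the edges of a graph H inside
   the independent set of S_{n,k} gives the join of the k-clique with H. *)
Definition Splus (n k : nat) : sgraph :=
  join (complete_graph k) (one_edge_graph (n - k)).

Definition Splusplus (n k : nat) : sgraph :=
  join (complete_graph k) (matching_graph (n - k)).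

(* Main.v *)
Require Import Defs.
From Stdlib Require Classical_Prop.
From mathcomp Require Import all_boot all_order all_algebra all_field.
From mathcomp Require Import ring lra zify.

(** Let [k = l t - 1], let [G] be [t C_2l]-free on [n] vertices, let [r] be its
    spectral radius and [x] a Perron vector with maximum [1].

    Upper bound, by induction on [t].  If deleting a vertex [v] destroys all
    families of [t - 1] disjoint [2l]-cycles, then [r^2 <= n + r r'] with
    [r'^2 <= (k - l + o(1)) n], so [r^2] stays below [k n] by a linear term.
    Otherwise, for each [v] there is a bounded set [Y], not containing [v], that
    meets every [2l]-cycle; hence only [O(n)] walks of length two start at [v],
    and up to [o(n)] the sum [r^2 x_v] comes from walks that end in a bounded
    set [D].  For [l >= 3] the set [D] is made of the large entries of [x],
    because a [C_2l]-free graph has few vertices of degree [c sqrt n]; for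
    [l = 2], [D = Y + v], because codegrees outside [Y] are at most one.  As
    [G] contains no [K_{k+1,k+1}], all but boundedly many vertices have at most
    [k] neighbours in [D], so [r^2 <= (k + o(1)) n].

    Stability.  If [k >= 2] and [r^2 >= k (n - k)], equality must almost hold
    throughout, which gives [k] vertices [K] of degree [(1 - o(1)) n] on which
    [x] is close to [1].  The few vertices that are not adjacent to all of [K]
    are re-attached to [K]; comparing Rayleigh quotients shows that there are
    none.  Then [K] is complete to the rest, the rest induces a matching (one
    edge if [l >= 3]), and maximality does what remains.

    One 4-cycle.  Here [k = 1] and polarity graphs are almost extremal, so there
    is no stability.  The identity for [r^2 x_w] in terms of codegrees, together
    with [r^2 - r >= n - 1 - 1/r], forces a graph without a dominating vertex to
    have [n - 1 = q (q - 1)] for its maximum degree [q]; then [n] is odd, the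
    bound improves to [r^2 - r >= n - 1], and the graph is a regular friendship
    graph, which does not exist. *)

Set Implicit Arguments.
Unset Strict Implicit.
Unset Printing Implicit Defensive.

Import Order.TTheory GRing.Theory Num.Theory.
Local Open Scope ring_scope.

(** * Perron vectors and spectral radii *)

(** The cases [l = 2] and [l >= 3] meet in one estimate, [dominated]: [r^2 x_v] is at most the
    weight of the walks of length two that end in a bounded set, plus [n - deg v], plus [o(n)]. The
    first term is at most [k deg v + O(1)], so the total is [(k - 1) deg v + n + o(n)]. The surplus
    [n - deg v] is the price of 4-cycles, where every vertex outside the bounded set may still be
    reached by one walk. It is harmless for [k >= 2], since a value near [k n] then forces [deg v]
    to be near [n]; for [k = 1] the estimate carries no information on degrees. The upper bound for
    [t] copies and [dominated] for [t + 1] copies are proved alternately. Competing graphs are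
    compared through Rayleigh quotients of explicit trial vectors, so that, apart from the trace
    argument for friendship graphs, spectral theory enters only through the existence of Perron
    vectors ([has_perron]). *)

Section Perron.
Variables (R : realFieldType) (V : finType) (e : rel V).
Implicit Types (r : R) (x y : V -> R).

Definition nbsum (x : V -> R) (v : V) : R := \sum_(u | e v u) x u.
Definition quad (x : V -> R) : R := \sum_v x v * nbsum x v.
Definition sqnorm (x : V -> R) : R := \sum_v x v ^+ 2.

(** The graph may be disconnected, so [x] is allowed to vanish somewhere; the Rayleigh clause is
    what pins [r] down as the largest eigenvalue. *)
Definition perron (r : R) (x : V -> R) : Prop :=
  [/\ forall v, 0 <= x v <= 1, exists v, x v = 1,
      forall v, nbsum x v = r * x v & forall y, quad y <= r * sqnorm y].

Lemma sqnorm_ge0 x : 0 <= sqnorm x.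
Proof. by apply: sumr_ge0 => v _; exact: sqr_ge0. Qed.

Lemma nbsumE x v : nbsum x v = \sum_u (e v u)%:R * x u.
Proof.
by rewrite /nbsum big_mkcond; apply: eq_bigr => u _; case: (e v u); rewrite ?mul1r ?mul0r.
Qed.

Lemma quadE x : quad x = \sum_v \sum_u (e v u)%:R * (x v * x u).
Proof.
apply: eq_bigr => v _; rewrite nbsumE mulr_sumr; apply: eq_bigr => u _.
by rewrite mulrCA.
Qed.

Lemma perron_eig_quad r x : perron r x -> quad x = r * sqnorm x.
Proof.
case=> _ _ ex _; rewrite /quad /sqnorm mulr_sumr; apply: eq_bigr => v _.
by rewrite ex mulrCA -expr2.
Qed.

Lemma perron_sqnorm_gt0 r x : perron r x -> 0 < sqnorm x.
Proof.
case=> _ [v xv] _ _; rewrite /sqnorm (bigD1 v) //= xv expr1n.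
by rewrite ltr_wpDr ?ltr01 // sumr_ge0 // => u _; exact: sqr_ge0.
Qed.

Lemma perron_quad_le r x s : perron r x -> quad x <= s * sqnorm x -> r <= s.
Proof.
by move=> P; rewrite (perron_eig_quad P) ler_pM2r // (perron_sqnorm_gt0 P).
Qed.

Lemma perron_uniq r x s y : perron r x -> perron s y -> r = s.
Proof.
move=> Px Py; apply/eqP; rewrite eq_le.
rewrite (perron_quad_le Px) ?(perron_quad_le Py) //; first by case: Px.
by case: Py.
Qed.

Hypothesis esym : symmetric e.

Lemma quad_cross (w : V -> R) (c : R) (v : V) :
  quad (fun u => w u + c * (u == v)%:R) =
  quad w + c * (nbsum w v *+ 2) + c ^+ 2 * (e v v)%:R.
Proof.
pose d u : R := (u == v)%:R.
have dd (f : V -> R) : \sum_u d u * f u = f v.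
  rewrite (bigD1 v) //= /d eqxx mul1r big1 ?addr0 // => u /negPf ->.
  by rewrite mul0r.
rewrite quadE (eq_bigr (fun a => (\sum_b (e a b)%:R * (w a * w b)
   + c * w a * nbsum d a) + c * (d a * (nbsum w a + c * nbsum d a)))); last first.
  move=> a _; rewrite !nbsumE mulr_sumr mulrDr mulrDr !mulr_sumr -!big_split /=.
  by apply: eq_bigr => b _; rewrite /d; ring.
rewrite !big_split /= -quadE -mulr_sumr dd.
have dv a : nbsum d a = (e a v)%:R.
  by rewrite nbsumE -(dd (fun u => (e a u)%:R)); apply: eq_bigr => u _; rewrite mulrC.
have -> : \sum_a c * w a * nbsum d a = c * nbsum w v.
  rewrite nbsumE mulr_sumr; apply: eq_bigr => a _.
  by rewrite dv esym; ring.
rewrite dv; ring.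
Qed.

(* A nonnegative [w] with [A w >= r w] attains the maximum of the Rayleigh
   quotient, so the derivative of [r |y|^2 - y^T A y] vanishes at [w]. *)
Lemma subeigen_eigen r (w : V -> R) :
  (forall y, quad y <= r * sqnorm y) -> (forall v, 0 <= w v) ->
  (forall v, r * w v <= nbsum w v) -> forall v, nbsum w v = r * w v.
Proof.
move=> Hq w0 Hw v.
have Hw0 : quad w = r * sqnorm w.
  apply/eqP; rewrite eq_le Hq /= /quad /sqnorm mulr_sumr; apply: ler_sum => u _.
  by rewrite expr2 mulrCA ler_wpM2l.
have sq (c : R) : sqnorm (fun u => w u + c * (u == v)%:R)
          = sqnorm w + c * (w v *+ 2) + c ^+ 2.
  rewrite /sqnorm (eq_bigr (fun u => w u ^+ 2 + (u == v)%:R * (c * (w u *+ 2) + c ^+ 2))).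
    rewrite big_split /=; rewrite -addrA; congr (_ + _).
    by rewrite (bigD1 v) //= eqxx mul1r big1 ?addr0 // => u /negPf ->; rewrite mul0r.
  by move=> u _; case: (u == v); rewrite /= ?mulr1n ?mulr0n; ring.
pose b := nbsum w v - r * w v.
(* The form [r |y|^2 - y^T A y] is nonnegative and vanishes at [w]; this is its expansion along the
   coordinate [v]. *)
have K (c : R) : c * (b *+ 2) <= c ^+ 2 * (r - (e v v)%:R).
  have := Hq (fun u => w u + c * (u == v)%:R).
  by rewrite quad_cross sq Hw0 /b; lra.
pose s := r - (e v v)%:R.
have s0 : 0 <= s by have := K 1; have := K (-1); rewrite -/s; lra.
have [b0|b0] : b = 0 \/ 0 < b ^+ 2.
- by have [->|b0] := eqVneq b 0; [left|right; rewrite exprn_even_gt0].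
- by apply/eqP; rewrite -subr_eq0 -/b b0.
have s1 : 0 < s + 1 by lra.
(* For small [c] the linear term wins: with this [c] the inequality would read
   [2 b^2 (s + 1) <= b^2 s]. *)
have := K (b / (s + 1)); rewrite -/s => H.
have : b / (s+1) * (b *+ 2) * (s + 1) ^+ 2 <= (b / (s + 1)) ^+ 2 * s * (s + 1) ^+ 2.
  by rewrite ler_wpM2r // sqr_ge0.
have -> : b / (s+1) * (b *+ 2) * (s + 1) ^+ 2 = b ^+ 2 *+ 2 * (s + 1).
  by field; rewrite lt0r_neq0.
have -> : (b / (s + 1)) ^+ 2 * s * (s + 1) ^+ 2 = b ^+ 2 * s.
  by field; rewrite lt0r_neq0.
nra.
Qed.

Lemma perron_of_subeigen r (w : V -> R) (v0 : V) :
  (forall y, quad y <= r * sqnorm y) -> (forall v, 0 <= w v) -> w v0 != 0 ->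
  (forall v, r * w v <= nbsum w v) -> exists x, perron r x.
Proof.
move=> Hq w0 wv0 Hw; have Ew := subeigen_eigen Hq w0 Hw.
pose m := [arg max_(v > v0) w v]%O.
have wm v : w v <= w m by rewrite /m; case: arg_maxP => // i _; apply.
have wm0 : 0 < w m by apply: lt_le_trans (wm v0); rewrite lt0r wv0 w0.
exists (fun v => w v / w m); split=> //.
- by move=> v; rewrite divr_ge0 ?w0 ?(ltW wm0) //= ler_pdivrMr // mul1r.
- by exists m; rewrite divff // lt0r_neq0.
- by move=> v; rewrite /nbsum -mulr_suml mulrA; congr (_ / _); exact: Ew.
Qed.

End Perron.

Section PerronTransport.
Variables (R : realFieldType) (V W : finType) (e : rel V) (e' : rel W).
Variable f : V -> W.
Hypotheses (fbij : bijective f) (fe : forall u v, e' (f u) (f v) = e u v).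

Lemma nbsum_bij (x : W -> R) v : nbsum e' x (f v) = nbsum e (x \o f) v.
Proof.
rewrite /nbsum (reindex f) /=; last exact: onW_bij.
by apply: eq_bigl => u; rewrite fe.
Qed.

Lemma quad_bij (x : W -> R) : quad e' x = quad e (x \o f).
Proof.
rewrite /quad (reindex f) /=; last exact: onW_bij.
by apply: eq_bigr => v _; rewrite nbsum_bij.
Qed.

Lemma sqnorm_bij (x : W -> R) : sqnorm x = sqnorm (x \o f).
Proof. by rewrite /sqnorm (reindex f) //; exact: onW_bij. Qed.

Lemma perron_bij r (x : W -> R) : perron e' r x -> perron e r (x \o f).
Proof.
case: fbij => g fK gK [x01 [w xw] ex qx]; split=> /=.
- by move=> v; exact: x01.
- by exists (g w); rewrite gK.
- by move=> v; rewrite -nbsum_bij ex.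
- move=> y; pose z := y \o g.
  have yz v : z (f v) = y v by rewrite /z /= fK.
  have := qx z; rewrite quad_bij sqnorm_bij.
  suff [-> ->] : quad e (z \o f) = quad e y /\ sqnorm (z \o f) = sqnorm y by [].
  split; apply: eq_bigr => v _; rewrite /= yz //.
  by congr (_ * _); apply: eq_bigr => u _; rewrite /= yz.
Qed.
End PerronTransport.

(** * The spectral radius over [algC] and its Perron vector over [algR] *)

Section SpectralRadius.
Variable G : sgraph.
Local Notation n := #|G|.
Local Notation A := (adjmx G).

Lemma adjmxE i j : A i j = (adj (enum_val i : G) (enum_val j))%:R.
Proof. by rewrite mxE. Qed.

Lemma adjmx_tr : A^T = A.
Proof. by apply/matrixP=> i j; rewrite !mxE adj_sym. Qed.

Lemma adjmx_conj : map_mx Num.conj A = A.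
Proof. by apply/matrixP=> i j; rewrite !mxE conjC_nat. Qed.

(** A unitary [P] diagonalises the Hermitian matrix [A], which turns the form into a sum of squared
    moduli of the coordinates of [u P^-1], weighted by eigenvalues. *)
Lemma adjmx_rayleigh (u : 'rV[algC]_n) (uR : forall j, u 0 j \is Creal) :
  (u *m A *m u^T) 0 0 <= rho G * \sum_j u 0 j ^+ 2.
Proof.
have Ah : A \is hermsymmx.
  by apply/is_hermitianmxP; rewrite expr0 scale1r adjmx_tr adjmx_conj.
have An := hermitian_normalmx Ah.
have /orthomx_spectralP EA := An.
set P := spectralmx A in EA; set d := spectral_diag A in EA.
have Pu : P \is unitarymx by exact: spectral_unitarymx.
have PV := invmx_unitary Pu.
have dreal i : d 0 i \is Creal.
  by have /mxOverP := hermitian_spectral_diag_real Ah; apply.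
have dle i : d 0 i <= rho G.
  have : eigenvalue A (d 0 i).
    apply/eigenvalueP; exists (row i P).
      have PA : P *m A = diag_mx d *m P.
        by rewrite [in LHS]EA !mulmxA mulmxV ?spectral_unit // mul1mx.
      by rewrite -row_mul PA row_mul row_diag_mx -scalemxAl -rowE.
    apply/eqP => r0; have /(congr1 (row i)) := mulmxV (spectral_unit A).
    rewrite row_mul -/P r0 mul0mx row1 => /rowP /(_ i).
    by rewrite !mxE !eqxx => /eqP; rewrite eq_sym oner_eq0.
  move=> /eigenvalue_le_spectral_radius; apply: le_trans.
  exact: real_ler_norm.
pose w := u *m invmx P.
have wT : P *m u^T = map_mx Num.conj w^T.
  rewrite /w PV trmx_mul map_mxM; congr (_ *m _).
    exact/esym/trmxCK.
  by apply/matrixP=> i j; rewrite !mxE (ord1 j); apply/esym/CrealP; exact: uR.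
have -> : u *m A *m u^T = (w *m diag_mx d) *m (map_mx Num.conj w^T).
  by rewrite EA -wT !mulmxA.
have -> : \sum_j u 0 j ^+ 2 = (w *m (map_mx Num.conj w^T)) 0 0.
  rewrite -wT /w mulmxA mulmxKV ?spectral_unit // mxE.
  by apply: eq_bigr => j _; rewrite mxE expr2.
rewrite !mxE mulr_sumr; apply: ler_sum => j _.
rewrite mul_mx_diag !mxE -mulrA mulrCA -normCK.
by rewrite ler_wpM2r // exprn_ge0.
Qed.

Lemma rho_real : rho G \is Creal.
Proof. by rewrite /rho; case: (bigmax_norm_spec (spectrum A)). Qed.

(** The order of [algC] is only partial; [algR] is an archimedean ordered field, in which all
    estimates can be run. *)
Definition rhoR : algR := in_algR rho_real.

(** Take the moduli of an eigenvector for an eigenvalue of largest modulus and use the triangle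
    inequality. *)
Lemma rho_subeigen : (0 < n)%N -> exists2 w : G -> algR,
  (forall v, 0 <= w v) /\ (exists v, w v != 0) &
  forall v, rhoR * w v <= nbsum (@adj G) w v.
Proof.
move=> n0; have [z /eigenvalueP [u Eu u0] rz] := spectral_radius_attained A n0.
pose w (v : G) : algR := in_algR (normr_real (u 0 (enum_rank v))).
exists w; first split=> [v|].
- exact: (normr_ge0 (u 0 (enum_rank v))).
- have /existsP [i ui] : [exists i, u 0 i != 0].
    apply: contraNT u0; rewrite negb_exists => /forallP H.
    by apply/eqP/rowP => i; rewrite mxE; have := H i; rewrite negbK => /eqP.
  exists (enum_val i); rewrite -(inj_eq val_inj) /= enum_valK.
  by rewrite normr_eq0.
move=> v; rewrite /nbsum.
have -> : (rhoR * w v <= \sum_(t | adj v t) w t) =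
  (rho G * `|u 0 (enum_rank v)| <= \sum_(t | adj v t) `|u 0 (enum_rank t)|).
  rewrite -[LHS]/(algRval _ <= algRval _) rmorphM /= rmorph_sum /=; congr (_ <= _).
have := congr1 (fun M : 'rV_n => `|M 0 (enum_rank v)|) Eu.
rewrite /= [X in _ = `|X|]mxE normrM -rz => <-.
rewrite mxE (reindex (@enum_rank G)) /=; last exact/onW_bij/enum_rank_bij.
rewrite [leRHS]big_mkcond /=; apply: le_trans (ler_norm_sum _ _ _) _.
apply: ler_sum => t _; rewrite normrM adjmxE !enum_rankK adj_sym.
by case: (adj v t); rewrite ?normr1 ?mulr1 ?normr0 ?mulr0.
Qed.

Lemma rho_perron : (0 < n)%N -> exists x, perron (@adj G) rhoR x.
Proof.
move=> n0; have [w [w0 [v wv]] Hw] := rho_subeigen n0.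
apply: (perron_of_subeigen _ _ w0 wv Hw) => [|y]; first exact: adj_sym.
pose u : 'rV[algC]_n := \row_j algRval (y (enum_val j)).
have uR j : u 0 j \is Creal by rewrite mxE; exact: algRvalP.
have := adjmx_rayleigh uR.
have -> : \sum_j u 0 j ^+ 2 = algRval (sqnorm y).
  rewrite /sqnorm rmorph_sum (reindex (@enum_val G predT)) /=.
    by apply: eq_bigr => j _; rewrite mxE rmorphXn.
  exact/onW_bij/enum_val_bij.
suff -> : (u *m A *m u^T) 0 0 = algRval (quad (@adj G) y) by [].
rewrite quadE rmorph_sum (reindex (@enum_val G predT)) /=; last exact/onW_bij/enum_val_bij.
rewrite mxE; apply: eq_bigr => j _.
rewrite mxE mulr_suml rmorph_sum [RHS](reindex (@enum_val G predT)) /=; last exact/onW_bij/enum_val_bij.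
apply: eq_bigr => i _; rewrite !mxE adj_sym -mulrA mulrCA [algRval (y (enum_val i)) * _]mulrC.
by case: adj.
Qed.
End SpectralRadius.

(** * Greedy paths and even cycles *)

Local Open Scope nat_scope.

Section Pruning.
Variables (V : finType) (e : rel V).
Hypotheses (esym : symmetric e) (eirr : irreflexive e).
Implicit Types (S T H : {set V}) (v : V).

Definition nbrs v : {set V} := [set u | e v u].
(** Edges inside [S :&: T] count twice, hence the factor 2 in [prune]. *)
Definition pairs S T : nat := \sum_(u in S) #|nbrs u :&: T|.

Lemma in_nbrs v u : (u \in nbrs v) = e v u. Proof. by rewrite inE. Qed.

Lemma pairsC S T : pairs S T = pairs T S.
Proof.
have E A B : pairs A B = \sum_(u in A) \sum_(w in B) e u w.
  apply: eq_bigr => u _; rewrite -sum1_card big_mkcond [RHS]big_mkcond /=.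
  by apply: eq_bigr => w _; rewrite !inE; case: (e u w); case: (w \in B).
rewrite !E exchange_big /=; apply: eq_bigr => u _; apply: eq_bigr => w _.
by rewrite esym.
Qed.

Lemma pairs_D1l S T u : u \in S -> pairs S T = #|nbrs u :&: T| + pairs (S :\ u) T.
Proof. by move=> uS; rewrite /pairs (big_setD1 u). Qed.

Lemma pairs_D1r S T w : w \in T -> pairs S T = #|nbrs w :&: S| + pairs S (T :\ w).
Proof. by move=> wT; rewrite pairsC (pairs_D1l _ wT) pairsC. Qed.

Lemma pairs_leq S T T' : T \subset T' -> pairs S T <= pairs S T'.
Proof. by move=> sT; apply: leq_sum => u _; rewrite subset_leq_card // setIS. Qed.

Lemma pairs_Ur S T T' : pairs S (T :|: T') <= pairs S T + pairs S T'.
Proof.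
rewrite /pairs -big_split /=; apply: leq_sum => u _.
by rewrite setIUr cardsU leq_subr.
Qed.

Lemma pairs_max S T : pairs S T <= #|S| * #|T|.
Proof.
rewrite /pairs -sum_nat_const; apply: leq_sum => u _.
by rewrite subset_leq_card // subsetIr.
Qed.

Lemma pairs_ge S T d : (forall u, u \in S -> d <= #|nbrs u :&: T|) -> d * #|S| <= pairs S T.
Proof. by move=> H; rewrite mulnC -sum_nat_const; apply: leq_sum. Qed.

(** Removing a vertex with fewer than [a] neighbours on the other side lowers the right-hand side
    more than the left-hand side, so the strict inequality survives; it fails for empty sets. [S]
    and [T] may overlap. *)
Lemma prune_bip a S T : a * (#|S| + #|T|) < pairs S T ->
  exists S' T' : {set V}, [/\ S' \subset S, T' \subset T, S' != set0,
    forall u, u \in S' -> a <= #|nbrs u :&: T'| &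
    forall w, w \in T' -> a <= #|nbrs w :&: S'|].
Proof.
have [m] := ubnP (#|S| + #|T|); elim: m S T => // m IH S T /ltnSE le_m lt_p.
have [/existsP [u /andP [uS du]]|] := boolP [exists u, (u \in S) && (#|nbrs u :&: T| < a)].
  have cS := cardsD1 u S; rewrite uS in cS.
  have [||S' [T' [sS sT S0 HS HT]]] := IH (S :\ u) T; first by lia.
    by have := pairs_D1l T uS; nia.
  by exists S', T'; split=> //; rewrite (subset_trans sS) // subsetDl.
rewrite negb_exists => /forallP HS.
have [/existsP [w /andP [wT dw]]|] := boolP [exists w, (w \in T) && (#|nbrs w :&: S| < a)].
  have cT := cardsD1 w T; rewrite wT in cT.
  have [||S' [T' [sS sT S0 HS' HT]]] := IH S (T :\ w); first by lia.
    by have := pairs_D1r S wT; nia.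
  by exists S', T'; split=> //; rewrite (subset_trans sT) // subsetDl.
rewrite negb_exists => /forallP HT.
exists S, T; split=> //.
- by apply: contraTneq lt_p => ->; rewrite /pairs big_set0.
- by move=> u uS; have := HS u; rewrite uS -leqNgt.
- by move=> u uS; have := HT u; rewrite uS -leqNgt.
Qed.

Lemma prune a H : 2 * a * #|H| < pairs H H ->
  exists2 H' : {set V}, H' \subset H & H' != set0 /\ forall u, u \in H' -> a <= #|nbrs u :&: H'|.
Proof.
have [m] := ubnP #|H|; elim: m H => // m IH H /ltnSE le_m lt_p.
have [/existsP [u /andP [uH du]]|] := boolP [exists u, (u \in H) && (#|nbrs u :&: H| < a)].
  have cH := cardsD1 u H; rewrite uH in cH.
  have [||H' sH HH] := IH (H :\ u); first by lia.
    have := pairs_D1l H uH; have := pairs_D1r (H :\ u) uH.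
    have : #|nbrs u :&: (H :\ u)| <= #|nbrs u :&: H|.
      by rewrite subset_leq_card // setIS // subsetDl.
    nia.
  by exists H' => //; rewrite (subset_trans sH) // subsetDl.
rewrite negb_exists => /forallP HH; exists H => //; split.
  by apply: contraTneq lt_p => ->; rewrite /pairs big_set0.
by move=> u uH; have := HH u; rewrite uH -leqNgt.
Qed.

Lemma choose_notin (A : {set V}) (X : seq V) : size X < #|A| -> exists2 w, w \in A & w \notin X.
Proof.
move=> lt; have [/existsP [w /andP [? ?]]|] := boolP [exists w, (w \in A) && (w \notin X)].
  by exists w.
rewrite negb_exists => /forallP H; move: lt; rewrite ltnNge => /negP [].
rewrite (leq_trans _ (card_size X)) // subset_leq_card //.
by apply/subsetP => w wA; have := H w; rewrite wA negbK.
Qed.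

(** [X] lists the vertices to avoid. As [S] and [T] may overlap, both vertices of a round are added
    to [X], which is why [m] rounds ask for degree [size X + 2 m]. *)
Lemma greedy_path S T D : (forall u, u \in S -> D <= #|nbrs u :&: T|) ->
  (forall w, w \in T -> D <= #|nbrs w :&: S|) ->
  forall m (X : seq V) u, u \in S -> u \in X -> size X + 2 * m <= D ->
  exists p, [/\ size p = 2 * m, path e u p, uniq p, ~~ has [in X] p &
    all [in S :|: T] p && (last u p \in S)].
Proof.
move=> HS HT; elim=> [|m IH] X u uS uX le_D.
  by exists [::]; split=> //=; rewrite ?muln0.
have [|w] := @choose_notin (nbrs u :&: T) X; first by have := HS u uS; lia.
rewrite !inE => /andP [euw wT] wX.
have [|u'] := @choose_notin (nbrs w :&: S) (w :: X); first by have := HT w wT => /=; lia.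
rewrite !inE negb_or => /andP [ewu uS'] /andP [u'w u'X].
have [||p [sp pp up hp /andP [ap lp]]] := IH [:: u', w & X] u' uS'; first by rewrite inE eqxx.
  by move: le_D; clear=> /=; lia.
have {hp} hp z : z \in p -> [&& z != u', z != w & z \notin X].
  move=> zp; move/hasPn: hp => /(_ z zp); rewrite !inE !negb_or.
  by case/and3P=> -> -> ->.
exists [:: w, u' & p]; split=> //=.
- by rewrite sp mulnS.
- by rewrite euw ewu pp.
- rewrite up inE negb_or eq_sym u'w andbT /=; apply/andP; split.
    by apply/negP => /hp; rewrite eqxx andbF.
  by apply/negP => /hp; rewrite eqxx.
- rewrite !negb_or wX u'X /=; apply/hasPn => z /hp /and3P [] //.
- by rewrite !inE wT orbT uS' ap lp.
Qed.

End Pruning.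

(** Counting behind [min_degree_bound]: few pairs stay inside the first neighbourhood, so the second
    one satisfies [a n1 <= 4 l nA], hence [a^2 <= 4 l nA]. Then [a nA] exceeds [4 l nH], and too
    many pairs are left between [A] and [B]. *)
Lemma min_degree_arith l a n1 nA nB nH p1H p1v p11 p1B pAH pAN pAB :
  3 <= l -> 20 * l < a -> 16 * l ^ 2 * nH < a ^ 3 -> a <= n1 -> a * n1 <= p1H ->
  p1H <= p1v + p11 + p1B -> p1v <= n1 * 1 -> p11 <= 2 * l * (n1 + n1) ->
  p1B <= 2 * l * (n1 + nA) -> a * nA <= pAH -> pAH <= pAN + pAB ->
  pAN <= 2 * l * (n1 + nA) -> nB <= nH -> 2 * l * (nA + nB) < pAB.
Proof.
move=> l3 la a3 an1 h1 h2 h3 h4 h5 h6 h7 h8 nBH.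
have k1 : a * n1 <= 4 * l * nA by nia.
have k2 : n1 <= nA.
  rewrite leqNgt; apply/negP => lt; have : 20 * l * n1 <= 4 * l * nA by nia.
  by nia.
have k3 : a * a <= 4 * l * nA by apply: leq_trans k1; rewrite leq_mul2l an1 orbT.
have k4 : 4 * l * nH < a * nA.
  have l4 : 0 < 4 * l by lia.
  rewrite -(ltn_pmul2l l4) (_ : 4 * l * (4 * l * nH) = 16 * l ^ 2 * nH); last by ring.
  apply: leq_trans a3 _; rewrite (_ : 4 * l * (a * nA) = a * (4 * l * nA)); last by ring.
  by rewrite expnS expnS expn1 leq_mul2l k3 orbT.
have k5 : l * n1 <= l * nA by rewrite leq_mul2l k2 orbT.
have k6 : l * nB <= l * nH by rewrite leq_mul2l nBH orbT.
have k7 : 20 * l * nA <= a * nA by rewrite leq_mul2r (ltnW la) orbT.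
move: h6 h7 h8 k4 k5 k6 k7; clear; rewrite !mulnDr -!mulnA.
move: (l * n1) (l * nA) (l * nB) (l * nH) (a * nA) => x1 x2 x3 x4 x5; lia.
Qed.

Section CycleFree.
Variables (V : finType) (e : rel V).
Hypotheses (esym : symmetric e) (eirr : irreflexive e).

Definition cycle_hits (m : nat) (Y : {set V}) : Prop :=
  forall c : seq V, size c = m -> uniq c -> cycle e c -> has [in Y] c.

Variables (l : nat) (Y : {set V}).
Hypotheses (l_gt0 : 0 < l) (hitY : cycle_hits (2 * l) Y).

Lemma cycle_nohit (c : seq V) : size c = 2 * l -> uniq c -> cycle e c ->
  all (fun v => v \notin Y) c -> False.
Proof.
by move=> sc uc cc /allP ac; have /hasP [v vc] := hitY sc uc cc; rewrite (negPf (ac v vc)).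
Qed.

(** Otherwise pruning leaves minimum degree [2 l], and a path with [2 l - 2] edges whose two ends
    lie in [S] is closed by [v] to a [2 l]-cycle that avoids [Y]. *)
Lemma pairs_nbrs v (S T : {set V}) : v \notin Y -> S \subset nbrs e v :\: Y ->
  T \subset ~: (v |: Y) -> pairs e S T <= 2 * l * (#|S| + #|T|).
Proof.
move=> vY /subsetP sS /subsetP sT; rewrite leqNgt; apply/negP.
move=> /(prune_bip esym) [S' [T' [/subsetP sS' /subsetP sT' /set0Pn [u uS] HS HT]]].
have [||p [sp pp up hp /andP [ap lp]]] :=
    greedy_path HS HT (m := l.-1) (X := [:: u; v]) uS; first by rewrite inE eqxx.
  by move: l_gt0; clear=> /=; lia.
have hS z : z \in S' -> e v z && (z \notin Y).
  by move=> /sS' /sS; rewrite !inE andbC.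
have := hS u uS => /andP [evu uY].
have := hS _ lp => /andP [evl _].
have vu : v != u by apply: contraTneq evu => ->; rewrite eirr.
move/hasPn: hp => hp.
apply: (@cycle_nohit [:: v, u & p]).
- by rewrite /= sp; move: l_gt0; clear; lia.
- rewrite /= inE negb_or vu up andbT /=; apply/andP; split.
    by apply/negP => /hp; rewrite !inE eqxx orbT.
  by apply/negP => /hp; rewrite !inE eqxx.
- by rewrite /= evu rcons_path pp /= esym evl.
- rewrite /= vY uY /=; apply/allP => z zp; move/allP: ap => /(_ z zp).
  rewrite inE => /orP [/hS /andP [] //|/sT' /sT].
  by rewrite !inE negb_or => /andP [].
Qed.

(* A cycle of length [2l] is closed up through [v] and two distinct parents in
   the first neighbourhood of [v], or, if the parents do not vary, through a
   single parent. *)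
Lemma min_degree_bound (H : {set V}) a : 3 <= l -> [disjoint H & Y] -> H != set0 ->
  (forall u, u \in H -> a <= #|nbrs e u :&: H|) ->
  (a <= 20 * l) || (a ^ 3 <= 16 * l ^ 2 * #|H|).
Proof.
move=> l3 dHY /set0Pn [v vH] Ha; have [//|a_big] := leqP a (20 * l).
rewrite /= leqNgt; apply/negP => a3.
have HY z : z \in H -> z \notin Y by move=> zH; rewrite (disjointFr dHY zH).
pose N1 := nbrs e v :&: H.
have N1a : a <= #|N1| := Ha v vH.
have vN1 : v \notin N1 by rewrite !inE eirr.
(* [A] is the part of [B] at distance two from [v]. *)
pose B := H :\: (v |: N1).
pose A := [set z in B | [exists u in N1, e u z]].
have sN1 : N1 \subset nbrs e v :\: Y.
  by apply/subsetP => z; rewrite !inE => /andP [-> /HY ->].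
have sBv (T : {set V}) : T \subset B -> T \subset ~: (v |: Y).
  move=> sT; apply/subsetP => z /(subsetP sT); rewrite !inE !negb_or.
  by case/andP=> /andP [-> _] /HY ->.
have sN1v : N1 \subset ~: (v |: Y).
  apply/subsetP => z zN; rewrite !inE negb_or; apply/andP; split.
    by apply: contraNneq vN1 => <-.
  by move: zN; rewrite !inE => /andP [_ /HY].
have sAB : A \subset B by apply/subsetP => z; rewrite inE => /andP [].
have sBH : B \subset H by rewrite subsetDl.
have vY : v \notin Y := HY v vH.
have p11 := pairs_nbrs vY sN1 sN1v.
have p1A := pairs_nbrs vY sN1 (sBv A sAB).
have p1B : pairs e N1 B <= pairs e N1 A.
  apply: leq_sum => u uN; apply/subset_leq_card/subsetP => z; rewrite in_setI in_nbrs.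
  case/andP=> euz zB; rewrite in_setI in_nbrs euz inE zB /=.
  by apply/existsP; exists u; rewrite uN euz.
have splitH (T : {set V}) : pairs e T H <= pairs e T [set v] + pairs e T N1 + pairs e T B.
  have -> : H = ([set v] :|: N1) :|: B.
    apply/setP => z; rewrite /B /N1 !inE.
    by have [->|_] := eqVneq z v; rewrite ?vH //=; case: (z \in H); rewrite ?andbF ?andbT //; case: (e v z).
  apply: leq_trans (pairs_Ur e _ _ _) _; rewrite leq_add2r.
  exact: (leq_trans (pairs_Ur e _ _ _)).
have h1 : a * #|N1| <= pairs e N1 H.
  by apply: pairs_ge => u; rewrite inE => /andP [_ /Ha].
have h2 := splitH N1; have h3 := pairs_max e N1 [set v]; rewrite cards1 in h3.
have hA1 : a * #|A| <= pairs e A H by apply: pairs_ge => u uA; exact/Ha/(subsetP sBH)/(subsetP sAB).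
have hA2 := splitH A.
have hAv : pairs e A [set v] = 0.
  rewrite /pairs big1 // => u uA; apply/eqP; rewrite cards_eq0 -subset0.
  apply/subsetP => z; rewrite !inE => /andP [+ /eqP zv]; rewrite zv esym => evu.
  by move: uA; rewrite !inE evu /=; case: (u \in H); rewrite ?andbF //= orbT.
have hA3 : pairs e A N1 <= 2 * l * (#|N1| + #|A|) by rewrite pairsC.
have cB : #|B| <= #|H| := subset_leq_card sBH.
have big : 2 * l * (#|A| + #|B|) < pairs e A B.
  rewrite hAv add0n in hA2.
  exact: (min_degree_arith l3 a_big a3 N1a h1 h2 h3 p11 (leq_trans p1B p1A) hA1 hA2 hA3 cB).
have [S' [T' [/subsetP sS' /subsetP sT' /set0Pn [a0 a0S] HS HT]]] := prune_bip esym big.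
have par z : z \in S' -> exists2 u, u \in N1 & e u z.
  by move=> /sS'; rewrite inE => /andP [_ /existsP [u /andP []]]; exists u.
(* A parent in [N1], fixed once and for all; the default [v] never occurs on [S']. *)
pose pa z := odflt v [pick u in N1 | e u z].
have paP z : z \in S' -> (pa z \in N1) && e (pa z) z.
  move=> zS; rewrite /pa; case: pickP => [u0 -> //|]; have [u uN euz] := par z zS.
  by move=> /(_ u); rewrite uN euz.
have SB z : z \in S' -> z \in B by move=> /sS' /(subsetP sAB).
have TB z : z \in T' -> z \in B by move=> /sT'.
have BN z : z \in B -> (z != v) && (z \notin N1) by rewrite in_setD !in_setU1 negb_or => /andP [].
have BY z : z \in B -> z \notin Y by move=> /(subsetP sBH) /HY.
have NY z : z \in N1 -> z \notin Y by rewrite inE => /andP [_ /HY].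
(* Either some [b] sees two different parents, or parents are constant along walks of length two
   through [T']. *)
have [/existsP [b /existsP [a1 /existsP [a2]]]|mono] :=
  boolP [exists b, exists a1, exists a2, [&& b \in T', a1 \in nbrs e b :&: S',
   a2 \in nbrs e b :&: S' & pa a1 != pa a2]].
- case/and4P=> bT; rewrite !in_setI !in_nbrs => /andP [eb1 a1S] /andP [eb2 a2S] pa12.
  have [|a3'] := @choose_notin _ (nbrs e b :&: S') [:: a1; a2; b].
    by have := HT b bT; move: l3; clear=> /=; lia.
  rewrite in_setI in_nbrs => /andP [eb3 a3S]; rewrite !inE !negb_or => /and3P [a31 a32 a3b].
  have [||p [sp pp up hp /andP [ap lp]]] :=
     greedy_path HS HT (m := l - 3) (X := [:: a3'; a1; a2; b]) a3S.
  + by rewrite inE eqxx.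
  + by move: l3; clear=> /=; lia.
  move/hasPn: hp => hp.
  pose z := last a3' p.
  (* The path from [a3'] ends at [z]; of two different parents at least one is not that of [z]. The
     cycle runs [v], parent of [x], [x], [b], then the path, then the parent of [z]. *)
  have [x xS [ebx paxz xp]] : exists2 x, x \in S' & [/\ e b x, pa x != pa z & (x != a3') && (x \notin p)].
    have [E|ne] := eqVneq (pa a1) (pa z); last first.
      exists a1 => //; split=> //; rewrite eq_sym a31 /=.
      by apply/negP => /hp; rewrite !inE eqxx orbT.
    exists a2 => //; split=> //; first by rewrite -E eq_sym.
    by rewrite eq_sym a32 /=; apply/negP => /hp; rewrite !inE eqxx !orbT.
  have /andP [pxN epx] := paP x xS; have /andP [pzN epz] := paP z lp.
  have pB y : y \in p -> y \in B.
    by move: (allP ap y) => h /h; rewrite inE => /orP [/SB|/TB].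
  have bp : b \notin p by apply/negP => /hp; rewrite !inE eqxx !orbT.
  have notN y w : y \in B -> w \in N1 -> w != y.
    by move=> /BN /andP [_ yN] wN; apply: contraNneq yN => <-.
  have notv y : y \in B -> v != y by move=> /BN /andP []; rewrite eq_sym.
  have vN w : w \in N1 -> v != w by move=> wN; apply: contraNneq vN1 => ->.
  have xb : x != b by apply: contraTneq ebx => ->; rewrite eirr.
  case/andP: xp => xa3 xp.
  apply: (@cycle_nohit (v :: pa x :: x :: b :: a3' :: rcons p (pa z))).
  + by rewrite /= size_rcons sp; move: l3; clear; lia.
  + rewrite /= rcons_uniq !inE !mem_rcons !inE !negb_or up paxz.
    have ba3 : b != a3' by rewrite eq_sym.
    rewrite ba3 bp xb xa3 xp.
    rewrite (vN _ pxN) (vN _ pzN) (notv _ (SB _ xS)) (notv _ (TB _ bT)) (notv _ (SB _ a3S)).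
    rewrite (notN _ _ (SB _ xS) pxN) (notN _ _ (TB _ bT) pxN) (notN _ _ (SB _ a3S) pxN).
    have nz y : y \in B -> y != pa z by move=> yB; rewrite eq_sym notN.
    rewrite (nz _ (SB _ xS)) (nz _ (TB _ bT)) (nz _ (SB _ a3S)).
    have nin w : w \in N1 -> w \notin p.
      by move=> wN; apply/negP => /pB /BN; rewrite wN andbF.
    rewrite (nin _ pxN) (nin _ pzN).
    have -> : v \notin p by apply/negP => /pB /BN; rewrite eqxx.
    have -> : a3' \notin p by apply/negP => /hp; rewrite !inE eqxx.
    by [].
  + rewrite /= !rcons_path last_rcons /= pp -/z epx (esym x b) ebx eb3 (esym z) epz.
    move: pxN pzN; rewrite !in_setI !in_nbrs => /andP [-> _] /andP [evz _].
    by rewrite esym evz.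
  + rewrite /= all_rcons vY (NY _ pxN) (NY _ pzN) (BY _ (SB _ xS)) (BY _ (TB _ bT)) (BY _ (SB _ a3S)) /=.
    by apply/allP => y /pB /BY.
(* Keeping only the vertices with the parent of [a0] costs no degree here, and that common parent
   now closes a path with [2 l - 2] edges. *)
- pose S1 := [set z in S' | pa z == pa a0].
  pose T1 := [set b in T' | [exists z in S1, e z b]].
  have HS1 u : u \in S1 -> 2 * l <= #|nbrs e u :&: T1|.
    move=> uS1; move: (uS1); rewrite inE => /andP [/HS h _]; apply: leq_trans h _.
    apply/subset_leq_card/subsetP => b; rewrite !in_setI in_nbrs => /andP [eub bT].
    rewrite eub inE bT; apply/existsP; exists u; by rewrite uS1 eub.
  have HT1 w : w \in T1 -> 2 * l <= #|nbrs e w :&: S1|.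
    rewrite inE => /andP [wT /existsP [z /andP [zS1 ezw]]].
    apply: leq_trans (HT w wT) _; apply/subset_leq_card/subsetP => y.
    rewrite !in_setI !in_nbrs => /andP [ewy yS]; rewrite ewy inE yS /=.
    move: zS1; rewrite inE => /andP [zS /eqP <-].
    apply: contraNT mono => ne; apply/existsP; exists w; apply/existsP; exists y.
    by apply/existsP; exists z; rewrite wT !in_setI !in_nbrs ewy yS zS (esym w z) ezw.
  have a0S1 : a0 \in S1 by rewrite inE a0S eqxx.
  have [||p [sp pp up hp /andP [ap lp]]] :=
     greedy_path HS1 HT1 (m := l.-1) (X := [:: a0]) a0S1.
  + by rewrite inE.
  + by move: l_gt0; clear=> /=; lia.
  move/hasPn: hp => hp.
  have /andP [pN ep] := paP a0 a0S.
  have lpa : e (last a0 p) (pa a0).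
    move: lp; rewrite inE => /andP [zS /eqP <-].
    by have /andP [_] := paP _ zS; rewrite esym.
  have pB y : y \in p -> y \in B.
    move: (allP ap y) => h /h; rewrite inE => /orP []; rewrite inE => /andP [].
      by move=> /SB.
    by move=> /TB.
  apply: (@cycle_nohit (pa a0 :: a0 :: p)).
  + by rewrite /= sp; move: l_gt0; clear; lia.
  + rewrite /= inE negb_or up andbT -andbA; apply/and3P; split.
    * by apply: contraTneq pN => ->; have /andP [] := BN _ (SB _ a0S).
    * by apply/negP => /pB /BN; rewrite pN andbF.
    * by apply/negP => /hp; rewrite inE eqxx.
  + by rewrite /= ep rcons_path pp lpa.
  + rewrite /= (NY _ pN) (BY _ (SB _ a0S)) /=.
    by apply/allP => y /pB /BY.
Qed.

End CycleFree.

(** * Disjoint cycles *)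

Section Packing.
Variables (V : finType) (e : rel V).
Hypotheses (esym : symmetric e) (eirr : irreflexive e).

(** Uniqueness of the flattened list says both that no cycle repeats a vertex and that the cycles
    are disjoint. *)
Definition packing (m t : nat) : Prop :=
  exists cs : seq (seq V), [/\ size cs = t,
    all (fun c => (size c == m) && cycle e c) cs & uniq (flatten cs)].

Lemma packing0 m : packing m 0.
Proof. by exists [::]. Qed.

Lemma size_flatten_const m (cs : seq (seq V)) :
  all (fun c => size c == m) cs -> size (flatten cs) = size cs * m.
Proof.
elim: cs => //= c cs IH /andP [/eqP sc /IH]; rewrite size_cat mulSn => ->.
by rewrite sc.
Qed.

Lemma packing_hits m t (cs : seq (seq V)) : ~ packing m t.+1 -> size cs = t ->
  all (fun c => (size c == m) && cycle e c) cs -> uniq (flatten cs) ->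
  cycle_hits e m [set v in flatten cs].
Proof.
move=> np sc ac uc c szc ucc cc; apply: contra_notT np => /hasPn nh.
exists (c :: cs); split; [by rewrite /= sc | by rewrite /= szc eqxx cc |].
rewrite /= cat_uniq ucc uc andbT /=; apply/hasPn => v vcs.
by apply/negP => /nh; rewrite inE vcs.
Qed.

Fixpoint alt (ks us : seq V) : seq V :=
  match ks, us with
  | a :: ks', u :: us' => [:: a, u & alt ks' us']
  | _, _ => [::]
  end.

Lemma perm_alt ks us : size ks = size us -> perm_eq (alt ks us) (ks ++ us).
Proof.
elim: ks us => [|a ks IH] [|u us] //= [/IH {}IH].
by rewrite perm_cons perm_sym -cat1s perm_catCA /= perm_cons perm_sym.
Qed.

Lemma size_alt ks us : size ks = size us -> size (alt ks us) = 2 * size us.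
Proof. by move=> E; rewrite (perm_size (perm_alt E)) size_cat E mul2n addnn. Qed.

Variables (K U : {set V}).
Hypothesis KU : forall a u, a \in K -> u \in U -> e a u.

Lemma alt_path x ks us : size ks = size us -> all [in K] ks -> all [in U] us ->
  x \in U -> path e x (alt ks us) && (last x (alt ks us) \in U).
Proof.
elim: ks us x => [|a ks IH] [|u us] x //= [sz] /andP [aK aks] /andP [uU aus] xU.
by rewrite esym !KU //= IH.
Qed.

Lemma alt_cycle a0 u p ks us : size ks = size us -> all [in K] (a0 :: ks) ->
  all [in U] us -> u \in U -> path e u p -> last u p \in U ->
  cycle e (a0 :: u :: p ++ alt ks us).
Proof.
move=> sz /= /andP [a0K aks] aus uU pp lp.
have /andP [pa la] := alt_path sz aks aus lp.
by rewrite KU //= rcons_path cat_path pp pa last_cat esym KU.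
Qed.

(** Cut both lists into blocks of length [l] and alternate inside each block. *)
Lemma std_packing l m ks us : 0 < l -> size ks = l * m -> size us = l * m ->
  all [in K] ks -> all [in U] us ->
  exists cs, [/\ size cs = m, all (fun c => (size c == 2 * l) && cycle e c) cs &
    perm_eq (flatten cs) (ks ++ us)].
Proof.
move=> l0; elim: m ks us => [|m IH] ks us.
  by rewrite muln0 => /size0nil -> /size0nil ->; exists [::].
rewrite mulnS => sk su ak au.
have [||||cs [scs acs pcs]] := IH (drop l ks) (drop l us).
- by rewrite size_drop sk addKn.
- by rewrite size_drop su addKn.
- by apply/allP => x /mem_drop /(allP ak).
- by apply/allP => x /mem_drop /(allP au).
have tk : size (take l ks) = l by rewrite size_takel // sk leq_addr.
have tu : size (take l us) = l by rewrite size_takel // su leq_addr.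
case Ek : (take l ks) => [|a ks1]; first by move: l0; rewrite -tk Ek.
case Eu : (take l us) => [|u us1]; first by move: l0; rewrite -tu Eu.
have ak1 : all [in K] (a :: ks1) by rewrite -Ek; apply/allP => x /mem_take /(allP ak).
have : all [in U] (u :: us1) by rewrite -Eu; apply/allP => x /mem_take /(allP au).
move=> /= /andP [uU aus1].
have sz : size ks1 = size us1 by move: tk; rewrite -[RHS]tu Ek Eu => -[].
exists ((a :: u :: alt ks1 us1) :: cs); split; first by rewrite /= scs.
- rewrite /= acs andbT size_alt //.
  have cyc : cycle e (a :: u :: alt ks1 us1).
    exact: (@alt_cycle a u [::] ks1 us1 sz ak1 aus1 uU isT uU).
  rewrite /= in cyc; rewrite cyc andbT.
  by move: tu; rewrite Eu /=; clear=> <-; rewrite mulnS.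
- rewrite -[in X in perm_eq _ X](cat_take_drop l ks) -[in X in perm_eq _ X](cat_take_drop l us).
  rewrite Ek Eu perm_sym perm_catACA perm_sym.
  apply: perm_cat => //; rewrite /= perm_cons -cat1s perm_sym perm_catC /=.
  rewrite perm_cons perm_catC perm_sym.
  exact: perm_alt.
Qed.

(** The path [p] may supply vertices outside [K :|: U], or edges inside [U], so that this one cycle
    gets by with fewer than [l] vertices of [K]; the other [t] cycles alternate. *)
Lemma special_packing l t a0 u p ks us ks' us' : 0 < l ->
  size ks = size us -> 2 + size p + 2 * size us = 2 * l ->
  size ks' = l * t -> size us' = l * t ->
  all [in K] (a0 :: ks ++ ks') -> all [in U] (u :: us ++ us') ->
  path e u p -> last u p \in U ->
  uniq (a0 :: u :: p ++ (ks ++ us) ++ (ks' ++ us')) -> packing (2 * l) t.+1.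
Proof.
move=> l0 sz sl sk su /=; rewrite !all_cat => /and3P [a0K ak ak'] /and3P [uU au au'] pp lp un.
have [cs [scs acs pcs]] := std_packing l0 sk su ak' au'.
exists ((a0 :: u :: p ++ alt ks us) :: cs); split; first by rewrite /= scs.
- rewrite /= acs size_cat size_alt // andbT.
  have cyc : cycle e (a0 :: u :: p ++ alt ks us) by apply: alt_cycle => //=; rewrite a0K ak.
  rewrite /= in cyc; rewrite cyc; by rewrite andbT -sl !addSn add0n.
- rewrite (perm_uniq (s2 := a0 :: u :: p ++ (ks ++ us) ++ (ks' ++ us'))) //=.
  rewrite !perm_cons -catA perm_cat2l; apply: perm_cat => //.
  exact: perm_alt.
Qed.

End Packing.

(** * Bicliques and vertices with many neighbours in a small set *)

Section CommonNeighbours.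
Variables (V : finType) (e : rel V).
Hypotheses (esym : symmetric e) (eirr : irreflexive e).

Lemma biclique_packing l t (K U : {set V}) : 0 < l ->
  (forall a u, a \in K -> u \in U -> e a u) ->
  l * t <= #|K| -> l * t <= #|U| -> packing e (2 * l) t.
Proof.
move=> l0 KU cK cU.
have [||||cs [scs acs pcs]] := std_packing esym KU (l := l) (m := t)
   (ks := take (l * t) (enum K)) (us := take (l * t) (enum U)) l0.
- by rewrite size_takel // -cardE.
- by rewrite size_takel // -cardE.
- by apply/allP => x /mem_take; rewrite mem_enum.
- by apply/allP => x /mem_take; rewrite mem_enum.
exists cs; split=> //; rewrite (perm_uniq pcs) cat_uniq !take_uniq ?enum_uniq //= andbT.
apply/hasPn => x /mem_take; rewrite mem_enum => xU.
by apply/negP => /mem_take; rewrite mem_enum => xK; have := KU _ _ xK xU; rewrite eirr.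
Qed.

(** Pigeonhole over the traces on [D]: [l t] vertices sharing a trace of size at least [l t] form a
    biclique with it, which contains [t] disjoint cycles. *)
Lemma few_rich_vertices l t (D : {set V}) : 0 < l -> ~ packing e (2 * l) t ->
  #|[set u | l * t <= #|nbrs e u :&: D|]| <= l * t * 2 ^ #|D|.
Proof.
move=> l0 np; rewrite leqNgt; apply/negP => lt.
set X := [set u | _] in lt.
have E : #|X| = \sum_(S in powerset D) #|[set u in X | nbrs e u :&: D == S]|.
  rewrite -sum1_card (partition_big (fun u => nbrs e u :&: D) [in powerset D]) /=.
    by apply: eq_bigr => S _; rewrite -sum1_card; apply: eq_bigl => u; rewrite !inE.
  by move=> u _; rewrite powersetE subsetIr.
have [/existsP [S /andP [SD hS]]|] := boolP [exists S : {set V},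
   (S \in powerset D) && (l * t <= #|[set u in X | nbrs e u :&: D == S]|)].
  case: np; apply: (biclique_packing (K := S) (U := [set u in X | nbrs e u :&: D == S])) => //.
  - move=> a u aS; rewrite inE => /andP [_ /eqP E2]; by move: aS; rewrite -E2 in_setI in_nbrs esym => /andP [].
  - move: hS; set F := [set u in X | _]; case: (set_0Vmem F) => [->|[u]].
      by rewrite cards0 leqn0 => /eqP ->.
    by rewrite !inE => /andP [h /eqP <-].
rewrite negb_exists => /forallP H; move: lt; apply/negP; rewrite -leqNgt E.
rewrite mulnC -card_powerset -sum_nat_const; apply: leq_sum => S SD.
by have := H S; rewrite SD /= -ltnNge; exact: ltnW.
Qed.
End CommonNeighbours.

(** * Copies of cycles as lists of vertices *)

Section Conversion.
Variables (V : finType) (e : rel V).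

Lemma cycle_nthP (x0 : V) (c : seq V) : 0 < size c ->
  reflect (forall i, i < size c -> e (nth x0 c i) (nth x0 c (i.+1 %% size c))) (cycle e c).
Proof.
case: c => // x p _; apply: (iffP (pathP x0)); rewrite size_rcons.
  move=> H i lt; have := H i lt; rewrite -rcons_cons nth_rcons /= lt.
  rewrite nth_rcons; move: lt; rewrite /= ltnS leq_eqVlt => /predU1P [->|lt].
    by rewrite ltnn eqxx modnn.
  by rewrite lt modn_small.
move=> H i lt; have := H i lt; rewrite -rcons_cons nth_rcons /= lt.
rewrite nth_rcons; move: lt; rewrite /= ltnS leq_eqVlt => /predU1P [->|lt].
  by rewrite ltnn eqxx modnn.
by rewrite lt modn_small.
Qed.
End Conversion.

Lemma contains_packing (G : sgraph) (t m : nat) : 2 < m ->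
  sg_contains G (copies t (cycle_graph m)) <-> packing (@adj G) m t.
Proof.
move=> m2; split.
- case=> f finj fadj.
  pose c (i : 'I_t) := [seq f (i, j) | j <- enum 'I_m].
  exists [seq c i | i <- enum 'I_t]; split.
  + by rewrite size_map size_enum_ord.
  + apply/allP => _ /mapP [i _ ->]; rewrite /c size_map size_enum_ord eqxx /=.
    have m0 : 0 < m by lia.
    pose j0 : 'I_m := Ordinal m0.
    apply/(cycle_nthP _ (f (i, j0))); rewrite size_map size_enum_ord // => a lt.
    rewrite (nth_map j0) ?size_enum_ord // (nth_map j0) ?size_enum_ord ?ltn_mod //.
    apply: fadj; rewrite /= /copies_adj /= eqxx /cycle_adj /=.
    have lt' : a.+1 %% m < m by rewrite ltn_mod.
    rewrite (nth_ord_enum j0 (Ordinal lt)) (nth_ord_enum j0 (Ordinal lt')) /= eqxx andbT.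
    rewrite -(inj_eq val_inj) /=; apply/eqP => E; move: E.
    move: lt; rewrite leq_eqVlt => /predU1P [E|lt2]; last by rewrite modn_small //; lia.
    by rewrite E modnn; lia.
  + rewrite -[flatten _]/(flatten [seq [seq f (i, j) | j <- enum 'I_m] | i <- enum 'I_t]).
    apply: allpairs_uniq_dep => [|i _|]; rewrite ?enum_uniq //.
    by move=> [i j] [i' j'] _ _ /= /finj [-> ->].
- case=> cs [sc ac uc].
  case: t sc => [|t] sc.
    exists (fun p : copies 0 (cycle_graph m) => match p with (i, _) => match (i : 'I_0) with Ordinal _ h => False_rect _ (notF h) end end); by case=> [[]].
  have [x0 _] : exists x0 : G, true.
    case: cs sc ac uc => //= c cs _ /andP [/andP [/eqP sz _] _] _.
    by case: c sz m2 => [<-|x c] //; exists x.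
  pose f (p : copies t.+1 (cycle_graph m)) : G := nth x0 (nth [::] cs (p.1 : 'I_t.+1)) (p.2 : 'I_m).
  have szc (i : 'I_t.+1) : size (nth [::] cs i) = m.
    by apply/eqP; have := all_nthP [::] ac i; rewrite sc ltn_ord => /(_ isT) /andP [].
  have cc (i : 'I_t.+1) : cycle (@adj G) (nth [::] cs i).
    by have := all_nthP [::] ac i; rewrite sc ltn_ord => /(_ isT) /andP [].
  have shc : shape cs = nseq t.+1 m.
    rewrite -sc /shape; elim: cs ac {sc uc f szc cc} => //= c cs IH /andP [/andP [/eqP -> _] /IH ->] //.
  exists f.
  + move=> [i j] [i' j'] /= E.
    have bnd (a : 'I_t.+1) (b : 'I_m) : b < nth 0 (shape cs) a by rewrite shc nth_nseq ltn_ord.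
    (* Injectivity is read off the positions in the flattened list, which has no duplicates. *)
    have fl (a : 'I_t.+1) (b : 'I_m) : f (a, b) = nth x0 (flatten cs) (flatten_index (shape cs) a b).
      by rewrite nth_flatten flatten_indexKl ?flatten_indexKr ?bnd.
    move: E; rewrite !fl => /eqP; rewrite nth_uniq ?size_flatten ?flatten_indexP ?bnd // => /eqP E.
    have := congr1 (reshape_index (shape cs)) E; have := congr1 (reshape_offset (shape cs)) E.
    rewrite !flatten_indexKl ?flatten_indexKr ?bnd //.
    by move=> /val_inj -> /val_inj ->.
  + move=> [i j] [i' j'] /= /andP [/= /eqP <- /andP [_]].
    have H := cycle_nthP (@adj G) x0 (c := nth [::] cs i); rewrite szc in H.
    have m0 : 0 < m by lia.
    have {}H := elimT (H m0) (cc i).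
    case/orP => /eqP E; rewrite /f /= -E; first exact: H.
    by rewrite adj_sym; exact: H.
Qed.

(** * Graphs in which every long cycle uses many vertices of [K] *)

Section Cover.
Variables (V : finType) (e : rel V).
Hypotheses (esym : symmetric e) (eirr : irreflexive e).

(** More than [l] hits fall into the [l] blocks of positions [2 j] and [2 j + 1]. *)
Lemma two_adjacent (P : pred V) x0 l c : size c = 2 * l -> l < count P c ->
  exists2 j, j < l & P (nth x0 c (2 * j)) && P (nth x0 c (2 * j).+1).
Proof.
elim: l c => [|l IH] c; first by rewrite muln0 => /size0nil ->.
case: c => [|x [|y c]]; rewrite ?mulnS //= => -[sc].
have [Pxy _|nP lt] := boolP (P x && P y); first by exists 0 => //; rewrite muln0.
have [|j jl Pj] := IH c sc; first by move: nP lt; case: (P x); case: (P y) => //= _; clear; lia.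
by exists j.+1 => //; rewrite mulnS.
Qed.

Lemma count_card (K : {set V}) (s : seq V) : uniq s -> count [in K] s <= #|K|.
Proof.
move=> us; rewrite -size_filter; have uf := filter_uniq [in K] us.
rewrite -(card_uniqP uf) subset_leq_card //; apply/subsetP => x.
by rewrite mem_filter => /andP [].
Qed.

Lemma cover_free l t (K : {set V}) : #|K| < l * t ->
  (forall c, size c = 2 * l -> uniq c -> cycle e c -> l <= count [in K] c) ->
  ~ packing e (2 * l) t.
Proof.
move=> cK H [cs [sc ac uc]]; move: cK; apply/negP; rewrite -leqNgt.
apply: leq_trans (count_card K uc); rewrite -sc {sc t}.
elim: cs ac uc => [|c cs IH] /=; first by rewrite muln0.
case/andP=> /andP [/eqP sz cc] acs; rewrite cat_uniq => /and3P [uc _ ucs].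
by rewrite mulnS count_cat leq_add ?H ?IH.
Qed.

(** The edges of an even cycle split into two perfect matchings. More than half of the vertices lie
    outside [K], so each matching has an edge outside [K]: apply [two_adjacent] to [c] and to its
    rotation. *)
Lemma cycle_outside_edges l (K : {set V}) x0 c : 0 < l -> size c = 2 * l -> cycle e c ->
  count [in K] c < l -> exists i j, [/\ i < l, j < l,
    [&& nth x0 c (2 * i) \notin K, nth x0 c (2 * i).+1 \notin K &
     e (nth x0 c (2 * i)) (nth x0 c (2 * i).+1)] &
    [&& nth x0 c (2 * j).+1 \notin K, nth x0 c ((2 * j).+2 %% (2 * l)) \notin K &
     e (nth x0 c (2 * j).+1) (nth x0 c ((2 * j).+2 %% (2 * l)))]].
Proof.
move=> l0 sc cc ck.
have s0 : 0 < size c by rewrite sc muln_gt0.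
have cx : l < count (predC [in K]) c by have := count_predC [in K] c; rewrite sc; lia.
have ed := elimT (cycle_nthP e x0 s0) cc; rewrite sc in ed.
have [i il /andP [i1 i2]] := two_adjacent x0 sc cx.
have sr : size (rot 1 c) = 2 * l by rewrite size_rot.
have cr : l < count (predC [in K]) (rot 1 c) by have /permP -> := permEl (perm_rot 1 c).
have [j jl /andP [j1 j2]] := two_adjacent x0 sr cr.
have nr a : a < 2 * l -> nth x0 (rot 1 c) a = nth x0 c (a.+1 %% (2 * l)).
  move: sc s0; case: (c) => //= x c' sc _ la.
  rewrite /rot /= drop0 take0 nth_cat.
  move: sc; rewrite -cat1s /= => sc; case: ltnP => h.
    by rewrite modn_small //= -?sc ?ltnS.
  have -> : a = size c' by move: la; rewrite -sc; lia.
  by rewrite subnn sc modnn.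
rewrite !nr in j1 j2; last 2 first; [by lia | by lia |].
have E1 : (2 * j).+1 %% (2 * l) = (2 * j).+1 by rewrite modn_small //; lia.
rewrite E1 in j1; rewrite /= in i1 i2 j1 j2.
exists i, j; split=> //; rewrite ?i1 ?i2 ?j1 ?j2 /=.
  have E2 : (2 * i).+1 %% (2 * l) = (2 * i).+1 by rewrite modn_small //; clear -il; lia.
  have i2l : 2 * i < 2 * l by clear -il; lia.
  by have := ed _ i2l; rewrite E2.
by apply: ed; clear -jl; lia.
Qed.

(** A cycle with fewer than [l] vertices in [K] has outside edges in both of its perfect matchings;
    these are different edges, but only one edge is available. *)
Lemma one_edge_free l t (K : {set V}) u0 v0 : 3 <= l -> #|K| < l * t ->
  (forall u v, u \notin K -> v \notin K -> e u v ->
    (u == u0) && (v == v0) || (u == v0) && (v == u0)) -> ~ packing e (2 * l) t.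
Proof.
move=> l3 cK H; apply: (cover_free cK) => c sc uc cc; rewrite leqNgt; apply/negP => lt.
have l0 : 0 < l by lia.
have [i [j [il jl /and3P [i1 i2 ei] /and3P [j1 j2 ej]]]] := cycle_outside_edges u0 l0 sc cc lt.
have nE a b : a < 2 * l -> b < 2 * l -> (nth u0 c a == nth u0 c b) = (a == b).
  by move=> la lb; rewrite nth_uniq ?sc.
have l2 : 0 < 2 * l by rewrite muln_gt0.
have ml : (2 * j).+2 %% (2 * l) < 2 * l by rewrite ltn_mod.
have [bi bi1 bj1] : [/\ 2 * i < 2 * l, (2 * i).+1 < 2 * l & (2 * j).+1 < 2 * l].
  by clear -il jl; split; lia.
have E : (2 * i = (2 * j).+1) \/ (2 * i).+1 = (2 * j).+1 /\ 2 * i = (2 * j).+2 %% (2 * l).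
  have h1 := H _ _ i1 i2 ei; have h2 := H _ _ j1 j2 ej.
  case/orP: h1 => /andP [/eqP a1 /eqP a2]; case/orP: h2 => /andP [/eqP b1 /eqP b2].
  - by left; apply/eqP; rewrite -nE ?a1 ?b1.
  - by right; split; apply/eqP; rewrite -nE ?a1 ?b1 ?a2 ?b2.
  - by right; split; apply/eqP; rewrite -nE ?a1 ?b1 ?a2 ?b2.
  - by left; apply/eqP; rewrite -nE ?a1 ?b1.
move: E l3 jl; clear => E l3 jl.
have [E2|lt] : (2 * j).+2 = 2 * l \/ (2 * j).+2 < 2 * l by lia.
  by move: E; rewrite E2 modnn; lia.
by move: E; rewrite modn_small //; lia.
Qed.

(** In a 4-cycle, edges taken from the two perfect matchings share a vertex, and their other ends
    are distinct. *)
Lemma matching_free t (K : {set V}) : #|K| < 2 * t ->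
  (forall u v w, u \notin K -> v \notin K -> w \notin K -> e u v -> e u w -> v = w) ->
  ~ packing e (2 * 2) t.
Proof.
move=> cK H; apply: (cover_free cK) => c sc uc cc; rewrite leqNgt; apply/negP => lt.
have [x0 _] : exists x0 : V, true by case: c sc {uc cc lt} => // x; exists x.
have [i [j [il jl /and3P [i1 i2 ei] /and3P [j1 j2 ej]]]] := @cycle_outside_edges 2 K x0 c isT sc cc lt.
move: uc {cc lt}; case: c sc i1 i2 ei j1 j2 ej => [|a [|b [|c [|d []]]]] //= _.
move=> i1 i2 ei j1 j2 ej; rewrite !inE !negb_or => /and3P [/and3P [ab ac ad] /andP [bc bd] /andP [cd _]].
case: i il i1 i2 ei => [|[|//]] _; case: j jl j1 j2 ej => [|[|//]] _ /= j1 j2 ej i1 i2 ei.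
- by rewrite esym in ei; have := H _ _ _ i2 i1 j2 ei ej => E; rewrite E eqxx in ac.
- by rewrite esym in ej; have := H _ _ _ i1 i2 j1 ei ej => E; rewrite E eqxx in bd.
- by rewrite esym in ej; have := H _ _ _ i1 i2 j1 ei ej => E; rewrite E eqxx in bd.
- by rewrite esym in ei; have := H _ _ _ i2 i1 j2 ei ej => E; rewrite E eqxx in ac.
Qed.

End Cover.

(** * Walks weighted by a Perron vector *)

Local Open Scope ring_scope.

Section RealTools.
Variable R : archiRealFieldType.

Lemma nat_above (c : R) : exists N : nat, c <= N%:R.
Proof.
exists (Num.Def.archi_bound `|c|); apply: le_trans (ler_norm c) _.
by apply: ltW; apply: archi_boundP.
Qed.
End RealTools.

Section Walks.
Variables (R : archiRealFieldType) (V : finType) (e : rel V).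
Hypotheses (esym : symmetric e) (eirr : irreflexive e).
Variables (r : R) (x : V -> R).
Hypothesis Px : perron e r x.
Local Notation n := #|V|.
Implicit Types (S T D Y : {set V}) (u v w : V).

(** With [S] the neighbourhood of [v], this weighs the walks of length two from [v] by their end in
    [T]. *)
Definition wsum S T : R := \sum_(u in S) \sum_(w in nbrs e u :&: T) x w.

Lemma perron_ge0 v : 0 <= x v. Proof. by case: Px => /(_ v) /andP []. Qed.
Lemma perron_le1 v : x v <= 1. Proof. by case: Px => /(_ v) /andP []. Qed.

Lemma nbsum_nbrs v : nbsum e x v = \sum_(u in nbrs e v) x u.
Proof. by apply: eq_bigl => u; rewrite in_nbrs. Qed.

Lemma perron_eig v : \sum_(u in nbrs e v) x u = r * x v.
Proof. by rewrite -nbsum_nbrs; case: Px. Qed.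

Lemma sum_le_card (T : {set V}) c : (forall w, w \in T -> x w <= c) ->
  \sum_(w in T) x w <= c * #|T|%:R.
Proof.
move=> H; rewrite -sum1_card natr_sum mulr_sumr; apply: ler_sum => w wT.
by rewrite mulr1 H.
Qed.

Lemma sum_setS S T : S \subset T -> \sum_(w in S) x w <= \sum_(w in T) x w.
Proof.
move=> sST; rewrite [leRHS](big_setID S) /= (setIidPr sST) lerDl.
by apply: sumr_ge0 => w _; exact: perron_ge0.
Qed.

Lemma rx_le_deg v : r * x v <= #|nbrs e v|%:R.
Proof. by rewrite -perron_eig -[leRHS]mul1r sum_le_card // => w _; exact: perron_le1. Qed.

Lemma perron_r_ge0 : 0 <= r.
Proof.
case: Px => _ [v xv] _ _; rewrite -[r]mulr1 -xv -perron_eig.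
by apply: sumr_ge0 => w _; exact: perron_ge0.
Qed.

Lemma perron_r_le : r <= n%:R.
Proof.
case: Px => _ [v xv] _ _; have := rx_le_deg v; rewrite xv mulr1 => /le_trans; apply.
by rewrite ler_nat max_card.
Qed.

Lemma two_walks v : r ^+ 2 * x v = wsum (nbrs e v) setT.
Proof.
rewrite /wsum expr2 -mulrA -perron_eig mulr_sumr; apply: eq_bigr => u _.
by rewrite setIT perron_eig.
Qed.

Lemma wsum_le S T c : (forall w, w \in T -> x w <= c) -> wsum S T <= c * (pairs e S T)%:R.
Proof.
move=> H; rewrite /wsum /pairs natr_sum mulr_sumr; apply: ler_sum => u uS.
by apply: sum_le_card => w; rewrite inE => /andP [_ /H].
Qed.

Lemma wsum_le1 S T : wsum S T <= (pairs e S T)%:R.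
Proof. by rewrite -[leRHS]mul1r wsum_le // => w _; exact: perron_le1. Qed.

Lemma wsum_splitr S D : wsum S setT = wsum S D + wsum S (~: D).
Proof.
rewrite /wsum -big_split /=; apply: eq_bigr => u _.
by rewrite setIT [LHS](big_setID D) /= -setDE.
Qed.

Lemma wsum_splitl S Y T : wsum S T = wsum (S :&: Y) T + wsum (S :\: Y) T.
Proof. by rewrite /wsum (big_setID Y). Qed.

Lemma wsum_leset S S' T T' : S \subset S' -> T \subset T' -> wsum S T <= wsum S' T'.
Proof.
move=> sS sT; apply: (@le_trans _ _ (wsum S T')).
  by apply: ler_sum => u _; apply: sum_setS; exact: setIS.
rewrite /wsum [leRHS](big_setID S) /= (setIidPr sS) lerDl.
by apply: sumr_ge0 => u _; apply: sumr_ge0 => w _; exact: perron_ge0.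
Qed.

Lemma cauchy_sum (A : {set V}) (f : V -> R) :
  (\sum_(u in A) f u) ^+ 2 <= #|A|%:R * \sum_(u in A) f u ^+ 2.
Proof.
set s := \sum_(u in A) f u; set q := \sum_(u in A) f u ^+ 2.
have [A0|A0] := posnP #|A|.
  by rewrite A0 mul0r /s (cards0_eq A0) big_set0 expr0n.
have a0 : 0 < #|A|%:R :> R by rewrite ltr0n.
have : 0 <= \sum_(u in A) (#|A|%:R * f u - s) ^+ 2 by apply: sumr_ge0 => u _; exact: sqr_ge0.
have -> : \sum_(u in A) (#|A|%:R * f u - s) ^+ 2 =
   #|A|%:R ^+ 2 * q - 2 * s * #|A|%:R * s + s ^+ 2 * #|A|%:R.
  rewrite (eq_bigr (fun u => #|A|%:R ^+ 2 * f u ^+ 2 + (- (2 * s * #|A|%:R)) * f u + s ^+ 2)).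
    by rewrite !big_split /= -!mulr_sumr sumr_const -/s -/q -[s *+ _]mulr_natr; ring.
  by move=> u _; ring.
have -> : #|A|%:R ^+ 2 * q - 2 * s * #|A|%:R * s + s ^+ 2 * #|A|%:R = #|A|%:R * (#|A|%:R * q - s ^+ 2).
  by ring.
by rewrite pmulr_rge0 // subr_ge0.
Qed.

(** Let [y] be [x] without its entry at [v]. Cauchy-Schwarz gives [r^2 x_v^2 <= n |y|^2], the bound
    on [y] gives [r |y|^2 <= r' |y|^2 + r x_v^2]; eliminate [x_v^2]. *)
Lemma delete_vertex v r' : 0 < r ->
  (forall y : V -> R, y v = 0 -> quad e y <= r' * sqnorm y) -> r ^+ 2 <= n%:R + r * r'.
Proof.
move=> r0 H.
pose y u := if u == v then 0 else x u.
have xy u : x u = y u + x v * (u == v)%:R.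
  by rewrite /y; case: eqP => [->|]; rewrite ?mulr1 ?mulr0 ?add0r ?addr0.
have Eq : quad e x = quad e y + x v * (nbsum e y v *+ 2).
  transitivity (quad e (fun u => y u + x v * (u == v)%:R)).
    by apply: eq_bigr => u _; rewrite xy /nbsum; congr (_ * _); apply: eq_bigr => w _; rewrite xy.
  by rewrite quad_cross // eirr mulr0 addr0.
have nby : nbsum e y v = r * x v.
  rewrite -perron_eig -nbsum_nbrs; apply: eq_bigr => u; rewrite /y; case: eqP => // ->.
  by rewrite eirr.
have yv : y v = 0 by rewrite /y eqxx.
have En : sqnorm x = sqnorm y + x v ^+ 2.
  rewrite /sqnorm (bigD1 v) //= [X in _ = X + _](bigD1 v) //= yv expr0n /= add0r addrC.
  by congr (_ + _); apply: eq_bigr => u /negPf uv; rewrite /y uv.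
have := H y yv; set z := sqnorm y in En *; set s := x v ^+ 2 in En.
have cs : r ^+ 2 * s <= n%:R * z.
  have -> : r ^+ 2 * s = (nbsum e y v) ^+ 2 by rewrite nby /s; ring.
  rewrite /nbsum; have -> : \sum_(u | e v u) y u = \sum_(u in nbrs e v) y u.
    by apply: eq_bigl => u; rewrite in_nbrs.
  apply: le_trans (cauchy_sum _ _) _; apply: ler_pM => //.
  - by apply: sumr_ge0 => u _; exact: sqr_ge0.
  - by rewrite ler_nat max_card.
  - rewrite /z /sqnorm [leRHS](bigID [in nbrs e v]) /= lerDl.
    by apply: sumr_ge0 => u _; exact: sqr_ge0.
have E1 := perron_eig_quad Px; rewrite Eq En nby in E1.
have X0 := perron_sqnorm_gt0 Px; rewrite En in X0.
have s0 : 0 <= s by exact: sqr_ge0.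
have z0 : 0 <= z by exact: sqnorm_ge0.
move=> Hq; have E2 : r * z <= r' * z + r * s.
  have : quad e y + x v * ((r * x v) *+ 2) = quad e y + 2 * (r * s) by rewrite /s; ring.
  by move=> E; rewrite E in E1; nra.
have z1 : 0 < z.
  rewrite lt0r z0 andbT; apply/eqP => Z; rewrite Z mulr0 in cs; rewrite Z add0r in X0.
  have : 0 < r ^+ 2 * s by rewrite mulr_gt0 // exprn_gt0.
  by rewrite ltNge cs.
have E3 : r * (r * z) <= r * (r' * z + r * s) by rewrite ler_wpM2l // ltW.
rewrite -(ler_pM2r z1); move: cs E3; rewrite expr2; lra.
Qed.

End Walks.

(** * The asymptotic bound *)

Section SpectralBound.
Variable R : archiRealFieldType.

Definition has_perron : Prop := forall (V : finType) (e : rel V), symmetric e ->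
  irreflexive e -> (0 < #|V|)%N -> exists (r : R) (x : V -> R), perron e r x.

(** The [k] of the overview. The subtraction is made in the field, so the value at [t = 0] is
    [-1]. *)
Definition tight (l t : nat) : R := (l * t)%:R - 1.

(** Makes [(k + 1) (2 d)] at most [1/2] in [gap_contra], where [d] is this number. *)
Definition slack (l t : nat) : R := (4%:R * (tight l t + 3%:R))^-1.

Definition spec_bound (l t : nat) : Prop :=
  forall eps : R, 0 < eps -> exists B : R, forall (V : finType) (e : rel V),
    symmetric e -> irreflexive e -> ~ packing e (2 * l) t ->
    forall r x, perron e r x -> r ^+ 2 <= (tight l t + eps) * #|V|%:R + B.

(** The term [n - deg v] pays, for [l = 2], for one walk to each vertex outside [D]; for [l >= 3] it
    is only used as a nonnegative number. *)
Definition dominated (l t : nat) : Prop :=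
  forall eps : R, 0 < eps -> exists M N : nat, forall (V : finType) (e : rel V),
    symmetric e -> irreflexive e -> ~ packing e (2 * l) t ->
    forall r x, perron e r x -> (N <= #|V|)%N ->
    (tight l t - slack l t) * #|V|%:R <= r ^+ 2 ->
    forall v, exists2 D : {set V}, (#|D| <= M)%N &
      r ^+ 2 * x v <= wsum e x (nbrs e v) D + (#|V|%:R - #|nbrs e v|%:R) + eps * #|V|%:R.

(** Here [a] is [r^2], and the last hypothesis is [delete_vertex] squared, with the bound for one
    copy less; [k - 2] appears because [l >= 2]. For [a] near [k n] the leading coefficients are
    [(k - 1)^2] and [k (k - 2)], which differ by one, while the errors amount to at most [3/4] of
    [n^2]. *)
Lemma gap_contra (k n a B : R) : 3%:R <= k -> 0 <= B -> 8%:R * (k + 2%:R) * B + 1 <= n ->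
  (k - (4%:R * (k + 3%:R))^-1) * n <= a ->
  (a - n) ^+ 2 <= a * ((k - 2%:R + (4%:R * (k + 3%:R))^-1) * n + B) -> False.
Proof.
move=> k3 B0 nB; set d := (4%:R * (k + 3%:R))^-1 => ha hq.
have dE : 4%:R * (k + 3%:R) * d = 1 by rewrite /d divff //; apply: lt0r_neq0; lra.
have d0 : 0 < d by rewrite invr_gt0; lra.
have d1 : d <= 1 by nra.
have n1 : 1 <= n by nra.
have hg : n ^+ 2 <= a * ((k + d) * n + B - a).
  by move: hq; rewrite !expr2; nra.
have a0 : 0 <= a by nra.
have g0 : 0 < (k + d) * n + B - a.
  rewrite ltNge; apply/negP => g0; have : a * ((k + d) * n + B - a) <= 0 by rewrite mulr_ge0_le0.
  by move: hg; rewrite expr2; nra.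
have g1 : (k + d) * n + B - a <= 2%:R * d * n + B by lra.
have a1 : a <= (k + 1) * n + B by nra.
have : a * ((k + d) * n + B - a) <= ((k + 1) * n + B) * (2%:R * d * n + B).
  by apply: ler_pM => //; lra.
have kd : (k + 1) * (2%:R * d) <= 2%:R^-1 by lra.
have -> : ((k + 1) * n + B) * (2%:R * d * n + B) = (k + 1) * (2%:R * d) * n ^+ 2 + B * ((k + 1 + 2%:R * d) * n + B).
  by ring.
have h1 : (k + 1) * (2%:R * d) * n ^+ 2 <= 2%:R^-1 * n ^+ 2 by rewrite ler_wpM2r // sqr_ge0.
have h2 : B * ((k + 1 + 2%:R * d) * n + B) <= 4%:R^-1 * n ^+ 2.
  have b1 : B <= n by nra.
  have : (k + 1 + 2%:R * d) * n + B <= 2%:R * (k + 2%:R) * n by nra.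
  move=> b2; have : B * ((k + 1 + 2%:R * d) * n + B) <= B * (2%:R * (k + 2%:R) * n) by rewrite ler_wpM2l.
  have : 8%:R * (k + 2%:R) * B * n <= n * n by rewrite ler_wpM2r; lra.
  by rewrite expr2; lra.
have n2 : 0 < n ^+ 2 by rewrite exprn_gt0; lra.
lra.
Qed.

(** The hypothesis makes [r] of order [sqrt n], so a linear term in [r] is [o(n)]. *)
Lemma absorb_linear (c eps : R) : 0 <= c -> 0 < eps -> exists N : nat,
  forall n r : R, N%:R <= n -> 0 <= r -> r ^+ 2 <= c * n + c * r -> c * r <= eps * n.
Proof.
move=> c0 e0; have [N HN] := nat_above ((c ^+ 3 / eps + c ^+ 2) / eps + 1).
exists N => n r nN r0 hr; rewrite leNgt; apply/negP => lt.
have n0 : 0 <= n by apply: le_trans nN; rewrite ler0n.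
have r1 : 0 < r.
  by rewrite lt0r r0 andbT; apply: contraTneq lt => ->; rewrite mulr0 -leNgt mulr_ge0 // ltW.
have h1 : eps * n * r <= c ^+ 2 * n + c ^+ 2 * r.
  apply: (@le_trans _ _ (c * r * r)); first by rewrite ler_wpM2r // ltW.
  by have := ler_wpM2l c0 hr; rewrite !expr2; lra.
have h2 : c ^+ 2 * n <= c ^+ 3 / eps * r.
  have -> : c ^+ 3 / eps * r = c ^+ 2 * (c * r / eps) by ring.
  rewrite ler_wpM2l ?sqr_ge0 // ler_pdivlMr //; lra.
have h3 : eps * n * r <= (c ^+ 3 / eps + c ^+ 2) * r by lra.
rewrite ler_pM2r // in h3.
have : eps * ((c ^+ 3 / eps + c ^+ 2) / eps + 1) <= eps * n.
  by rewrite ler_pM2l //; exact: le_trans nN.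
by rewrite mulrDr [eps * (_ / _)]mulrC divfK ?lt0r_neq0 //; lra.
Qed.

Hypothesis hasP : has_perron.

Lemma quad_supported (V : finType) (e e' : rel V) (v : V) (y : V -> R) : y v = 0 ->
  (forall u w, u != v -> w != v -> e' u w = e u w) -> quad e y = quad e' y.
Proof.
move=> yv E; rewrite !quadE; apply: eq_bigr => u _; apply: eq_bigr => w _.
have [->|uv] := eqVneq u v; first by rewrite yv mul0r !mulr0.
have [->|wv] := eqVneq w v; first by rewrite yv !mulr0.
by rewrite E.
Qed.

Lemma rich_hits l t : (1 < l)%N -> spec_bound l t -> exists N : nat,
  forall (V : finType) (e : rel V), symmetric e -> irreflexive e ->
  ~ packing e (2 * l) t.+1 -> forall (r : R) x, perron e r x -> (N <= #|V|)%N ->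
  (tight l t.+1 - slack l t.+1) * #|V|%:R <= r ^+ 2 -> forall v,
  exists Y : {set V}, [/\ v \notin Y, (#|Y| <= 2 * l * t)%N & cycle_hits e (2 * l) Y].
Proof.
move=> l1 SB; set k := tight l t.+1; set d := slack l t.+1.
have lR : 2%:R <= l%:R :> R by rewrite ler_nat.
have kE : k = l%:R * t%:R + l%:R - 1 by rewrite /k /tight natrM -natr1; ring.
have lt0 : 0 <= l%:R * t%:R :> R by rewrite mulr_ge0 ?ler0n.
have k1 : 1 <= k by rewrite kE; lra.
have dE : d = (4%:R * (k + 3%:R))^-1 by [].
have d0 : 0 < d by rewrite dE invr_gt0; lra.
have d1 : d <= 2%:R^-1.
  by rewrite dE lef_pV2 ?posrE; lra.
have [B HB] := SB d d0.
have [N HN] := nat_above (8%:R * (k + 2%:R) * `|B| + 1).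
exists N => V e esym eirr np r x Px nN hr v.
(* Isolating [v] has the effect of deleting it while the vertex type stays the same. *)
pose e' u w := [&& e u w, u != v & w != v].
have e'sym : symmetric e' by move=> u w; rewrite /e' esym [(w != v) && _]andbC.
have e'irr : irreflexive e' by move=> u; rewrite /e' eirr.
have NR : N%:R <= #|V|%:R :> R by rewrite ler_nat.
have [[cs [sc ac uc]]|np'] := Classical_Prop.classic (packing e' (2 * l) t).
  have vcs : v \notin flatten cs.
    apply/negP => /flattenP [c ccs vc]; have /andP [_ cc] := allP ac c ccs.
    by have := next_cycle cc vc; rewrite /e' eqxx andbF.
  have ac' : all (fun c => (size c == 2 * l)%N && cycle e c) cs.
    apply/allP => c /(allP ac) /andP [-> /=]; apply: sub_cycle => u w.
    by rewrite /e' => /and3P [].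
  (* A cycle of [e] missing these [t] cycles would complete a family of [t + 1]. *)
  exists [set u in flatten cs]; split; first by rewrite inE.
    rewrite cardsE (leq_trans (card_size _)) // (@size_flatten_const _ (2 * l)) ?sc.
      by rewrite mulnC.
    by apply/allP => c /(allP ac') /andP [].
  exact: (packing_hits np sc ac' uc).
have V0 : (0 < #|V|)%N by apply/card_gt0P; exists v.
have [r' [x' Px']] := hasP e'sym e'irr V0.
have := HB V e' e'sym e'irr np' r' x' Px' => hr'.
have t0 : (0 < t)%N.
  by rewrite lt0n; apply/eqP => t0; apply: np'; rewrite t0; exact: packing0.
have tR : 1 <= t%:R :> R by rewrite ler1n.
have r0 := perron_r_ge0 Px; have r'0 := perron_r_ge0 Px'.
have n1 : 1 <= #|V|%:R :> R by rewrite ler1n.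
have r1 : 0 < r.
  rewrite lt0r r0 andbT; apply: contraTneq hr => ->; rewrite expr0n /= -ltNge.
  by apply: mulr_gt0; lra.
have D : r ^+ 2 <= #|V|%:R + r * r'.
  apply: (delete_vertex esym eirr Px (v := v) r1) => y yv.
  rewrite (quad_supported (e' := e') yv); first by case: Px'.
  by move=> u w uv wv; rewrite /e' uv wv !andbT.
have k3 : 3%:R <= k by rewrite kE; nra.
(* No [t] disjoint cycles survive without [v], so the bound for [t] copies applies to [e'] and [r]
   is too small. *)
exfalso; apply: (@gap_contra k #|V|%:R (r ^+ 2) `|B|) => //.
  exact: le_trans HN NR.
have rr : 0 <= r ^+ 2 - #|V|%:R.
  have : 1 * #|V|%:R <= (k - d) * #|V|%:R by rewrite ler_wpM2r ?ler0n //; lra.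
  by move: hr; lra.
have sq : (r ^+ 2 - #|V|%:R) ^+ 2 <= (r * r') ^+ 2.
  by rewrite ler_sqr ?nnegrE ?mulr_ge0 //; lra.
apply: le_trans sq _; rewrite exprMn ler_wpM2l ?sqr_ge0 //.
apply: le_trans hr' _; apply: lerD; last exact: ler_norm.
by rewrite ler_wpM2r ?ler0n // -dE /tight natrM; move: kE lR; lra.
Qed.

End SpectralBound.

Section Dominated.
Variable R : archiRealFieldType.
Hypothesis hasP : has_perron R.

Section OneGraph.
Variables (V : finType) (e : rel V).
Hypotheses (esym : symmetric e) (eirr : irreflexive e).
Variables (r : R) (x : V -> R).
Hypothesis Px : perron e r x.
Local Notation n := #|V|.

Lemma codegree_le1 (Y : {set V}) v w : cycle_hits e (2 * 2) Y -> v \notin Y ->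
  w \notin v |: Y -> (#|[set u in nbrs e v :\: Y | e u w]| <= 1)%N.
Proof.
move=> hY vY; rewrite in_setU1 negb_or => /andP [wv wY].
rewrite leqNgt; apply/negP => /card_gt1P [a [b []]].
rewrite !inE => /andP [/andP [aY eva] eaw] /andP [/andP [bY evb] ebw] ab.
apply: (@cycle_nohit _ e 2 Y hY [:: v; a; w; b]) => //=.
- rewrite !inE !negb_or ab [v == w]eq_sym wv !andbT /=.
  have ne u1 u2 : e u1 u2 -> u1 != u2 by move=> E; apply: contraTneq E => ->; rewrite eirr.
  by rewrite (ne _ _ eva) (ne _ _ evb) (ne _ _ eaw) eq_sym (ne _ _ ebw).
- by rewrite eva eaw (esym w) ebw esym evb.
- by rewrite vY aY wY bY.
Qed.

Lemma sum_outside (T : {set V}) v :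
  \sum_(w in T) x w <= r * x v + (n%:R - #|nbrs e v|%:R).
Proof.
apply: le_trans (sum_setS Px (subsetT T)) _.
rewrite (big_setID (nbrs e v)) /= setTI (perron_eig Px) lerD2l.
apply: (@le_trans _ _ (1 * #|[set: V] :\: nbrs e v|%:R)).
  by apply: sum_le_card => w _; exact: (perron_le1 Px).
by rewrite mul1r cardsD setTI cardsT natrB // max_card.
Qed.

(** First steps into [Y] contribute at most [#|Y| r]. After a first step outside [Y], each end
    outside [v |: Y] is reached at most once, and [sum_outside] bounds the total weight of these
    ends. *)
Lemma two_walks_C4 (Y : {set V}) v : cycle_hits e (2 * 2) Y -> v \notin Y ->
  r ^+ 2 * x v <= wsum e x (nbrs e v) (v |: Y) + (n%:R - #|nbrs e v|%:R)
                  + #|Y|.+1%:R * r.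
Proof.
move=> hY vY; rewrite (two_walks Px) (wsum_splitr e x _ (v |: Y)) -addrA lerD2l.
rewrite (wsum_splitl e x _ Y).
have h1 : wsum e x (nbrs e v :&: Y) (~: (v |: Y)) <= #|Y|%:R * r.
  apply: le_trans (wsum_leset Px (subsetIr _ _) (subsetT _)) _.
  rewrite mulrC -sum1_card natr_sum mulr_sumr; apply: ler_sum => u _.
  by rewrite setIT (perron_eig Px) ler_wpM2l ?(perron_r_ge0 Px) // (perron_le1 Px).
have h2 : wsum e x (nbrs e v :\: Y) (~: (v |: Y)) <= r + (n%:R - #|nbrs e v|%:R).
  apply: (@le_trans _ _ (\sum_(w in ~: (v |: Y)) x w)).
    rewrite /wsum (exchange_big_dep [in ~: (v |: Y)]) /=; last first.
      by move=> u w _; rewrite in_setI => /andP [].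
    apply: ler_sum => w; rewrite in_setC => wD.
    rewrite sumr_const -[leRHS]mulr1n ler_wpMn2l ?(perron_ge0 Px) //.
    apply: leq_trans (codegree_le1 hY vY wD).
    apply/subset_leq_card/subsetP => u; rewrite unfold_in in_setI in_nbrs in_set.
    by case/and3P=> -> ->.
  apply: le_trans (sum_outside _ v) _; rewrite lerD2r.
  by rewrite -[leRHS]mulr1 ler_wpM2l ?(perron_r_ge0 Px) // (perron_le1 Px).
have := lerD h1 h2; rewrite -[#|Y|.+1%:R]natr1; lra.
Qed.

(** All but the rich vertices have at most [l t - 1] neighbours in [D], and the boundedly many rich
    ones have at most [#|D|]. *)
Lemma pairs_few l t (S D : {set V}) : (0 < l)%N -> (0 < t)%N -> ~ packing e (2 * l) t ->
  (pairs e S D <= (l * t - 1) * #|S| + #|D| * (l * t * 2 ^ #|D|))%N.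
Proof.
move=> l0 t0 np; pose X := [set u | (l * t <= #|nbrs e u :&: D|)%N].
have hX : (#|X| <= l * t * 2 ^ #|D|)%N := few_rich_vertices esym eirr D l0 np.
rewrite /pairs (big_setID X) /= addnC; apply: leq_add.
  apply: (@leq_trans ((l * t - 1) * #|S :\: X|)); last by rewrite leq_mul2l subset_leq_card ?orbT // subsetDl.
  rewrite mulnC -sum_nat_const; apply: leq_sum => u; rewrite in_setD in_set -ltnNge => /andP [h _].
  by rewrite subn1 -ltnS prednK // muln_gt0 l0.
apply: (@leq_trans (#|D| * #|S :&: X|)); last first.
  by rewrite leq_mul2l (leq_trans _ hX) ?orbT // subset_leq_card // subsetIr.
rewrite mulnC -sum_nat_const; apply: leq_sum => u _.
by rewrite subset_leq_card // subsetIr.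
Qed.

(** First steps into [Y] and ends in [v |: Y] are counted trivially; [pairs_nbrs] counts the
    rest. *)
Lemma pairs_linear l m (Y T : {set V}) v : (0 < l)%N -> cycle_hits e (2 * l) Y ->
  v \notin Y -> (#|Y| <= m)%N ->
  (pairs e (nbrs e v) T <= (m + 1 + 2 * l) * (#|nbrs e v| + #|T|))%N.
Proof.
move=> l0 hY vY cY; rewrite /pairs (big_setID Y) /= -!/(pairs e _ _).
have h1 : (pairs e (nbrs e v :&: Y) T <= m * #|T|)%N.
  apply: leq_trans (pairs_max _ _ _) _; rewrite leq_mul2r (leq_trans _ cY) ?orbT //.
  by rewrite subset_leq_card // subsetIr.
set S := nbrs e v :\: Y; have cS : (#|S| <= #|nbrs e v|)%N by rewrite subset_leq_card // subsetDl.
have h2 : (pairs e S (v |: Y) <= #|nbrs e v| * (m + 1))%N.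
  by apply: leq_trans (pairs_max _ _ _) _; rewrite leq_mul // cardsU1 vY add1n addn1 ltnS.
have h3 : (pairs e S (T :\: (v |: Y)) <= 2 * l * (#|nbrs e v| + #|T|))%N.
  apply: leq_trans (pairs_nbrs esym eirr l0 hY vY _ _) _ => //; first by rewrite setDE subsetIr.
  by rewrite leq_mul2l leq_add ?orbT // subset_leq_card // subsetDl.
have h4 : (pairs e S T <= pairs e S (v |: Y) + pairs e S (T :\: (v |: Y)))%N.
  apply: leq_trans (pairs_leq _ _ _) (pairs_Ur _ _ _ _).
  by apply/subsetP => z zT; rewrite in_setU in_setD zT andbT orbN.
move: (pairs e S T) (pairs e S _) (pairs e S _) (pairs e _ T) h1 h2 h3 h4 => p1 p2 p3 p4; clear; nia.
Qed.

End OneGraph.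

Lemma ex_subset_card (V : finType) (D : {set V}) m : (m <= #|D|)%N ->
  exists2 D0 : {set V}, D0 \subset D & #|D0| = m.
Proof.
move=> h; exists [set z in take m (enum D)].
  by apply/subsetP => z; rewrite inE => /mem_take; rewrite mem_enum.
rewrite cardsE; have /card_uniqP -> := take_uniq m (enum_uniq D).
by rewrite size_takel // -cardE.
Qed.

(** An entry at least [h] forces degree at least [h r], which is of order [sqrt n]. If a positive
    proportion of the entries were that large, pruning outside [Y] would leave minimum degree of
    order [sqrt n], and its cube would exceed the [O(n)] of [min_degree_bound]. *)
Lemma few_large_entries l m (h delta : R) : (3 <= l)%N -> 0 < h -> 0 < delta ->
  exists N : nat, forall (V : finType) (e : rel V), symmetric e -> irreflexive e ->
  forall (Y : {set V}), cycle_hits e (2 * l) Y -> (#|Y| <= m)%N ->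
  forall r x, perron e r x -> (N <= #|V|)%N -> #|V|%:R <= r ^+ 2 ->
  #|[set v | h <= x v]|%:R <= delta * #|V|%:R.
Proof.
move=> l3 h0 d0.
(* The minimum degree [a] obtained below satisfies [a > c1 r - c2]. *)
pose c1 := h * delta / 8%:R; pose c2 := m%:R * delta / 8%:R + 1.
have c10 : 0 < c1 by rewrite /c1 divr_gt0 ?mulr_gt0 ?ltr0n.
have c20 : 1 <= c2 by rewrite /c2 lerDr divr_ge0 ?mulr_ge0 ?ler0n // ltW.
(* The summands ensure in turn [a > 20 l], [a >= c1 r / 2], the failure of the cubic bound, and
   [z > 0]. *)
pose R0 := (20 * l)%:R / c1 + 2%:R * c2 / c1 + (128 * l ^ 2)%:R / c1 ^+ 3 + m%:R / h + 1.
have [N HN] := nat_above (R0 ^+ 2 + 2%:R * m%:R / delta).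
exists N => V e esym eirr Y hY cY r x Px nN nr.
have NR : R0 ^+ 2 + 2%:R * m%:R / delta <= #|V|%:R by apply: le_trans HN _; rewrite ler_nat.
have t1 : 0 <= (20 * l)%:R / c1 by rewrite divr_ge0 ?ler0n // ltW.
have t2 : 0 <= 2%:R * c2 / c1 by rewrite divr_ge0 ?mulr_ge0 ?ler0n //; lra.
have t3 : 0 <= (128 * l ^ 2)%:R / c1 ^+ 3 by rewrite divr_ge0 ?ler0n // exprn_ge0 // ltW.
have t4 : 0 <= m%:R / h by rewrite divr_ge0 ?ler0n // ltW.
have t5 : 0 <= 2%:R * m%:R / delta by rewrite divr_ge0 ?mulr_ge0 ?ler0n // ltW.
have R00 : 1 <= R0 by rewrite /R0; lra.
have r0 := perron_r_ge0 Px.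
have rR : R0 <= r by rewrite -ler_sqr ?nnegrE //; lra.
rewrite leNgt; apply/negP => lt.
set L := [set v | h <= x v] in lt.
have cL : delta / 2%:R * #|V|%:R <= #|L :\: Y|%:R.
  have : #|L|%:R <= #|L :\: Y|%:R + m%:R :> R.
    rewrite -natrD ler_nat -(cardsID Y L) addnC leq_add2l.
    by rewrite (leq_trans _ cY) // subset_leq_card // subsetIr.
  have : 2%:R * m%:R / delta <= #|V|%:R by have := sqr_ge0 R0; lra.
  by rewrite ler_pdivrMr //; lra.
pose z := h * r - m%:R.
have z0 : 0 < z.
  have : m%:R / h < r by rewrite (lt_le_trans _ rR) // /R0; lra.
  by rewrite ltr_pdivrMr // /z; lra.
have R2 : 0 < R0 ^+ 2 by rewrite exprn_gt0 // (lt_le_trans ltr01 R00).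
have V1 : 0 < #|V|%:R :> R by lra.
have pge : delta / 2%:R * #|V|%:R * z <= (pairs e (~: Y) (~: Y))%:R.
  apply: (@le_trans _ _ (#|L :\: Y|%:R * z)); first by rewrite ler_wpM2r // ltW.
  rewrite -sum1_card natr_sum mulr_suml.
  apply: (@le_trans _ _ (pairs e (L :\: Y) (~: Y))%:R); last first.
    rewrite ler_nat (pairsC esym) pairs_leq //.
    by rewrite setDE subsetIr.
  rewrite /pairs natr_sum; apply: ler_sum => v; rewrite in_setD inE => /andP [_ hv].
  have := rx_le_deg Px v; rewrite -(cardsID Y (nbrs e v)) natrD.
  have : #|nbrs e v :&: Y|%:R <= m%:R :> R.
    by rewrite ler_nat (leq_trans _ cY) // subset_leq_card // subsetIr.
  have : h * r <= r * x v by rewrite mulrC ler_wpM2l.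
  by rewrite /z mul1r setDE; lra.
pose a := Num.truncn (z * delta / 8%:R).
have y0 : 0 <= z * delta / 8%:R by rewrite divr_ge0 ?mulr_ge0 ?ler0n // ltW.
have /andP [a1 a2] : a%:R <= z * delta / 8%:R < a.+1%:R by rewrite truncn_itv.
have prn : (2 * a * #|~: Y| < pairs e (~: Y) (~: Y))%N.
  rewrite -(ltr_nat R) (lt_le_trans _ pge) // !natrM.
  have : #|~: Y|%:R <= #|V|%:R :> R by rewrite ler_nat max_card.
  move=> hc; apply: (@le_lt_trans _ _ (2%:R * (z * delta / 8%:R) * #|V|%:R)).
    by apply: ler_pM => //; rewrite ?mulr_ge0 ?ler0n // ler_wpM2l ?ler0n.
  have : 0 < z * delta * #|V|%:R by rewrite !mulr_gt0.
  lra.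
have [H sH [H0 Hdeg]] := prune esym prn.
have dHY : [disjoint H & Y] by rewrite disjoints_subset.
have l0 : (0 < l)%N by apply: leq_trans l3.
have c1E : c1 * r - c2 < a%:R.
  by move: a2; rewrite -[a.+1%:R]natr1 /z /c1 /c2; lra.
have c1R : (20 * l)%:R + 2%:R * c2 + (128 * l ^ 2)%:R / c1 ^+ 2 + c1 <= c1 * r.
  apply: (@le_trans _ _ (c1 * R0)); last by rewrite ler_pM2l.
  have -> : c1 * R0 = (20 * l)%:R + 2%:R * c2 + (128 * l ^ 2)%:R / c1 ^+ 2 + c1 * (m%:R / h) + c1.
    by rewrite /R0; field; rewrite !lt0r_neq0.
  by have : 0 <= c1 * (m%:R / h); [rewrite mulr_ge0 // ltW | lra].
have t6 : 0 <= (128 * l ^ 2)%:R / c1 ^+ 2 by rewrite divr_ge0 ?ler0n // exprn_ge0 // ltW.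
have t7 : 0 <= (20 * l)%:R :> R by rewrite ler0n.
clearbody R0 c1 c2; clear pge prn y0 a1 a2 t1 t2 t3 t4 t5 NR HN rR R00 cL lt.
case/orP: (min_degree_bound esym eirr l0 hY l3 dHY H0 Hdeg) => ha.
  by move: ha; rewrite -(ler_nat R) => ha; clear -ha c1E c1R t6 t7 c20 c10; lra.
have ha3 : a%:R ^+ 3 <= (16 * l ^ 2)%:R * r ^+ 2.
  rewrite -natrX; apply: (@le_trans _ _ (16 * l ^ 2 * #|H|)%:R); first by rewrite ler_nat.
  rewrite natrM ler_wpM2l ?ler0n //; apply: le_trans nr; rewrite ler_nat max_card //.
have hb : 0 <= c1 * r / 2%:R <= a%:R.
  by have : 0 <= c1 * r; [rewrite mulr_ge0 // ltW | move=> hc; clear -hc c1E c1R t6 t7 c20 c10; apply/andP; split; lra].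
have hb3 : (c1 * r / 2%:R) ^+ 3 <= a%:R ^+ 3.
  by case/andP: hb => hb1 hb2; rewrite lerXn2r ?nnegrE ?ler0n.
have r1 : 0 < r ^+ 2 by exact: lt_le_trans nr.
have h4 : c1 ^+ 2 * (c1 * r) * r ^+ 2 <= (128 * l ^ 2)%:R * r ^+ 2.
  have -> : c1 ^+ 2 * (c1 * r) * r ^+ 2 = 8%:R * (c1 * r / 2%:R) ^+ 3 by field.
  apply: (@le_trans _ _ (8%:R * ((16 * l ^ 2)%:R * r ^+ 2))).
    by rewrite ler_wpM2l ?ler0n //; exact: le_trans hb3 ha3.
  by rewrite !natrM; clear; lra.
rewrite ler_pM2r // mulrC -ler_pdivlMr ?exprn_gt0 // in h4.
clear -h4 c1R c10 c20 t7; lra.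
Qed.

Lemma dominated_long l t : (3 <= l)%N -> spec_bound R l t -> dominated R l t.+1.
Proof.
move=> l3 SB eps e0; have l0 : (0 < l)%N by apply: leq_trans l3.
have l1 : (1 < l)%N by apply: leq_trans l3.
have [N1 HN1] := rich_hits hasP l1 SB.
pose m := (2 * l * t)%N; pose C := (m + 1 + 2 * l)%N.
have C1 : 1 <= C%:R :> R by rewrite ler1n /C addn1.
have C0 : 0 < C%:R :> R by lra.
pose eta := eps / (2%:R * C%:R).
have etaC : 2%:R * eta * C%:R = eps by rewrite /eta; field; rewrite lt0r_neq0.
have eta0 : 0 < eta by rewrite /eta divr_gt0 // mulr_gt0 // ltr0n.
pose h := eta / (8%:R * C%:R); pose delta := eta / (4%:R * C%:R).
have h0 : 0 < h by rewrite /h divr_gt0 // mulr_gt0 // ltr0n.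
have hC : 8%:R * h * C%:R = eta by rewrite /h; field; rewrite lt0r_neq0.
have d0 : 0 < delta by rewrite /delta divr_gt0 // mulr_gt0 // ltr0n.
have dC : 4%:R * delta * C%:R = eta by rewrite /delta; field; rewrite lt0r_neq0.
have [N2 HN2] := few_large_entries m l3 h0 d0.
pose c := eta / (2%:R * C%:R).
have c0 : 0 < c by rewrite /c divr_gt0 // mulr_gt0 // ltr0n.
have cC : 2%:R * c * C%:R = eta by rewrite /c; field; rewrite lt0r_neq0.
have [M HM] := nat_above ((l * t.+1)%:R / c).
rewrite ler_pdivrMr // in HM.
pose N3 := (M * (l * t.+1 * 2 ^ M)).+1.
exists M, (maxn N1 (maxn N2 N3)) => V e esym eirr np r x Px.
rewrite !geq_max => /and3P [n1 n2 n3] hr.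
have k2 : 2%:R <= tight R l t.+1.
  have : 3%:R <= (l * t.+1)%:R :> R by rewrite ler_nat mulnS (leq_trans l3) // leq_addr.
  by rewrite /tight; lra.
have sl : slack R l t.+1 <= 1.
  by rewrite /slack invf_le1 ?mulr_gt0 ?ltr0n //; lra.
have nr : #|V|%:R <= r ^+ 2.
  by apply: le_trans hr; rewrite -[leLHS]mul1r ler_wpM2r ?ler0n //; lra.
have r0 := perron_r_ge0 Px.
have lin v T : (pairs e (nbrs e v) T)%:R <= C%:R * (#|nbrs e v|%:R + #|T|%:R) :> R.
  have [Y [vY cY hY]] := HN1 V e esym eirr np r x Px n1 hr v.
  by rewrite -natrD -natrM ler_nat (pairs_linear esym eirr T l0 hY vY cY).
have degn v : #|nbrs e v|%:R <= #|V|%:R :> R by rewrite ler_nat max_card.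
have cardn (T : {set V}) : #|T|%:R <= #|V|%:R :> R by rewrite ler_nat max_card.
have low v (T : {set V}) (b : R) : 0 <= b -> (forall w, w \in T -> x w <= b) ->
   wsum e x (nbrs e v) T <= 2%:R * b * C%:R * #|V|%:R.
  move=> b0 hT; apply: le_trans (wsum_le e _ hT) _.
  rewrite (_ : 2%:R * b * C%:R * #|V|%:R = b * (C%:R * (#|V|%:R + #|V|%:R))); last by ring.
  rewrite ler_wpM2l // (le_trans (lin v T)) // ler_wpM2l ?ler0n // lerD ?degn ?cardn //.
pose D := [set v | eta <= x v].
(* Of the weight [eta n] of the walks from [v], those ending in entries below [h] carry at most a
   quarter. The others end in the small set [L], so there are at most [C (deg v + delta n)] of them,
   and [deg v] must be linear in [n]. *)
have Ddeg v : v \in D -> c * #|V|%:R <= #|nbrs e v|%:R.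
  rewrite inE => hv; pose L := [set w | h <= x w].
  have [Y [vY cY hY]] := HN1 V e esym eirr np r x Px n1 hr v.
  have cL : #|L|%:R <= delta * #|V|%:R := HN2 V e esym eirr Y hY cY r x Px n2 nr.
  have w1 : eta * #|V|%:R <= wsum e x (nbrs e v) L + wsum e x (nbrs e v) (~: L).
    rewrite -wsum_splitr -(two_walks Px) mulrC; apply: ler_pM => //; rewrite ?ler0n // ltW //.
  have w2 : wsum e x (nbrs e v) L <= C%:R * #|nbrs e v|%:R + C%:R * (delta * #|V|%:R).
    apply: le_trans (wsum_le1 Px _ _) _; apply: le_trans (lin v L) _.
    by rewrite mulrDr lerD2l ler_wpM2l ?ler0n.
  have w3 : wsum e x (nbrs e v) (~: L) <= 2%:R * h * C%:R * #|V|%:R.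
    by apply: low => [|w]; [exact: ltW | rewrite !inE -ltNge => /ltW].
  have : C%:R * (c * #|V|%:R) <= C%:R * #|nbrs e v|%:R.
    have -> : C%:R * (c * #|V|%:R) = (2%:R * c * C%:R) * #|V|%:R / 2%:R by field.
    rewrite cC; have := w1; have E1 : C%:R * (delta * #|V|%:R) = (4%:R * delta * C%:R) * #|V|%:R / 4%:R by field.
    have E2 : 2%:R * h * C%:R * #|V|%:R = (8%:R * h * C%:R) * #|V|%:R / 4%:R by field.
    rewrite E1 dC in w2; rewrite E2 hC in w3; clear -w1 w2 w3; lra.
  by rewrite ler_pM2l.
move=> v; exists D; last first.
  rewrite (two_walks Px) (wsum_splitr e x _ D) -addrA lerD2l.
  apply: le_trans (low v (~: D) eta (ltW eta0) _) _ => [w|].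
    by rewrite !inE -ltNge => /ltW.
  by rewrite etaC lerDr subr_ge0.
(* [M] vertices of degree [c n] would give at least [l (t + 1) n] pairs, against the coefficient
   [l (t + 1) - 1] of [pairs_few]. *)
rewrite leqNgt; apply/negP => /ltnW /ex_subset_card [D0 /subsetP sD cD].
have p1 : c * #|V|%:R * M%:R <= (pairs e D0 setT)%:R.
  rewrite -cD -sum1_card natr_sum mulr_sumr /pairs natr_sum; apply: ler_sum => u uD.
  by rewrite setIT mulr1 Ddeg // sD.
have := pairs_few esym eirr [set: V] D0 l0 (ltn0Sn t) np.
rewrite pairsC // cD cardsT => p2.
have : (pairs e D0 setT)%:R <= ((l * t.+1 - 1) * #|V| + M * (l * t.+1 * 2 ^ M))%:R :> R by rewrite ler_nat.
move=> p3; have : (l * t.+1)%:R * #|V|%:R <= c * #|V|%:R * M%:R.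
  rewrite mulrAC ler_wpM2r ?ler0n // mulrC //.
move=> p4; have := le_trans p4 (le_trans p1 p3); rewrite -natrM ler_nat.
have : (0 < l * t.+1)%N by rewrite muln_gt0 l0.
move: n3; rewrite /N3; clear; case: (l * t.+1)%N => // k.
by rewrite subn1 /= mulSn; lia.
Qed.

Lemma dominated_C4 t : spec_bound R 2 t -> dominated R 2 t.+1.
Proof.
move=> SB eps e0; have [N1 HN1] := rich_hits hasP (isT : (1 < 2)%N) SB.
pose M := (4 * t).+1.
have [N2 HN2] := @absorb_linear R M.+1%:R eps (ler0n _ _) e0.
exists M, (maxn N1 N2) => V e esym eirr np r x Px; rewrite geq_max => /andP [n1 n2] hr v.
have nR : N2%:R <= #|V|%:R :> R by rewrite ler_nat.
have A u : exists2 D : {set V}, (#|D| <= M)%N & r ^+ 2 * x u <= wsum e x (nbrs e u) D +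
   (#|V|%:R - #|nbrs e u|%:R) + M%:R * r.
  have [Y [uY cY hY]] := HN1 V e esym eirr np r x Px n1 hr u.
  exists (u |: Y); first by rewrite cardsU1 uY add1n.
  apply: le_trans (two_walks_C4 esym eirr Px hY uY) _; rewrite lerD2l.
  by rewrite ler_wpM2r ?(perron_r_ge0 Px) // ler_nat.
have r0 := perron_r_ge0 Px.
(* Bootstrap: at the vertex with entry [1] the estimate itself shows [r^2 = O(n + r)]. *)
have small : M.+1%:R * r <= eps * #|V|%:R.
  apply: HN2 => //; have [_ [u xu] _ _] := Px.
  have [D cD] := A u; rewrite xu mulr1 => /le_trans; apply.
  have : wsum e x (nbrs e u) D <= M%:R * #|V|%:R.
    apply: le_trans (wsum_le1 Px _ _) _; rewrite -natrM ler_nat.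
    by apply: leq_trans (pairs_max _ _ _) _; rewrite mulnC leq_mul // max_card.
  have : 0 <= #|nbrs e u|%:R :> R by rewrite ler0n.
  rewrite -[M.+1%:R]natr1; lra.
have [D cD hD] := A v; exists D => //; apply: le_trans hD _; rewrite lerD2l.
by apply: le_trans small; rewrite -[M.+1%:R]natr1 mulrDl lerDl mul1r.
Qed.

End Dominated.

(** * Stability *)

Section Stability.
Variable R : archiRealFieldType.
Hypothesis hasP : has_perron R.

Lemma tightE l t : (0 < l)%N -> (0 < t)%N -> tight R l t = (l * t - 1)%:R.
Proof. by move=> l0 t0; rewrite /tight natrB // muln_gt0 l0. Qed.

Lemma wsum_few l t (V : finType) (e : rel V) (esym : symmetric e) (eirr : irreflexive e)
    r (x : V -> R) M (S D : {set V}) :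
  perron e r x -> (0 < l)%N -> (0 < t)%N -> ~ packing e (2 * l) t -> (#|D| <= M)%N ->
  wsum e x S D <= tight R l t * #|S|%:R + (M * (l * t * 2 ^ M))%:R.
Proof.
move=> Px l0 t0 np cD; apply: le_trans (wsum_le1 Px _ _) _.
rewrite tightE // -natrM -natrD ler_nat.
apply: leq_trans (pairs_few esym eirr S D l0 t0 np) _; rewrite leq_add2l.
by rewrite leq_mul // leq_mul2l leq_pexp2l ?orbT.
Qed.

(** Evaluate [dominated] at the vertex with entry [1], where [(k - 1) deg v + n] is at most [k n].
    The term [N^2] covers graphs of small order, and below the threshold of [dominated] the bound is
    immediate. *)
Lemma dominated_spec_bound l t : (1 < l)%N -> (0 < t)%N -> dominated R l t -> spec_bound R l t.
Proof.
move=> l1 t0 dom eps e0; have [M [N HMN]] := dom eps e0.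
have l0 : (0 < l)%N by apply: leq_trans l1.
have k1 : 1 <= tight R l t by rewrite tightE // ler1n; have := leq_mul l1 t0; lia.
exists ((M * (l * t * 2 ^ M))%:R + N%:R ^+ 2) => V e esym eirr np r x Px.
have n0 : 0 <= #|V|%:R :> R by rewrite ler0n.
have C0 : 0 <= (M * (l * t * 2 ^ M))%:R :> R by rewrite ler0n.
have N0 : 0 <= N%:R ^+ 2 :> R by rewrite exprn_ge0 ?ler0n.
have en : 0 <= eps * #|V|%:R by rewrite mulr_ge0 // ltW.
have kn : 0 <= tight R l t * #|V|%:R by rewrite mulr_ge0 //; lra.
have [nN|nN] := leqP N #|V|; last first.
  have : r ^+ 2 <= N%:R ^+ 2; last by lra.
  rewrite ler_sqr ?nnegrE ?(perron_r_ge0 Px) ?ler0n //.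
  by rewrite (le_trans (perron_r_le Px)) // ler_nat ltnW.
have [hr|hr] := lerP ((tight R l t - slack R l t) * #|V|%:R) (r ^+ 2); last first.
  have : 0 <= slack R l t * #|V|%:R.
    by rewrite mulr_ge0 // /slack invr_ge0 mulr_ge0 ?ler0n //; lra.
  by lra.
have [_ [v xv] _ _] := Px.
have [D cD] := HMN V e esym eirr np r x Px nN hr v; rewrite xv mulr1 => h.
have := wsum_few esym eirr (nbrs e v) Px l0 t0 np cD.
have : (tight R l t - 1) * #|nbrs e v|%:R <= (tight R l t - 1) * #|V|%:R.
  by rewrite ler_wpM2l ?ler_nat ?max_card //; lra.
lra.
Qed.

Lemma dominatedS l t : (1 < l)%N -> spec_bound R l t -> dominated R l t.+1.
Proof.
rewrite leq_eqVlt => /predU1P [<-|l3]; first exact: dominated_C4.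
exact: dominated_long.
Qed.

(** The base case is vacuous, since the empty family is a packing of [0] cycles. *)
Theorem spec_bound_all l t : (1 < l)%N -> spec_bound R l t.
Proof.
move=> l1; elim: t => [|t IH]; last by apply: dominated_spec_bound => //; exact: dominatedS.
by move=> eps _; exists 0 => V e _ _ []; exact: packing0.
Qed.

(** At the vertex with entry [1], [dominated] gives [n - deg v = o(n)] because [k >= 2]. If fewer
    than [k] entries on [D] were near [1], almost every first step would carry weight at most
    [k - d] into [D], too little for [r^2]. Near-maximal entries have near-full degree by the same
    estimate. *)
Lemma stability l t (eps : R) : (1 < l)%N -> (0 < t)%N -> (3 <= l * t)%N -> 0 < eps < 1 ->
  exists N : nat, forall (V : finType) (e : rel V), symmetric e -> irreflexive e ->
  ~ packing e (2 * l) t -> forall r x, perron e r x -> (N <= #|V|)%N ->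
  tight R l t * (#|V|%:R - tight R l t) <= r ^+ 2 ->
  exists2 K : {set V}, #|K| = (l * t - 1)%N &
    forall v, v \in K -> 1 - eps <= x v /\ (1 - eps) * #|V|%:R <= #|nbrs e v|%:R.
Proof.
move=> l1 t0 lt3 /andP [e0 e1].
have l0 : (0 < l)%N by apply: leq_trans l1.
set k := tight R l t.
have k2 : 2%:R <= k by rewrite /k tightE // ler_nat; lia.
have s0 : 0 < slack R l t by rewrite /slack invr_gt0 mulr_gt0 ?ltr0n // -/k; lra.
pose a := Num.min (eps / 20%:R) (slack R l t).
have a0 : 0 < a by rewrite lt_min s0 divr_gt0 ?ltr0n.
have ae : a <= eps / 20%:R by rewrite ge_min lexx.
have as_ : a <= slack R l t by rewrite ge_min lexx orbT.
clearbody a.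
have [M [N1 HM]] : exists M N : nat, forall (V : finType) (e : rel V),
    symmetric e -> irreflexive e -> ~ packing e (2 * l) t ->
    forall r x, perron e r x -> (N <= #|V|)%N ->
    (tight R l t - slack R l t) * #|V|%:R <= r ^+ 2 ->
    forall v, exists2 D : {set V}, (#|D| <= M)%N &
      r ^+ 2 * x v <= wsum e x (nbrs e v) D + (#|V|%:R - #|nbrs e v|%:R) + a * #|V|%:R.
  have : dominated R l t by case: t t0 {lt3 k k2 s0 a a0 ae as_} => // t _; apply: dominatedS => //; exact: spec_bound_all.
  exact.
pose C := (M * (l * t * 2 ^ M))%N.
have [N2 HN2] := nat_above ((k ^+ 2 + C%:R) / a).
exists (maxn N1 N2) => V e esym eirr np r x Px; rewrite geq_max => /andP [n1 n2] hr.
set n : R := #|V|%:R.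
have n0 : 0 <= n by rewrite ler0n.
have hn : k ^+ 2 + C%:R <= a * n.
  by move: HN2; rewrite ler_pdivrMr // mulrC => /le_trans; apply; rewrite ler_pM2l // ler_nat.
have C0 : 0 <= C%:R :> R by rewrite ler0n.
have k20 : 0 <= k ^+ 2 by rewrite sqr_ge0.
have hr1 : (k - a) * n <= r ^+ 2.
  by apply: le_trans hr; rewrite -/n; move: hn; rewrite expr2; lra.
have hr2 : (k - slack R l t) * n <= r ^+ 2.
  by apply: le_trans hr1; rewrite ler_wpM2r //; lra.
have dn v : #|nbrs e v|%:R <= n by rewrite ler_nat max_card.
(* In the final comparison [n - deg v <= 3 a n], and all the errors together stay below [6 a n],
   hence below [d n]. *)
pose d := 7%:R * a.
have deg v : 1 - d <= x v -> (1 - eps) * n <= #|nbrs e v|%:R.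
  move=> xv; have [D cD h] := HM V e esym eirr np r x Px n1 hr2 v.
  have := wsum_few esym eirr (nbrs e v) Px l0 t0 np cD; rewrite -/C -/k => w.
  have : (k - a) * n * (1 - d) <= r ^+ 2 * x v.
    apply: ler_pM => //; first by rewrite mulr_ge0 //; lra.
    by rewrite /d; lra.
  move: h; rewrite -/n => h h2.
  have h3 : (k - a) * n * (1 - d) <= (k - 1) * #|nbrs e v|%:R + n + 2%:R * a * n by lra.
  have d0 : 0 <= d by rewrite /d; lra.
  have an : 0 <= a * n by rewrite mulr_ge0 // ltW.
  have h4 : (k - 1) * ((1 - 20%:R * a) * n) <= (k - 1) * #|nbrs e v|%:R.
    have : 0 <= (k - 2%:R) * (a * n) by rewrite mulr_ge0 //; lra.
    have : 0 <= a * (a * n) by rewrite mulr_ge0 // ltW.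
    by move: h3; rewrite /d; lra.
  rewrite ler_pM2l in h4; last by lra.
  by apply: le_trans h4; rewrite ler_wpM2r //; lra.
have [_ [v xv] _ _] := Px.
have [D cD] := HM V e esym eirr np r x Px n1 hr2 v; rewrite xv mulr1 -/n => h.
pose D1 := [set w in D | 1 - d <= x w].
have [cD1|cD1] := leqP (l * t - 1) #|D1|.
  have [K /subsetP sK cK] := ex_subset_card cD1.
  exists K => // w /sK; rewrite inE => /andP [_ xw]; split; last exact: deg.
  by apply: le_trans xw; rewrite /d; lra.
exfalso.
(* Off the rich set [X] a vertex has at most [k] neighbours in [D]. If it has exactly [k], one of
   them is outside [D1] and loses at least [d]; if it has fewer, the loss is at least [1]. *)
have wb : wsum e x (nbrs e v) D <= (k - d) * n + C%:R.
  pose X := [set u | (l * t <= #|nbrs e u :&: D|)%N].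
  have hX : (#|X| <= l * t * 2 ^ #|D|)%N := few_rich_vertices esym eirr D l0 np.
  rewrite (wsum_splitl e x _ X) addrC; apply: lerD.
    apply: (@le_trans _ _ (\sum_(u in nbrs e v :\: X) (k - d))); last first.
      rewrite sumr_const -mulr_natr ler_wpM2l //; first by rewrite /d; lra.
      by rewrite (le_trans _ (dn v)) // ler_nat subset_leq_card // subsetDl.
    apply: ler_sum => u; rewrite in_setD in_set -ltnNge => /andP [hu _].
    rewrite (big_setID D1) /=.
    have b1 : \sum_(w in nbrs e u :&: D :&: D1) x w <= 1 * #|nbrs e u :&: D :&: D1|%:R.
      by apply: sum_le_card => w _; exact: (perron_le1 Px).
    have b2 : \sum_(w in (nbrs e u :&: D) :\: D1) x w <= (1 - d) * #|(nbrs e u :&: D) :\: D1|%:R.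
      apply: sum_le_card => w; rewrite in_setD in_setI inE => /andP [h1 /andP [_ wD]].
      by move: h1; rewrite wD -ltNge => /ltW.
    have c1 : (#|nbrs e u :&: D :&: D1| < l * t - 1)%N.
      by apply: leq_ltn_trans cD1; rewrite subset_leq_card // subsetIr.
    have c2 := cardsID D1 (nbrs e u :&: D).
    have lt0 : (0 < l * t)%N by rewrite muln_gt0 l0.
    have kE : k + 1 = (l * t)%:R by rewrite /k /tight; ring.
    move: b1 b2; set s1 := \sum_(w in _) _; set s2 := \sum_(w in _ :\: _) _.
    move: c1 c2; set m1 := #|_ :&: D1|; set m2 := #|_ :\: D1| => c1 c2 b1 b2.
    have c3 : m1%:R + 2%:R <= (l * t)%:R :> R by rewrite -natrD ler_nat; clear -c1; lia.
    have c4 : m1%:R + m2%:R + 1 <= (l * t)%:R :> R by rewrite -natrD natr1 ler_nat c2.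
    have d1 : d <= 1 by rewrite /d; lra.
    have d0 : 0 <= d by rewrite /d; lra.
    have [z|z] := posnP m2; first by move: b2; rewrite z mulr0; lra.
    have z1 : 1 <= m2%:R :> R by rewrite ler1n.
    have : 0 <= d * (m2%:R - 1) by rewrite mulr_ge0 //; lra.
    by lra.
  apply: le_trans (wsum_le1 Px _ _) _; rewrite ler_nat.
  apply: leq_trans (pairs_max _ _ _) _; rewrite mulnC leq_mul //.
  apply: (@leq_trans #|X|); first by rewrite subset_leq_card // subsetIr.
  by rewrite (leq_trans hX) // leq_mul2l leq_pexp2l ?orbT.
have := wsum_few esym eirr (nbrs e v) Px l0 t0 np cD; rewrite -/C -/k => w.
have : 0 <= (k - 2%:R) * (n - #|nbrs e v|%:R).
  by rewrite mulr_ge0 ?subr_ge0 ?dn //; lra.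
have : 0 < k ^+ 2 by rewrite exprn_gt0 //; lra.
by move: wb h; rewrite /d; lra.
Qed.

End Stability.

(** * Structure around a dominating set *)

Local Open Scope nat_scope.

Section Augment.
Variables (V : finType) (e : rel V).
Hypotheses (esym : symmetric e) (eirr : irreflexive e).

(** Off the path, the special cycle takes [1 + m] vertices of [K] and [m] of [U], and the [t]
    alternating cycles take [l t] of each. *)
Lemma special_exists l t m (K U : {set V}) u p : 0 < l ->
  (forall a u, a \in K -> u \in U -> e a u) ->
  path e u p -> u \in U -> last u p \in U -> uniq (u :: p) ->
  2 + size p + 2 * m = 2 * l ->
  1 + m + l * t <= #|K :\: [set z in u :: p]| ->
  m + l * t <= #|U :\: [set z in u :: p]| -> packing e (2 * l) t.+1.
Proof.
move=> l0 KU pp uU lp up sz cK cU.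
have KUd z : z \in K -> z \in U -> False by move=> zK zU; have := KU z z zK zU; rewrite eirr.
pose kl := take (1 + m + l * t) (enum (K :\: [set z in u :: p])).
pose ul := take (m + l * t) (enum (U :\: [set z in u :: p])).
have sk : size kl = 1 + m + l * t by rewrite size_takel // -cardE.
have su : size ul = m + l * t by rewrite size_takel // -cardE.
have ak z : z \in kl -> (z \in K) && (z \notin u :: p).
  by move=> /mem_take; rewrite mem_enum !inE andbC.
have au z : z \in ul -> (z \in U) && (z \notin u :: p).
  by move=> /mem_take; rewrite mem_enum !inE andbC.
have uk : uniq kl by rewrite take_uniq // enum_uniq.
have uu : uniq ul by rewrite take_uniq // enum_uniq.
case Ek : kl => [|a0 k']; first by rewrite Ek in sk.
have sk' : size k' = m + l * t by move: sk; rewrite Ek /= -addnA add1n => -[].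
have tk : size (take m k') = m by rewrite size_takel // sk' leq_addr.
have tu : size (take m ul) = m by rewrite size_takel // su leq_addr.
apply: (@special_packing V e esym K U KU l t a0 u p (take m k') (take m ul) (drop m k') (drop m ul)) => //.
- by rewrite tk tu.
- by rewrite tu.
- by rewrite size_drop sk' addKn.
- by rewrite size_drop su addKn.
- by rewrite cat_take_drop -Ek; apply/allP => z /ak /andP [].
- by rewrite /= uU cat_take_drop; apply/allP => z /au /andP [].
- rewrite (perm_uniq (s2 := (u :: p) ++ kl ++ ul)).
    rewrite !cat_uniq up uk uu /= andbT has_cat negb_or -!all_predC.
    apply/andP; split; [apply/andP; split|]; apply/allP => z /=.
    + by move=> /ak /andP [].
    + by move=> /au /andP [].
    + by move=> /au /andP [zU _]; apply/negP => /ak /andP [zK _]; exact: (KUd z).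
  rewrite Ek; move: (cat_take_drop m k') (cat_take_drop m ul).
  move: (take m k') (drop m k') (take m ul) (drop m ul) => k1 k2 u1 u2 <- <-.
  apply/permP => P; rewrite /= !count_cat /= !count_cat /=; clear; lia.
Qed.

Variables (l t : nat) (K U : {set V}).
Hypotheses (l1 : 1 < l) (KU : forall a u, a \in K -> u \in U -> e a u).
Hypotheses (cK : #|K| = (l * t.+1).-1) (cU : l * t.+1 + 4 <= #|U|).
Hypothesis np : ~ packing e (2 * l) t.+1.

Lemma notinKU u : u \in U -> u \notin K.
Proof. by move=> uU; apply/negP => uK; have := KU uK uU; rewrite eirr. Qed.

Lemma card_setD_size (A : {set V}) (s : seq V) m : m + size s <= #|A| ->
  m <= #|A :\: [set z in s]|.
Proof.
move=> h; have c : #|A :&: [set z in s]| <= size s.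
  by apply: leq_trans (subset_leq_card (subsetIr _ _)) _; rewrite cardsE; exact: card_size.
by rewrite cardsD; clear -h c; lia.
Qed.

Lemma setD_disjoint (A : {set V}) (s : seq V) : (forall z, z \in s -> z \notin A) ->
  A :\: [set z in s] = A.
Proof.
move=> H; apply/setP => z; rewrite !inE; case: (boolP (z \in s)) => //= /H.
by move=> /negPf ->.
Qed.

(** The path [u w u'] lets [w] stand in for a vertex of [K]: one cycle then uses only [l - 1]
    vertices of [K], and [t + 1] cycles fit into [l (t + 1) - 1]. *)
Lemma outside_common_nbr w u u' : w \notin K -> u \in U -> u' \in U -> e w u -> e w u' -> u = u'.
Proof.
move=> wK uU uU' ewu ewu'; apply/eqP/idPn => uu'; apply: np.
apply: (@special_exists l t (l - 2) K U u [:: w; u']) => //=.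
- by apply: leq_trans l1.
- by rewrite esym ewu ewu'.
- have ne a b : e a b -> a != b by move=> E; apply: contraTneq E => ->; rewrite eirr.
  by rewrite !inE negb_or uu' eq_sym (ne _ _ ewu) (ne _ _ ewu').
- by clear -l1; lia.
- rewrite setD_disjoint ?cK; first by rewrite mulnS; clear -l1; lia.
  by move=> z; rewrite !inE => /or3P [] /eqP -> //; exact: notinKU.
- by apply: card_setD_size; apply: leq_trans cU; rewrite mulnS /=; clear -l1; lia.
Qed.

(** The path [u u' a z z'] uses two edges inside [U], so again the cycle needs only [l - 1] vertices
    of [K], counting [a]; it requires [l >= 3]. *)
Lemma outside_disjoint_edges u u' z z' : 2 < l -> uniq [:: u; u'; z; z'] ->
  [set u; u'; z; z'] \subset U -> e u u' -> e z z' -> False.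
Proof.
move=> l3 uq /subsetP sU euu' ezz'; apply: np.
have [uU u'U zU z'U] : [/\ u \in U, u' \in U, z \in U & z' \in U].
  by split; apply: sU; rewrite !inE eqxx ?orbT.
have [a aK] : exists a, a \in K.
  by apply/card_gt0P; rewrite cK mulnS; clear -l1; lia.
have nK b : b \in U -> b != a by move=> /notinKU bK; apply: contraNneq bK => ->.
apply: (@special_exists l t (l - 3) K U u [:: u'; a; z; z']) => //=.
- by apply: leq_trans l1.
- by rewrite euu' (esym u') (KU aK u'U) (KU aK zU) ezz'.
- move: uq; rewrite /= !inE !negb_or !andbT => /and3P [/and3P [h1 h2 h3] /andP [h4 h5] h6].
  by rewrite h1 h2 h3 h4 h5 h6 !nK // ![a == _]eq_sym !nK.
- by clear -l3; lia.
- have -> : K :\: [set b in [:: u; u'; a; z; z']] = K :\ a.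
    apply/setP => b; rewrite !inE; have [->|ba] := eqVneq b a; first by rewrite !orbT.
    case bK : (b \in K); rewrite ?andbF //= andbT.
    have nb c : c \in U -> (b == c) = false.
      by move=> cU'; apply: contraNF (notinKU cU') => /eqP <-.
    by rewrite !nb.
  have := cardsD1 a K; rewrite aK cK mulnS; clear -l3; lia.
- by apply: card_setD_size; apply: leq_trans cU; rewrite mulnS /=; clear -l3; lia.
Qed.

End Augment.

Section JoinRelation.
Variables (V : finType) (e : rel V) (K U : {set V}).
Hypotheses (esym : symmetric e) (eirr : irreflexive e).

(** The rewired graph: a vertex outside [K :|: U] trades all its edges for those to [K]. *)
Definition join_rel : rel V := fun u w =>
  (u != w) && [|| u \in K, w \in K | [&& u \in U, w \in U & e u w]].

Lemma join_rel_sym : symmetric join_rel.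
Proof.
move=> u w; rewrite /join_rel eq_sym esym; case: (w == u) => //=.
by case: (u \in K); case: (w \in K); case: (u \in U); case: (w \in U).
Qed.

Lemma join_rel_irr : irreflexive join_rel.
Proof. by move=> u; rewrite /join_rel eqxx. Qed.

Lemma join_rel_out u w : u \notin K -> w \notin K -> join_rel u w -> [&& u \in U, w \in U & e u w].
Proof. by move=> uK wK; rewrite /join_rel (negPf uK) (negPf wK) /= => /andP []. Qed.

Lemma outside_edge_unique u0 v0 :
  (forall w u u', w \notin K -> u \in U -> u' \in U -> e w u -> e w u' -> u = u') ->
  (forall u u' z z', uniq [:: u; u'; z; z'] -> [set u; u'; z; z'] \subset U ->
     e u u' -> e z z' -> False) ->
  u0 \notin K -> v0 \notin K -> u0 \in U -> v0 \in U -> e u0 v0 ->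
  forall u v, u \in U -> v \in U -> e u v -> (u == u0) && (v == v0) || (u == v0) && (v == u0).
Proof.
move=> H1 H2 u0K v0K u0U v0U e00 u v uU vU euv.
have ne a b : e a b -> a != b by move=> E; apply: contraTneq E => ->; rewrite eirr.
have [E|n1] := eqVneq u u0; first by rewrite E in euv *; rewrite (H1 u0 v v0) ?eqxx.
have [E|n2] := eqVneq u v0.
  by rewrite E in euv *; rewrite (H1 v0 v u0) ?eqxx ?orbT // esym.
have [E|n3] := eqVneq v u0.
  by rewrite E in euv; case/eqP: n2; apply: (H1 u0) => //; rewrite esym.
have [E|n4] := eqVneq v v0.
  by rewrite E in euv; case/eqP: n1; apply: (H1 v0) => //; rewrite esym.
exfalso; apply: (H2 u v u0 v0) => //.
  by rewrite /= !inE !negb_or (ne _ _ euv) n1 n2 n3 n4 (ne _ _ e00).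
by apply/subsetP => z; rewrite !inE -!orbA => /or4P [] /eqP ->.
Qed.

(** Outside [K] the rewired graph is a matching, and has at most one edge if [l >= 3], so every
    [2 l]-cycle uses [l] of the [l (t + 1) - 1] vertices of [K]. *)
Lemma join_rel_free l t : 1 < l -> #|K| = (l * t.+1).-1 ->
  (forall w u u', w \notin K -> u \in U -> u' \in U -> e w u -> e w u' -> u = u') ->
  (2 < l -> forall u u' z z', uniq [:: u; u'; z; z'] -> [set u; u'; z; z'] \subset U ->
     e u u' -> e z z' -> False) ->
  ~ packing join_rel (2 * l) t.+1.
Proof.
move=> l1 cK H1 H2.
have cK' : #|K| < l * t.+1 by rewrite cK mulnS; clear -l1; lia.
move: l1 cK' H2; rewrite leq_eqVlt => /predU1P [<- cK' _|l3 cK' H2].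
  apply: (matching_free join_rel_sym cK') => u v w uK vK wK.
  move=> /(join_rel_out uK vK) /and3P [uU vU euv] /(join_rel_out uK wK) /and3P [_ wU euw].
  exact: (H1 u).
have [/existsP [u0 /existsP [v0 /and4P [u0K v0K u00 e0]]]|none] :=
   boolP [exists u0, exists v0, [&& u0 \notin K, v0 \notin K, u0 != v0 & join_rel u0 v0]].
  have /and3P [u0U v0U e00] := join_rel_out u0K v0K e0.
  apply: (@one_edge_free V _ l t.+1 K u0 v0 l3 cK') => u v uK vK /(join_rel_out uK vK) /and3P [uU vU euv].
  exact: (outside_edge_unique H1 (H2 l3) u0K v0K u0U v0U e00).
have [x0 _|V0] := pickP [pred x : V | true]; last first.
  move=> np0; case: np0 => cs [sc ac uc]; case: cs sc ac uc => [|c cs] //= _ /andP [/andP [/eqP sz _] _] _.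
  case: c sz => [|z c]; last by have := V0 z.
  by move: l3; clear; case: l.
(* With no edge outside [K], the degenerate pair [x0], [x0] serves as the exceptional edge. *)
apply: (@one_edge_free V _ l t.+1 K x0 x0 l3 cK') => u v uK vK euv.
move: none; rewrite negb_exists => /forallP /(_ u); rewrite negb_exists => /forallP /(_ v).
rewrite uK vK euv /= andbT; move: euv; rewrite /join_rel => /andP [-> //].
Qed.
End JoinRelation.

(** * Re-attaching the remaining vertices *)

Local Open Scope ring_scope.

Section Collapse.
Variable R : archiRealFieldType.
Hypothesis hasP : has_perron R.

(** Extremality stated for trial vectors on a fixed vertex type, so that no eigenvector of the
    competitor has to be found. *)
Definition spectral_max (l t : nat) (V : finType) (r : R) : Prop :=
  forall e : rel V, symmetric e -> irreflexive e -> ~ packing e (2 * l) t ->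
  forall y : V -> R, quad e y <= r * sqnorm y.

(** For a set [E] holding a small proportion of the vertices, this makes [rE] small compared with
    [r], which is at least of order [sqrt n]. *)
Lemma induced_bound l t : (1 < l)%N -> exists2 B : R, 0 <= B & forall (V : finType) (e : rel V),
  symmetric e -> irreflexive e -> ~ packing e (2 * l) t -> forall E : {set V},
  exists rE : R, [/\ 0 <= rE, rE ^+ 2 <= (`|tight R l t| + 1) * #|E|%:R + B &
    forall y : V -> R, \sum_(w in E) y w * \sum_(z in nbrs e w :&: E) y z
                       <= rE * \sum_(w in E) y w ^+ 2].
Proof.
move=> l1; have [B HB] := spec_bound_all hasP t l1 ltr01.
exists `|B|; first exact: normr_ge0.
move=> V e esym eirr np E.
have [E0|[v vE]] := set_0Vmem E.
  exists 0; rewrite E0; split=> // [|y]; last by rewrite !big_set0 mulr0.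
  by rewrite expr0n /= cards0 mulr0 add0r normr_ge0.
pose T : finType := {w : V | w \in E}; pose eT : rel T := fun u w => e (val u) (val w).
have cT : #|T| = #|E| by rewrite card_sig; apply: eq_card => w; rewrite !inE.
have sT : symmetric eT by move=> u w; rewrite /eT esym.
have iT : irreflexive eT by move=> u; rewrite /eT eirr.
have nT : ~ packing eT (2 * l) t.
  case=> cs [sc ac uc]; apply: np; exists [seq map val c | c <- cs]; split.
  - by rewrite size_map.
  - rewrite all_map; apply/allP => c /(allP ac) /andP [/= sz cc].
    by rewrite size_map sz cycle_map.
  - by rewrite -map_flatten map_inj_uniq //; exact: val_inj.
have T0 : (0 < #|T|)%N by rewrite cT; apply/card_gt0P; exists v.
have [rE [x' Px']] := hasP sT iT T0.
exists rE; split; first exact: perron_r_ge0 Px'.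
  apply: le_trans (HB T eT sT iT nT rE x' Px') _; rewrite cT.
  by apply: lerD; rewrite ?ler_norm // ler_wpM2r ?ler0n // lerD2r ler_norm.
move=> y; have [_ _ _ /(_ (y \o val))] := Px'; rewrite /quad /sqnorm.
rewrite [X in _ -> _ <= _ * X](big_sub [in E]) [X in _ -> X <= _](big_sub [in E]) /=.
congr (is_true (_ <= _)); apply: eq_bigr => u _; congr (_ * _).
rewrite /nbsum (eq_bigl (fun z => (z \in E) && e (val u) z)); last first.
  by move=> z; rewrite in_setI in_nbrs andbC.
by rewrite (big_sub_cond [in E]).
Qed.

Section OneGraph.
Variables (V : finType) (e : rel V).
Hypotheses (esym : symmetric e) (eirr : irreflexive e).
Variables (r : R) (x : V -> R).
Hypothesis Px : perron e r x.
Local Notation n := (#|V|%:R : R).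

Definition bilin (A C : {set V}) : R := \sum_(v in A) x v * \sum_(z in nbrs e v :&: C) x z.

Lemma bilinC A C : bilin A C = bilin C A.
Proof.
rewrite /bilin (eq_bigr (fun v => \sum_(z in nbrs e v :&: C) x v * x z)); last first.
  by move=> v _; rewrite mulr_sumr.
rewrite (exchange_big_dep [in C]) /=; last by move=> v z _; rewrite in_setI => /andP [].
apply: eq_bigr => z zC; rewrite mulr_sumr; apply: eq_big => [v|v _]; last by rewrite mulrC.
by rewrite !in_setI !in_nbrs zC andbT esym andbC.
Qed.

(** Pair the eigenvalue equation with [x] on [E] to get [(r - rE) s <= b q], and use
    [q^2 <= #|E| s]. *)
Lemma outside_mass (E : {set V}) (b rE : R) : 0 <= b -> rE < r ->
  (forall w, w \in E -> \sum_(z in nbrs e w :\: E) x z <= b) ->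
  bilin E E <= rE * \sum_(w in E) x w ^+ 2 ->
  (r - rE) * \sum_(w in E) x w <= b * #|E|%:R /\ bilin E (~: E) <= b * \sum_(w in E) x w.
Proof.
move=> b0 rr hb hE; set q := \sum_(w in E) x w; set s := \sum_(w in E) x w ^+ 2 in hE *.
have hB : bilin E (~: E) <= b * q.
  rewrite /bilin /q mulr_sumr; apply: ler_sum => w wE; rewrite mulrC.
  by rewrite ler_wpM2r ?(perron_ge0 Px) // -setDE hb.
split=> //.
have E1 : r * s = bilin E (~: E) + bilin E E.
  rewrite /bilin /s mulr_sumr -big_split /=; apply: eq_bigr => w _.
  rewrite expr2 mulrCA -(perron_eig Px) (big_setID E) /= mulrDr addrC.
  by rewrite setDE.
have C := cauchy_sum E x; rewrite -/q -/s in C.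
have q0 : 0 <= q by apply: sumr_ge0 => w _; exact: (perron_ge0 Px).
have [->|q1] := eqVneq q 0; first by rewrite mulr0 mulr_ge0 ?ler0n.
have {}q0 : 0 < q by rewrite lt0r q1.
rewrite -(ler_pM2r q0).
have h1 : (r - rE) * s <= b * q by lra.
have h2 : (r - rE) * q ^+ 2 <= (r - rE) * (#|E|%:R * s) by rewrite ler_wpM2l //; lra.
have h3 : #|E|%:R * ((r - rE) * s) <= #|E|%:R * (b * q) by rewrite ler_wpM2l ?ler0n.
by move: h2 h3; rewrite expr2; lra.
Qed.

Lemma quad_nbrs (e' : rel V) (y : V -> R) :
  quad e' y = \sum_v y v * \sum_(z in nbrs e' v) y z.
Proof. by apply: eq_bigr => v _; rewrite nbsum_nbrs. Qed.

(* In [join_rel e K U] each vertex of [E] is joined to exactly [K], so the optimal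
   trial vector equals [S / r] on [E]; elsewhere it is kept equal to [x]. *)
Lemma rewire (K U : {set V}) : 0 < r -> [disjoint K & U] ->
  (forall a u, a \in K -> u \in U -> e a u) ->
  let E := ~: (K :|: U) in let S := \sum_(v in K) x v in
  (forall y : V -> R, quad (join_rel e K U) y <= r * sqnorm y) ->
  #|E|%:R * S ^+ 2 / r <= bilin E (~: E).
Proof.
move=> r0 dKU KU E S Hy.
have EK v : v \in E -> (v \notin K) && (v \notin U) by rewrite !inE negb_or.
pose y v := if v \in E then S / r else x v.
have yE v : v \in E -> y v = S / r by rewrite /y => ->.
have ynE v : v \notin E -> y v = x v by rewrite /y => /negPf ->.
have KE v : v \in K -> v \notin E by move=> vK; rewrite !inE vK.
have UE v : v \in U -> v \notin E by move=> vU; rewrite !inE vU orbT.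
have S0 : 0 <= S by apply: sumr_ge0 => v _; exact: (perron_ge0 Px).
have y0 v : 0 <= y v by rewrite /y; case: ifP => _; rewrite ?(perron_ge0 Px) // divr_ge0 // ltW.
have subsum (A C : {set V}) : A \subset C -> \sum_(z in A) y z <= \sum_(z in C) y z.
  move=> sAC; rewrite [leRHS](big_setID A) /= (setIidPr sAC) lerDl.
  by apply: sumr_ge0.
have sumE : \sum_(z in E) y z = #|E|%:R * (S / r).
  by rewrite (eq_bigr (fun=> S / r)) ?sumr_const ?mulr_natl // => v; exact: yE.
have sumD v : \sum_(z in nbrs e v :\: E) y z = \sum_(z in nbrs e v :\: E) x z.
  by apply: eq_bigr => z; rewrite in_setD => /andP [/ynE].
have nE v : v \in E -> \sum_(z in nbrs (join_rel e K U) v) y z = S.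
  move=> vE; have /andP [vK vU] := EK v vE.
  rewrite (eq_bigl [in K]); first by apply: eq_bigr => z /KE /ynE.
  move=> z; rewrite in_nbrs /join_rel (negPf vK) (negPf vU) /= orbF.
  by case: (boolP (z \in K)) => zK; rewrite ?andbF // andbT; apply: contraNneq vK => ->.
have nK v : v \in K -> \sum_(z in nbrs e v :\: E) x z + #|E|%:R * (S / r)
    <= \sum_(z in nbrs (join_rel e K U) v) y z.
  move=> vK; rewrite -sumD -sumE [leRHS](big_setID E) /= [leLHS]addrC; apply: lerD.
    apply: subsum; apply/subsetP => z zE; rewrite in_setI zE andbT in_nbrs /join_rel vK /= andbT.
    by apply: contraTneq vK => ->; have /andP [] := EK z zE.
  apply: subsum; apply/subsetP => z; rewrite !in_setD !in_nbrs => /andP [-> evz] /=.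
  by rewrite /join_rel vK /= andbT; apply: contraTneq evz => ->; rewrite eirr.
have nU v : v \in U -> \sum_(z in nbrs e v :\: E) x z <= \sum_(z in nbrs (join_rel e K U) v) y z.
  move=> vU; rewrite -sumD; apply: subsum; apply/subsetP => z.
  rewrite in_setD !in_nbrs => /andP [zE evz]; rewrite /join_rel evz vU /= andbT.
  have -> : v != z by apply: contraTneq evz => ->; rewrite eirr.
  by move: zE; rewrite !inE negbK => /orP [->|->]; rewrite ?orbT.
have split3 (f : V -> R) : \sum_v f v = \sum_(v in E) f v + \sum_(v in K) f v + \sum_(v in U) f v.
  transitivity (\sum_(v in [set: V]) f v); first by apply: eq_bigl => v; rewrite inE.
  rewrite (big_setID E) /= setTI -addrA; congr (_ + _).
  rewrite (big_setID K) /=; congr (_ + _); apply: eq_bigl => v; rewrite !inE.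
    by case: (boolP (v \in K)) => vK; rewrite ?andbF ?orbT.
  case: (boolP (v \in K)) => vK /=; last by rewrite negbK andbT.
  by rewrite (disjointFr dKU vK).
have hQ : bilin (~: E) (~: E) + 2%:R * (#|E|%:R * S ^+ 2 / r) <= quad (join_rel e K U) y.
  rewrite quad_nbrs split3.
  have -> : \sum_(v in E) y v * \sum_(z in nbrs (join_rel e K U) v) y z = #|E|%:R * S ^+ 2 / r.
    rewrite (eq_bigr (fun=> S / r * S)); last by move=> v vE; rewrite yE // nE.
    by rewrite sumr_const -mulr_natl; ring.
  have hK : \sum_(v in K) x v * \sum_(z in nbrs e v :&: ~: E) x z + #|E|%:R * S ^+ 2 / r
     <= \sum_(v in K) y v * \sum_(z in nbrs (join_rel e K U) v) y z.
    have -> : #|E|%:R * S ^+ 2 / r = \sum_(v in K) x v * (#|E|%:R * (S / r)).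
      by rewrite -mulr_suml -/S; ring.
    rewrite -big_split /=; apply: ler_sum => v vK; rewrite -mulrDr ynE ?KE //.
    by rewrite ler_wpM2l ?(perron_ge0 Px) // -setDE nK.
  have hU : \sum_(v in U) x v * \sum_(z in nbrs e v :&: ~: E) x z
     <= \sum_(v in U) y v * \sum_(z in nbrs (join_rel e K U) v) y z.
    apply: ler_sum => v vU; rewrite ynE ?UE //.
    by rewrite ler_wpM2l ?(perron_ge0 Px) // -setDE nU.
  have -> : bilin (~: E) (~: E) = \sum_(v in K) x v * \sum_(z in nbrs e v :&: ~: E) x z
     + \sum_(v in U) x v * \sum_(z in nbrs e v :&: ~: E) x z.
    rewrite /bilin (big_setID K) /=; congr (_ + _); apply: eq_bigl => v; rewrite !inE.
      by case: (boolP (v \in K)) => vK; rewrite ?andbF ?orbT.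
    case: (boolP (v \in K)) => vK /=; last by rewrite negbK.
    by rewrite (disjointFr dKU vK).
  by lra.
have hN : r * sqnorm y = r * \sum_(v in ~: E) x v ^+ 2 + #|E|%:R * S ^+ 2 / r.
  rewrite /sqnorm; have -> : \sum_v y v ^+ 2 = \sum_(v in [set: V]) y v ^+ 2.
    by apply: eq_bigl => v; rewrite inE.
  rewrite (big_setID E) /= setTI setTD addrC mulrDr; congr (_ * _ + _).
    by apply: eq_bigr => v; rewrite in_setC => /ynE ->.
  rewrite (eq_bigr (fun=> (S / r) ^+ 2)); last by move=> v /yE ->.
  by rewrite sumr_const -mulr_natl; field; rewrite lt0r_neq0.
have hP : r * \sum_(v in ~: E) x v ^+ 2 = bilin (~: E) (~: E) + bilin E (~: E).
  rewrite [bilin E _]bilinC /bilin mulr_sumr -big_split /=; apply: eq_bigr => v vE.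
  by rewrite -mulrDr expr2 mulrCA -(perron_eig Px) (big_setID E) /= addrC -setDE.
(* [bilin (~: E) (~: E)] cancels, and so does one of the two copies of [#|E| S^2 / r]. *)
have := Hy y; lra.
Qed.

End OneGraph.
End Collapse.

Section Core.
Variable R : archiRealFieldType.
Hypothesis hasP : has_perron R.

Lemma predn_tight l t : (0 < l)%N -> (l * t.+1).-1%:R = tight R l t.+1 :> R.
Proof. by move=> l0; rewrite tightE // subn1. Qed.

(** The competitor [e0] is a [k]-clique joined to an independent set. The trial vector is [1] on the
    clique and [k / r] elsewhere, as the eigenvalue equation off the clique prescribes. *)
Lemma spectral_max_lower l t (V : finType) (r : R) : (1 < l)%N -> 0 <= r ->
  spectral_max l t.+1 V r -> ((l * t.+1).-1 < #|V|)%N ->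
  0 < r /\ tight R l t.+1 * (#|V|%:R - tight R l t.+1) <= r ^+ 2.
Proof.
move=> l1 r0 Ext; set k := (l * t.+1).-1 => kn.
have l0 : (0 < l)%N by apply: leq_trans l1.
have k0 : (0 < k)%N by rewrite /k mulnS; move: l1; clear; lia.
have : (k <= #|[set: V]|)%N by rewrite cardsT ltnW.
move=> /ex_subset_card [K _ cK].
pose e0 : rel V := fun u w => (u != w) && ((u \in K) || (w \in K)).
have s0 : symmetric e0 by move=> u w; rewrite /e0 eq_sym orbC.
have i0 : irreflexive e0 by move=> u; rewrite /e0 eqxx.
have np0 : ~ packing e0 (2 * l) t.+1.
  have J : join_rel e0 K set0 =2 e0.
    by move=> u w; rewrite /join_rel /e0 !inE orbF.
  move=> [cs [sc ac uc]].
  apply: (@join_rel_free V e0 K set0 s0 i0 l t l1 cK).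
  - by move=> w u u' _; rewrite inE.
  - move=> _ u u' z z' _ /subsetP /(_ u).
    by rewrite !inE eqxx => /(_ isT).
  - exists cs; split=> //; apply/allP => c /(allP ac) /andP [-> cc] /=.
    by rewrite (eq_cycle J).
have {}Ext := Ext e0 s0 i0 np0.
set n : R := #|V|%:R; rewrite -predn_tight // -/k.
have kR : 1 <= k%:R :> R by rewrite ler1n.
have nk : k%:R < n by rewrite ltr_nat.
have cKC : #|~: K|%:R = n - k%:R by rewrite cardsCs setCK natrB cK // ltnW.
have main a b : 0 <= a -> 0 <= b ->
   2%:R * (k%:R * (n - k%:R) * a * b) <= r * (k%:R * a ^+ 2 + (n - k%:R) * b ^+ 2).
  move=> a0 b0; pose y v := if v \in K then a else b.
  have y0 v : 0 <= y v by rewrite /y; case: ifP.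
  have all_ (f : V -> R) : \sum_v f v = \sum_(v in K) f v + \sum_(v in ~: K) f v.
    by rewrite (bigID [in K]); congr (_ + _); apply: eq_bigl => v; rewrite inE.
  have yK : \sum_(v in K) y v = k%:R * a.
    by rewrite (eq_bigr (fun=> a)) ?sumr_const ?cK ?mulr_natl // /y => v ->.
  have yC : \sum_(v in ~: K) y v = (n - k%:R) * b.
    rewrite (eq_bigr (fun=> b)); first by rewrite sumr_const -[LHS]mulr_natl cKC.
    by rewrite /y => v; rewrite inE => /negPf ->.
  have sub (A : {set V}) v : A \subset nbrs e0 v -> \sum_(z in A) y z <= nbsum e0 y v.
    move=> /setIidPr sA; rewrite nbsum_nbrs [leRHS](big_setID A) /= sA lerDl.
    exact: sumr_ge0.
  have hK v : v \in K -> (n - k%:R) * b <= nbsum e0 y v.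
    move=> vK; rewrite -yC; apply: sub; apply/subsetP => z; rewrite !inE /e0 vK andbT.
    by apply: contraNneq => <-.
  have hC v : v \in ~: K -> k%:R * a <= nbsum e0 y v.
    rewrite inE => vK; rewrite -yK; apply: sub; apply/subsetP => z zK; rewrite !inE /e0 zK orbT andbT.
    by apply: contraNneq vK => ->.
  have := Ext y; rewrite /quad /sqnorm !all_.
  have -> : \sum_(v in K) y v ^+ 2 = k%:R * a ^+ 2.
    by rewrite (eq_bigr (fun=> a ^+ 2)) ?sumr_const ?cK ?mulr_natl // /y => v ->.
  have -> : \sum_(v in ~: K) y v ^+ 2 = (n - k%:R) * b ^+ 2.
    rewrite (eq_bigr (fun=> b ^+ 2)); first by rewrite sumr_const -[LHS]mulr_natl cKC.
    by rewrite /y => v; rewrite inE => /negPf ->.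
  have : k%:R * a * ((n - k%:R) * b) <= \sum_(v in K) y v * nbsum e0 y v.
    by rewrite -yK mulr_suml; apply: ler_sum => v vK; rewrite ler_wpM2l ?hK.
  have : (n - k%:R) * b * (k%:R * a) <= \sum_(v in ~: K) y v * nbsum e0 y v.
    by rewrite -yC mulr_suml; apply: ler_sum => v vK; rewrite ler_wpM2l ?hC.
  lra.
(* The constant trial vector gives positivity first, so that [k / r] makes sense below. *)
have r1 : 0 < r.
  rewrite lt0r r0 andbT; apply/eqP => rE; have := main 1 1 ler01 ler01; rewrite rE !expr1n.
  have : 0 < k%:R * (n - k%:R) by rewrite mulr_gt0 //; lra.
  by lra.
split=> //.
have := main 1 (k%:R / r) ler01 (divr_ge0 (ler0n _ _) r0).
rewrite expr1n !mulr1 => h.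
have h2 : 2%:R * (k%:R * (n - k%:R) * (k%:R / r)) * r <= r * (k%:R + (n - k%:R) * (k%:R / r) ^+ 2) * r.
  by rewrite ler_wpM2r.
have E1 : 2%:R * (k%:R * (n - k%:R) * (k%:R / r)) * r = 2%:R * k%:R * (k%:R * (n - k%:R)).
  by field; rewrite lt0r_neq0.
have E2 : r * (k%:R + (n - k%:R) * (k%:R / r) ^+ 2) * r = k%:R * r ^+ 2 + k%:R * (k%:R * (n - k%:R)).
  by field; rewrite lt0r_neq0.
rewrite E1 E2 in h2.
have k00 : 0 < k%:R :> R by lra.
rewrite -(ler_pM2l k00); lra.
Qed.

Section Leftover.
Variables (V : finType) (e : rel V).
Hypotheses (esym : symmetric e) (eirr : irreflexive e).
Variables (r : R) (x : V -> R).
Hypothesis Px : perron e r x.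

(** Two passes of [outside_mass]. The crude bound [k + 1] makes the mass of [E] small, which forces
    entries at most [1/4] on [U]. A vertex of [E] misses an entry at least [1/2] of [K] and has at
    most one neighbour in [U], so it receives at most [S - 1/4] from outside [E]; [rewire] then
    yields a contradiction, as re-attaching it gives [S]. *)
Lemma no_leftover (k rE : R) (K U : {set V}) : #|K|%:R = k -> 2%:R <= k ->
  [disjoint K & U] -> (forall a u, a \in K -> u \in U -> e a u) ->
  (forall w u u', w \notin K -> u \in U -> u' \in U -> e w u -> e w u' -> u = u') ->
  (forall y : V -> R, quad (join_rel e K U) y <= r * sqnorm y) ->
  8%:R * (k + 1) <= r -> 16%:R * (k + 1) * #|~: (K :|: U)|%:R <= r ^+ 2 ->
  0 <= rE <= r / (8%:R * k) ->
  bilin e x (~: (K :|: U)) (~: (K :|: U)) <= rE * \sum_(w in ~: (K :|: U)) x w ^+ 2 ->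
  (forall a, a \in K -> 2%:R^-1 <= x a) ->
  (forall w, w \in ~: (K :|: U) -> exists2 a, a \in K & ~~ e w a) ->
  ~: (K :|: U) = set0.
Proof.
move=> kE k2 dKU KU F1 Hy rk hE /andP [rE0 hrE] rEq xK hw.
have r0 : 0 < r by lra.
have Brew := rewire esym eirr Px r0 dKU KU Hy.
set E := ~: (K :|: U) in hE rEq hw Brew *.
have hrE2 : rE <= r / 16%:R.
  by apply: le_trans hrE _; rewrite ler_wpM2l ?(ltW r0) // lef_pV2 ?posrE; lra.
have rEr : rE < r by lra.
pose q := \sum_(w in E) x w.
have q0 : 0 <= q by apply: sumr_ge0 => w _; exact: (perron_ge0 Px).
have oneU w : w \notin K -> (#|nbrs e w :&: U| <= 1)%N.
  move=> wK; apply/card_le1_eqP => u u'; rewrite !in_setI !in_nbrs => /andP [h1 h2] /andP [h3 h4].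
  exact: (F1 w).
have nE_sub w : nbrs e w :\: E = (nbrs e w :&: K) :|: (nbrs e w :&: U).
  by apply/setP => z; rewrite !inE negbK andbC andb_orr.
have sumKU w (c : R) : w \notin K -> 0 <= c -> (forall u, u \in U -> x u <= c) ->
    \sum_(z in nbrs e w :\: E) x z <= \sum_(z in nbrs e w :&: K) x z + c.
  move=> wK c0 hc; rewrite nE_sub (big_setID (nbrs e w :&: K)) /= setUK setDUl setDv set0U lerD2l.
  apply: (@le_trans _ _ (\sum_(z in nbrs e w :&: U) x z)).
    exact: (sum_setS Px (subsetDl _ _)).
  apply: (@le_trans _ _ (c * #|nbrs e w :&: U|%:R)).
    by apply: sum_le_card => z; rewrite in_setI => /andP [_ /hc].
  by rewrite -[leRHS]mulr1 ler_wpM2l // lern1 oneU.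
have KsumL w : \sum_(z in nbrs e w :&: K) x z <= k.
  apply: (@le_trans _ _ (1 * #|nbrs e w :&: K|%:R)).
    by apply: sum_le_card => z _; exact: (perron_le1 Px).
  by rewrite mul1r -kE ler_nat subset_leq_card // subsetIr.
have EnK w : w \in E -> w \notin K by rewrite !inE negb_or => /andP [].
have q1 : q * r <= r ^+ 2 / 8%:R.
  have k10 : 0 <= k + 1 by lra.
  have hb1 w : w \in E -> \sum_(z in nbrs e w :\: E) x z <= k + 1.
    move=> wE; apply: le_trans (sumKU w 1 (EnK w wE) ler01 (fun u _ => perron_le1 Px u)) _.
    by rewrite lerD2r.
  have [h _] := outside_mass Px k10 rEr hb1 rEq.
  have h3 : r / 2%:R * q <= (r - rE) * q by rewrite ler_wpM2r //; lra.
  by rewrite -/q in h; lra.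
have xU u : u \in U -> x u <= 4%:R^-1.
  move=> uU; have uK : u \notin K by rewrite (disjointFl dKU uU).
  have h1 : r * x u <= q + (k + 1).
    rewrite -(perron_eig Px) (big_setID E) /=; apply: lerD.
      exact: (sum_setS Px (subsetIr _ _)).
    apply: le_trans (sumKU u 1 uK ler01 (fun u _ => perron_le1 Px u)) _.
    by rewrite lerD2r.
  have h2 : r * (r * x u) <= r * (q + (k + 1)) by rewrite ler_wpM2l // ltW.
  have r20 : 0 < r ^+ 2 by rewrite exprn_gt0.
  rewrite -(ler_pM2l r20) expr2 -mulrA; apply: le_trans h2 _.
  have h3 : 8%:R * (k + 1) * r <= r * r by rewrite ler_wpM2r // ltW.
  by move: q1; rewrite expr2; lra.
pose S := \sum_(v in K) x v.
have S1 : 1 <= S.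
  apply: (@le_trans _ _ (\sum_(v in K) 2%:R^-1)); last by apply: ler_sum => v /xK.
  by rewrite sumr_const -[leRHS]mulr_natl kE; lra.
have Sk : S <= k.
  apply: (@le_trans _ _ (1 * #|K|%:R)); last by rewrite mul1r kE.
  by apply: sum_le_card => z _; exact: (perron_le1 Px).
have hb w : w \in E -> \sum_(z in nbrs e w :\: E) x z <= S - 4%:R^-1.
  move=> wE; have wK := EnK w wE.
  apply: le_trans (sumKU w 4%:R^-1 wK _ xU) _; first by lra.
  have [a aK naw] := hw w wE; rewrite -in_nbrs in naw.
  have : \sum_(z in nbrs e w :&: K) x z <= \sum_(z in K :\ a) x z.
    apply: (sum_setS Px); apply/subsetP => z; rewrite in_setI in_setD1 => /andP [h ->]; rewrite andbT.
    by apply: contraNneq naw => <-.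
  have : S = x a + \sum_(z in K :\ a) x z by rewrite /S (big_setD1 a).
  by have := xK a aK; lra.
have b0 : 0 <= S - 4%:R^-1 by lra.
have [h1 h2] := outside_mass Px b0 rEr hb rEq.
rewrite -/q in h1 h2; rewrite -/S in Brew.
apply/eqP; rewrite -cards_eq0 -leqn0 leqNgt; apply/negP => E0.
  have ER : 0 < #|E|%:R :> R by rewrite ltr0n.
  have h3 : #|E|%:R * S ^+ 2 / r <= (S - 4%:R^-1) * q := le_trans Brew h2.
  rewrite ler_pdivrMr // in h3.
  have rr0 : 0 < r - rE by clear -rEr Px hasP; lra.
  have h4 : (r - rE) * (#|E|%:R * S ^+ 2) <= (r - rE) * ((S - 4%:R^-1) * q * r) by rewrite ler_wpM2l // ltW.
  have h5 : ((S - 4%:R^-1) * r) * ((r - rE) * q) <= ((S - 4%:R^-1) * r) * ((S - 4%:R^-1) * #|E|%:R).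
    by rewrite ler_wpM2l // mulr_ge0 // ltW.
  have h6 : #|E|%:R * ((r - rE) * S ^+ 2) <= #|E|%:R * ((S - 4%:R^-1) ^+ 2 * r) by rewrite expr2; clear -h4 h5 Px hasP; lra.
  rewrite ler_pM2l // in h6.
  have h7 : rE * (8%:R * k) <= r by rewrite -ler_pdivlMr //; clear -k2 Px hasP; lra.
  have h8 : rE * (8%:R * S) <= r.
    by apply: le_trans h7; rewrite ler_wpM2l //; clear -Sk Px hasP; lra.
  have h9 : S * (rE * (8%:R * S)) <= S * r by rewrite ler_wpM2l //; clear -S1 Px hasP; lra.
  have h10 : 1 * r <= S * r by rewrite ler_wpM2r // ltW.
  (* [h6] reads [(r - rE) S^2 <= (S - 1/4)^2 r]. By [h9] the left side loses at most [S r / 8],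
     while the right side loses [S r / 2 - r / 16]. *)
  by move: h6; rewrite !expr2; clear -h9 h10 r0 Px hasP; lra.
Qed.

End Leftover.

Lemma extremal_core l t : (1 < l)%N -> (3 <= l * t.+1)%N -> exists N : nat,
  forall (V : finType) (e : rel V), symmetric e -> irreflexive e ->
  ~ packing e (2 * l) t.+1 -> forall (r : R) x, perron e r x ->
  (N <= #|V|)%N -> spectral_max l t.+1 V r ->
  exists2 K : {set V}, #|K| = (l * t.+1).-1 &
    (forall a u, a \in K -> u \notin K -> e a u) /\ (exists2 a, a \in K & 0 < x a).
Proof.
move=> l1 lt3; have l0 : (0 < l)%N by apply: leq_trans l1.
pose k : R := tight R l t.+1.
have kE : ((l * t.+1).-1)%:R = k by rewrite predn_tight.
have k2 : 2%:R <= k by rewrite -kE ler_nat; move: lt3; clear; lia.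
have k4 : 1 <= (k + 1) ^+ 4 by rewrite exprn_ege1 //; lra.
(* Keeps both [eps (k + 1) k], for the size of [E], and [eps (k + 1) k^3], for [rE], at most
   [1/100]. *)
pose eps := (100%:R * (k + 1) ^+ 4)^-1.
have eE : 100%:R * (k + 1) ^+ 4 * eps = 1 by rewrite /eps divff // lt0r_neq0 //; lra.
have e0 : 0 < eps by rewrite /eps invr_gt0; lra.
have kabs : `|k| = k by rewrite ger0_norm //; lra.
have kk : (k + 1) * k <= (k + 1) ^+ 4.
  apply: (@le_trans _ _ ((k + 1) ^+ 2)); first by rewrite expr2 ler_wpM2l; lra.
  by rewrite ler_weXn2l //; lra.
have kkk : (k + 1) * k * k ^+ 2 <= (k + 1) ^+ 4.
  have -> : (k + 1) * k * k ^+ 2 = (k + 1) * k ^+ 3 by ring.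
  have -> : (k + 1) ^+ 4 = (k + 1) * (k + 1) ^+ 3 by ring.
  rewrite ler_wpM2l //; first by lra.
  by rewrite lerXn2r ?nnegrE //; lra.
have epsM (c : R) : c <= (k + 1) ^+ 4 -> eps * c <= 100%:R^-1.
  move=> hc; apply: (@le_trans _ _ (eps * (k + 1) ^+ 4)); last by lra.
  by rewrite ler_wpM2l // ltW.
have ek2 := epsM _ kk; have ek3 := epsM _ kkk; clear epsM kk kkk k4 eE.
have ek1 : eps * (k + 1) <= 100%:R^-1.
  by apply: le_trans ek2; rewrite ler_wpM2l ?(ltW e0) // -[leLHS]mulr1 ler_wpM2l; lra.
have e1 : eps <= 100%:R^-1.
  by apply: le_trans ek1; rewrite -[leLHS]mulr1 ler_wpM2l ?(ltW e0) //; lra.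
clearbody eps.
have eps01 : 0 < eps < 1 by rewrite e0 /=; lra.
have [N1 HN1] := stability hasP l1 (ltn0Sn t) lt3 eps01.
have [B B0 HB] := induced_bound hasP t.+1 l1.
(* The summands serve, in turn, the constant [B] in the bound on [rE], the inequality
   [8 (k + 1) <= r], and the size of [U]. *)
have [N2 HN2] := nat_above (64%:R * k ^+ 2 * B * 3%:R + 128%:R * (k + 1) ^+ 2 + 100%:R * (k + 10%:R)).
exists (maxn N1 N2) => V e esym eirr np r x Px; rewrite geq_max => /andP [n1 n2] Ext.
set n : R := #|V|%:R.
have hn : 64%:R * k ^+ 2 * B * 3%:R + 128%:R * (k + 1) ^+ 2 + 100%:R * (k + 10%:R) <= n.
  by apply: le_trans HN2 _; rewrite ler_nat.
have kB : 0 <= 64%:R * k ^+ 2 * B by rewrite mulr_ge0 // mulr_ge0 ?ler0n // sqr_ge0.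
have k20 : 0 <= (k + 1) ^+ 2 by rewrite sqr_ge0.
have kn : ((l * t.+1).-1 < #|V|)%N by rewrite -(ltr_nat R) kE -/n; clear -hn kB k20 k2; lra.
have [r0 lowr] := spectral_max_lower l1 (perron_r_ge0 Px) Ext kn.
rewrite -/k -/n in lowr.
have nr : n <= r ^+ 2.
  apply: le_trans lowr; have k2' : 0 <= k - 2%:R by clear -k2; lra.
  have nk : k <= n by clear -hn kB k20 k2; lra.
  have : 0 <= (k - 2%:R) * (n - k) by rewrite mulr_ge0 ?subr_ge0.
  by clear -nk k2 hn kB k20; lra.
have rk : 8%:R * (k + 1) <= r.
  rewrite -ler_sqr ?nnegrE ?(ltW r0) //; last by clear -k2; lra.
  apply: le_trans nr; apply: le_trans hn; rewrite exprMn; clear -kB k20 k2; lra.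
have [K cK hK] := HN1 V e esym eirr np r x Px n1 lowr.
rewrite subn1 in cK.
pose U := [set u | (u \notin K) && [forall a in K, e a u]].
have dKU : [disjoint K & U].
  by rewrite disjoint_sym disjoints_subset; apply/subsetP => u; rewrite !inE => /andP [].
have KU a u : a \in K -> u \in U -> e a u.
  by move=> aK; rewrite inE => /andP [_ /forall_inP]; apply.
pose E := ~: (K :|: U).
(* A vertex of [E] misses some vertex of [K], and each vertex of [K] has at most [eps n]
   non-neighbours. *)
have cE : #|E|%:R <= k * (eps * n).
  have sE : E \subset \bigcup_(a in K) ~: nbrs e a.
    apply/subsetP => w; rewrite !inE negb_or => /andP [wK]; rewrite wK /=.
    rewrite negb_forall => /existsP [a]; rewrite negb_imply => /andP [aK naw].
    by apply/bigcupP; exists a => //; rewrite !inE.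
  have card_le : (#|E| <= \sum_(a in K) #|~: nbrs e a|)%N.
    apply: leq_trans (subset_leq_card sE) _.
    elim/big_rec2: _ => [|a S c _ h]; first by rewrite cards0.
    by rewrite (leq_trans (leq_card_setU _ _)) // leq_add2l.
  apply: (@le_trans _ _ (\sum_(a in K) #|~: nbrs e a|)%:R); first by rewrite ler_nat.
  rewrite natr_sum -kE -cK -sum1_card natr_sum mulr_suml; apply: ler_sum => a aK.
  rewrite mul1r cardsCs setCK natrB ?max_card // -/n.
  by have [_] := hK a aK; rewrite -/n; clear; lra.
have cU : (l * t.+1 + 4 <= #|U|)%N.
  rewrite -(ler_nat R) natrD.
  have : #|V|%:R <= #|K|%:R + #|U|%:R + #|E|%:R :> R.
    rewrite -!natrD ler_nat -(cardsC (K :|: U)) leq_add2r.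
    exact: leq_card_setU.
  have : (l * t.+1)%:R = k + 1 by rewrite /k /tight subrK.
  rewrite cK kE -/n => -> h.
  have : eps * (k + 1) * n <= 100%:R^-1 * n by rewrite ler_wpM2r ?ler0n.
  have : 0 <= eps * n by rewrite mulr_ge0 ?ler0n // ltW.
  by clear -cE hn kB k20 k2 h; lra.
have F1 w u u' : w \notin K -> u \in U -> u' \in U -> e w u -> e w u' -> u = u'.
  exact: (outside_common_nbr esym eirr l1 KU cK cU np).
have F2 : (2 < l)%N -> forall u u' z z', uniq [:: u; u'; z; z'] ->
    [set u; u'; z; z'] \subset U -> e u u' -> e z z' -> False.
  move=> l3 u u' z z'; apply: (outside_disjoint_edges esym eirr l1 KU cK _ np l3).
  exact: cU.
have np1 := join_rel_free esym eirr l1 cK F1 F2.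
have Hy := Ext _ (join_rel_sym K U esym) (join_rel_irr e K U) np1.
have [rE [rE0 rE2 rEq]] := HB V e esym eirr np E.
have en0 : 0 <= eps * n by rewrite mulr_ge0 ?ler0n // ltW.
have hrE : rE <= r / (8%:R * k).
  have k80 : 0 < 8%:R * k by clear -k2; lra.
  have kp : 0 <= k by clear -k2; lra.
  rewrite ler_pdivlMr // -ler_sqr ?nnegrE ?mulr_ge0 ?(ltW k80) ?(ltW r0) //.
  apply: le_trans nr; rewrite exprMn -/k kabs in rE2 *.
  apply: (@le_trans _ _ (((k + 1) * (k * (eps * n)) + B) * (8%:R * k) ^+ 2)).
    rewrite ler_wpM2r ?sqr_ge0 //; apply: le_trans rE2 _; rewrite lerD2r ler_wpM2l //; clear -k2; lra.
  have : eps * ((k + 1) * k * k ^+ 2) * n <= 100%:R^-1 * n by rewrite ler_wpM2r ?ler0n.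
  by rewrite exprMn; move: hn kB k20 k2; clear; lra.
have hE16 : 16%:R * (k + 1) * #|E|%:R <= r ^+ 2.
  have h1 : 16%:R * (k + 1) * #|E|%:R <= 16%:R * (k + 1) * (k * (eps * n)).
    by rewrite ler_wpM2l //; clear -k2; lra.
  have : eps * ((k + 1) * k) * n <= 100%:R^-1 * n by rewrite ler_wpM2r ?ler0n.
  by move: h1 nr (ler0n R #|V|); rewrite -/n; clear; lra.
have xK a : a \in K -> 2%:R^-1 <= x a by move=> /hK [h _]; apply: le_trans h; clear -e1; lra.
have cKk : #|K|%:R = k by rewrite cK.
have hw w : w \in E -> exists2 a, a \in K & ~~ e w a.
  move=> wE; move: (wE); rewrite !inE negb_or => /andP [wK]; rewrite wK /= negb_forall => /existsP [a].
  by rewrite negb_imply => /andP [aK naw]; exists a => //; rewrite esym.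
have hrE' : 0 <= rE <= r / (8%:R * k) by rewrite rE0 hrE.
have E0 := no_leftover esym eirr Px cKk k2 dKU KU F1 Hy rk hE16 hrE' (rEq x) xK hw.
exists K => //; split; last first.
  have [a aK] : exists a, a \in K.
    by apply/card_gt0P; rewrite cK -(ltr_nat R) kE; clear -k2; lra.
  by exists a => //; apply: lt_le_trans (xK a aK); rewrite invr_gt0 ltr0n.
move=> a u aK uK; apply: KU => //; have : u \notin E by rewrite /E E0 inE.
by rewrite !inE negbK (negPf uK) /=.
Qed.


End Core.

Lemma packing_sub (V : finType) (e e' : rel V) m t : subrel e e' -> packing e m t -> packing e' m t.
Proof.
move=> se [cs [sc ac uc]]; exists cs; split=> //; apply/allP => c /(allP ac) /andP [-> cc] /=.
exact: sub_cycle se _ cc.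
Qed.

(** * Completing the structure by adding edges *)

Section Maximality.
Variable R : archiRealFieldType.
Variables (V : finType) (e : rel V).
Hypotheses (esym : symmetric e) (eirr : irreflexive e).
Variables (r : R) (x : V -> R).
Hypothesis Px : perron e r x.

Definition add_edge (a b : V) : rel V :=
  fun u w => [|| e u w, (u == a) && (w == b) | (u == b) && (w == a)].

Lemma add_edge_sym a b : symmetric (add_edge a b).
Proof.
move=> u w; rewrite /add_edge esym; congr (_ || _); rewrite orbC.
by rewrite [(u == b) && _]andbC [(u == a) && _]andbC.
Qed.

Lemma add_edge_irr a b : a != b -> irreflexive (add_edge a b).
Proof.
move=> ab u; rewrite /add_edge eirr /=; have [->|] := eqVneq u a; last by rewrite andbF.
by rewrite (negPf ab).
Qed.

Lemma add_edge_quad a b : ~~ e a b -> quad e x + x a * x b <= quad (add_edge a b) x.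
Proof.
move=> nab; rewrite -lerBrDl !quadE -sumrB.
have nn v u : (e v u)%:R * (x v * x u) <= (add_edge a b v u)%:R * (x v * x u).
  rewrite ler_wpM2r ?mulr_ge0 ?(perron_ge0 Px) // /add_edge.
  by case: (e v u); rewrite /= ?ler0n.
rewrite (bigD1 a) //= -[leLHS]addr0; apply: lerD; last first.
  by apply: sumr_ge0 => v _; rewrite subr_ge0 ler_sum.
rewrite -sumrB (bigD1 b) //= -[leLHS]addr0; apply: lerD; last first.
  by apply: sumr_ge0 => v _; rewrite subr_ge0.
by rewrite (negPf nab) /add_edge !eqxx orbT mul0r subr0 mul1r.
Qed.

(** An edge between positive entries lifts the quadratic form at [x] above [r |x|^2], against
    [spectral_max]. *)
Lemma add_edge_packing l t a b : spectral_max l t V r -> a != b -> ~~ e a b ->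
  0 < x a -> 0 < x b -> ~ packing (add_edge a b) (2 * l) t -> False.
Proof.
move=> Ext ab nab xa xb np.
have := Ext _ (add_edge_sym a b) (add_edge_irr ab) np x.
have := add_edge_quad nab; rewrite (perron_eig_quad Px).
have : 0 < x a * x b by rewrite mulr_gt0.
lra.
Qed.

Variables (l t : nat) (K : {set V}).
Hypotheses (l1 : (1 < l)%N) (Ext : spectral_max l t.+1 V r) (np : ~ packing e (2 * l) t.+1).
Hypotheses (cK : #|K| = (l * t.+1).-1) (KU : forall a u, a \in K -> u \notin K -> e a u).
Hypotheses (cU : (l * t.+1 + 4 <= #|~: K|)%N) (posK : exists2 a, a \in K & 0 < x a).

(** Positivity spreads along edges, and the complete pair formed by [K] and its complement connects
    the graph. *)
Lemma all_positive v : 0 < x v.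
Proof.
case: posK => a aK xa.
have step u w : e u w -> 0 < x w -> 0 < x u.
  move=> euw xw; have : 0 < r * x u.
    rewrite -(perron_eig Px) (bigD1 w) ?in_nbrs //= ltr_pwDl //.
    by apply: sumr_ge0 => z _; exact: perron_ge0 Px z.
  move=> h; rewrite lt0r (perron_ge0 Px) andbT.
  by apply: contraTneq h => ->; rewrite mulr0 ltxx.
have [u uK] : exists u, u \in ~: K by apply/card_gt0P; rewrite (leq_trans _ cU) // addn4.
rewrite inE in uK.
have xu : 0 < x u by apply: (step u a) => //; rewrite esym KU.
have [vK|vK] := boolP (v \in K); first by apply: (step v u) => //; exact: KU.
by apply: (step v a) => //; rewrite esym KU.
Qed.

Lemma KU_setC a u : a \in K -> u \in ~: K -> e a u.
Proof. by move=> aK; rewrite inE; exact: KU. Qed.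

Lemma outside_degree_le1 w u u' : w \notin K -> u \in ~: K -> u' \in ~: K ->
  e w u -> e w u' -> u = u'.
Proof. exact: (outside_common_nbr esym eirr l1 KU_setC cK cU np). Qed.

Lemma outside_no_disjoint : (2 < l)%N -> forall u u' z z', uniq [:: u; u'; z; z'] ->
  [set u; u'; z; z'] \subset ~: K -> e u u' -> e z z' -> False.
Proof. by move=> l3 u u' z z'; exact: (outside_disjoint_edges esym eirr l1 KU_setC cK cU np l3). Qed.

(** With a missing edge at [K] added, the graph is still contained in [join_rel e K (~: K)], which
    is free. *)
Lemma clique_K a b : a \in K -> b != a -> e a b.
Proof.
move=> aK ba; have [bK|] := boolP (b \in K); last exact: KU.
apply/idPn => nab; apply: (add_edge_packing (a := a) (b := b) Ext); rewrite ?all_positive //.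
  by rewrite eq_sym.
move=> pk; apply: (join_rel_free esym eirr l1 cK outside_degree_le1 outside_no_disjoint).
apply: packing_sub pk => u w; rewrite /add_edge /join_rel !inE.
case/or3P=> [euw|/andP [/eqP -> /eqP ->]|/andP [/eqP -> /eqP ->]].
- have -> : u != w by apply: contraTneq euw => ->; rewrite eirr.
  by rewrite euw andbT; case: (u \in K); case: (w \in K).
- by rewrite aK andbT eq_sym.
- by rewrite aK orbT andbT.
Qed.

(** Joining two vertices that are isolated outside [K] keeps the outside a matching; for [l >= 3] it
    becomes a single edge. *)
Lemma add_outside_free u u' : u \notin K -> u' \notin K -> u != u' ->
  (forall v, v \notin K -> ~~ e u v) -> (forall v, v \notin K -> ~~ e u' v) ->
  ((2 < l)%N -> forall v w, v \notin K -> w \notin K -> ~~ e v w) ->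
  ~ packing (add_edge u u') (2 * l) t.+1.
Proof.
move=> uK uK' uu' iu iu' l3n pk.
have sy := add_edge_sym u u'; have ir := add_edge_irr uu'.
have ne u1 u2 : e u1 u2 -> u1 != u2 by move=> E; apply: contraTneq E => ->; rewrite eirr.
apply: (@join_rel_free V (add_edge u u') K (~: K) sy ir l t l1 cK).
- move=> w u1 u2 wK; rewrite !inE => u1K u2K; rewrite /add_edge.
  case/or3P=> [e1|/andP [/eqP E1 /eqP E2]|/andP [/eqP E1 /eqP E2]];
    case/or3P=> [e2|/andP [/eqP E3 /eqP E4]|/andP [/eqP E3 /eqP E4]]; subst=> //.
  + by apply: (outside_degree_le1 wK); rewrite ?inE.
  + by have := iu u1 u1K; rewrite e1.
  + by have := iu' u1 u1K; rewrite e1.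
  + by have := iu u2 u2K; rewrite e2.
  + by have := iu' u2 u2K; rewrite e2.
- move=> l3 a b c d un /subsetP sK.
  have [aK bK cK' dK] : [/\ a \notin K, b \notin K, c \notin K & d \notin K].
    have h z : z \in [set a; b; c; d] -> z \notin K by move=> /sK; rewrite inE.
    by split; apply: h; rewrite !inE eqxx ?orbT.
  move: un; rewrite /= !inE !negb_or !andbT => /and3P [/and3P [h1 h2 h3] /andP [h4 h5] h6].
  rewrite /add_edge (negPf (l3n l3 a b aK bK)) (negPf (l3n l3 c d cK' dK)) /=.
  case/orP=> /andP [/eqP E1 /eqP E2]; case/orP=> /andP [/eqP E3 /eqP E4]; subst.
  + by rewrite eqxx in h2.
  + by rewrite eqxx in h3.
  + by rewrite eqxx in h3.
  + by rewrite eqxx in h2.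
- apply: packing_sub pk => a b; rewrite /join_rel !inE => eab.
  have -> : a != b by apply: contraTneq eab => ->; rewrite ir.
  by rewrite eab andbT; case: (a \in K); case: (b \in K).
Qed.

Lemma outside_maximal u u' : u \notin K -> u' \notin K -> u != u' ->
  (forall v, v \notin K -> ~~ e u v) -> (forall v, v \notin K -> ~~ e u' v) ->
  ((2 < l)%N -> forall v w, v \notin K -> w \notin K -> ~~ e v w) -> False.
Proof.
move=> uK uK' uu' iu iu' l3n.
apply: (add_edge_packing (a := u) (b := u') Ext uu'); rewrite ?all_positive ?iu //.
exact: add_outside_free.
Qed.

Lemma outside_single_edge : (2 < l)%N -> exists u0 v0, [/\ u0 \notin K, v0 \notin K, u0 != v0 &
  forall u v, u \notin K -> v \notin K -> e u v = (u == u0) && (v == v0) || (u == v0) && (v == u0)].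
Proof.
move=> l3; have [/existsP [u0 /existsP [v0 /and3P [u0K v0K e0]]]|none] :=
   boolP [exists u0, exists v0, [&& u0 \notin K, v0 \notin K & e u0 v0]].
  exists u0, v0; split=> //; first by apply: contraTneq e0 => ->; rewrite eirr.
  move=> u v uK vK; apply/idP/idP.
    by apply: (outside_edge_unique esym eirr outside_degree_le1 (outside_no_disjoint l3)); rewrite ?inE.
  by case/orP=> /andP [/eqP -> /eqP ->] //; rewrite esym.
exfalso; have nn u v : u \notin K -> v \notin K -> ~~ e u v.
  move=> uK vK; apply: contraNN none => euv.
  by apply/existsP; exists u; apply/existsP; exists v; rewrite uK vK.
have /card_gt1P [u [v [uK vK uv]]] : (1 < #|~: K|)%N by rewrite (leq_trans _ cU) // addn4.
rewrite !inE in uK vK.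
by apply: (outside_maximal uK vK uv) => // w wK; exact: nn.
Qed.

End Maximality.

(** * A regular friendship graph does not exist *)

Section Friendship.
Variables (V : finType) (e : rel V) (q : nat).
Hypotheses (esym : symmetric e) (eirr : irreflexive e).
Hypotheses (dq : forall v, #|nbrs e v| = q) (fr : forall v w, v != w -> #|nbrs e v :&: nbrs e w| = 1%N).
Hypothesis q2 : (2 < q)%N.

Let G := SGraph esym eirr.
Local Notation A := (adjmx G).
Local Notation n := #|V|.

(** Count the walks of length two from [v] by their midpoints and by their ends. *)
Lemma friendship_card (v : V) : n = (q * (q - 1) + 1)%N.
Proof.
have E : (\sum_(u in nbrs e v) #|nbrs e u| = \sum_(w : V) #|nbrs e v :&: nbrs e w|)%N.
  under eq_bigr => u _ do rewrite -sum1_card.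
  rewrite (exchange_big_dep predT) //=; apply: eq_bigr => w _.
  by rewrite -sum1_card; apply: eq_bigl => u; rewrite !inE (esym w).
move: E; rewrite (eq_bigr (fun=> q)) // sum_nat_const dq (bigD1 v) //= setIid dq.
rewrite (eq_bigr (fun=> 1%N)); last by move=> w wv; rewrite fr // eq_sym.
rewrite sum1_card (cardC1 v) => E.
have n0 : (0 < n)%N by apply/card_gt0P; exists v.
move: E n0 q2; move: #|V| => m; move: (q); clear => p E m0 p2.
rewrite mulnBr muln1 E; move: m0; clear; case: m => // m _; lia.
Qed.

Lemma adjmx_sq i j : (A *m A) i j = (#|nbrs e (enum_val i) :&: nbrs e (enum_val j)|)%:R.
Proof.
rewrite mxE -sum1_card natr_sum (reindex (@enum_rank V)) /=; last exact/onW_bij/enum_rank_bij.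
rewrite [RHS]big_mkcond /=; apply: eq_bigr => u _; rewrite !mxE enum_rankK !inE.
by rewrite /= [e u _]esym; case: (e _ u); case: (e _ u); rewrite ?mulr1 ?mulr0.
Qed.

(** From [A^2 = J + (q - 1) I] and [A J = q J] the eigenvalues are [q], which is simple, and plus or
    minus [sqrt (q - 1)]. Trace zero makes [q] an integer multiple of that root, so [q - 1] divides
    [q^2], impossible for [q > 2]. *)
Lemma friendship_false (v : V) : False.
Proof.
have nE := friendship_card v.
have qn : (q <= n)%N by rewrite nE; move: q2; clear; nia.
set s := sqrtC (q - 1)%:R : algC.
have s2 : s ^+ 2 = (q - 1)%:R by rewrite sqrtCK.
have Atr : A^T = A by exact: adjmx_tr.
have Ah : A \is hermsymmx.
  by apply/is_hermitianmxP; rewrite expr0 scale1r adjmx_tr adjmx_conj.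
have /orthomx_spectralP EA := hermitian_normalmx Ah.
set P := spectralmx A in EA; set d := spectral_diag A in EA.
have Pu : P \in unitmx := spectral_unit A.
have AJ : A *m const_mx 1 = q%:R *: const_mx 1 :> 'M_n.
  apply/matrixP => i j; rewrite !mxE mulr1 -(dq (enum_val i)) -sum1_card natr_sum.
  rewrite (reindex (@enum_rank V)) /=; last exact/onW_bij/enum_rank_bij.
  rewrite [RHS]big_mkcond /=; apply: eq_bigr => u _; rewrite !mxE enum_rankK inE /= mulr1.
  by case: (e _ u).
have A2 : A *m A = const_mx 1 + (q - 1)%:R%:M.
  apply/matrixP => i j; rewrite adjmx_sq !mxE.
  have [->|ij] := eqVneq i j.
    by rewrite setIid dq mulr1n natrB ?(leq_trans _ q2) // addrC subrK.
  by rewrite fr ?mulr0n ?addr0 // (inj_eq enum_val_inj).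
set c : algC := (q - 1)%:R in s2 A2.
have DE : diag_mx d = P *m A *m invmx P by rewrite EA -!mulmxA mulmxV // mulmx1 mulKVmx.
have DD : diag_mx d *m diag_mx d = P *m (A *m A) *m invmx P.
  by rewrite DE !mulmxA mulmxKV.
(* The matrix [A^2 - c] is the all-ones matrix, so [(A - q) (A^2 - c) = 0]. *)
have cD i : d 0 i * (d 0 i ^+ 2 - c) = q%:R * (d 0 i ^+ 2 - c).
  have AA : A *m (A *m A - c%:M) = q%:R *: (A *m A - c%:M) by rewrite A2 addrK.
  have Dc : diag_mx d *m diag_mx d - c%:M = P *m (A *m A - c%:M) *m invmx P.
    rewrite DD mulmxBr mulmxBl; congr (_ - _).
    by rewrite mul_mx_scalar -scalemxAl mulmxV // scalemx1.
  have : diag_mx d *m (diag_mx d *m diag_mx d - c%:M) = q%:R *: (diag_mx d *m diag_mx d - c%:M).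
    by rewrite Dc {1}DE !mulmxA mulmxKV // -[_ *m A *m _]mulmxA AA -scalemxAr -scalemxAl.
  move/matrixP => /(_ i i); rewrite mul_diag_mx mulmx_diag !mxE eqxx !mulr1n expr2.
  by [].
have trA : \sum_i d 0 i = 0.
  rewrite -mxtrace_diag DE mxtrace_mulC mulmxA mulVmx // mul1mx.
  by rewrite /mxtrace big1 // => i _; rewrite mxE adj_irrefl.
have trA2 : \sum_i d 0 i ^+ 2 = n%:R * q%:R.
  have -> : \sum_i d 0 i ^+ 2 = \tr (diag_mx d *m diag_mx d).
    by rewrite mulmx_diag mxtrace_diag; apply: eq_bigr => i _; rewrite mxE expr2.
  rewrite DD mxtrace_mulC mulmxA mulVmx // mul1mx /mxtrace.
  rewrite (eq_bigr (fun=> q%:R)); first by rewrite sumr_const card_ord mulr_natl.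
  by move=> i _; rewrite adjmx_sq setIid dq.
have dcase i : [\/ d 0 i = q%:R, d 0 i = s | d 0 i = - s].
  have [->|nq] := eqVneq (d 0 i) q%:R; first by constructor 1.
  have /eqP : (d 0 i - q%:R) * (d 0 i ^+ 2 - c) = 0 by rewrite mulrBl cD subrr.
  rewrite mulf_eq0 subr_eq0 (negPf nq) /= -s2 subr_sqr mulf_eq0 subr_eq0 addr_eq0.
  by case/orP=> /eqP ->; [constructor 2|constructor 3].
pose a := #|[set i | d 0 i == q%:R]|.
have nR : n%:R = q%:R ^+ 2 - c :> algC.
  by rewrite nE /c natrD natrM !natrB ?(leq_trans _ q2) //; ring.
(* Multiplicity of [q]: [q^2 = c + n], so the trace of [A^2] reads [n q = n c + a n]. *)
have a1 : a = 1%N.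
  have E : \sum_i d 0 i ^+ 2 = \sum_(i < n) (c + (d 0 i == q%:R)%:R * n%:R).
    apply: eq_bigr => i _; case: eqP => [->|nq]; first by rewrite mul1r nR addrC subrK.
    by rewrite mul0r addr0; case: (dcase i) => // ->; rewrite ?sqrrN s2.
  move: E; rewrite trA2 big_split /= sumr_const card_ord -mulr_suml -[c *+ _]mulr_natl.
  have -> : \sum_(i < n) (d 0 i == q%:R)%:R = a%:R :> algC.
    rewrite /a -sum1_card natr_sum [RHS]big_mkcond /=; apply: eq_bigr => i _.
    by rewrite inE; case: eqP.
  have n0 : n%:R != 0 :> algC by rewrite pnatr_eq0 nE addn1.
  move=> E; have : n%:R * (q%:R - c) = n%:R * a%:R by rewrite mulrBr E; ring.
  move/(mulfI n0) => E2; apply/eqP; rewrite -(eqr_nat algC) -E2 /c natrB ?(leq_trans _ q2) //.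
  by rewrite opprB addrC subrK.
have c0 : c != 0 by rewrite /c pnatr_eq0; move: q2; clear; lia.
pose sg i : int := if d 0 i == q%:R then 0 else if d 0 i == s then 1 else -1.
pose m := \sum_i sg i.
have E : q%:R + m%:~R * s = 0.
  rewrite -trA /m rmorph_sum /= mulr_suml.
  have -> : q%:R = \sum_(i < n) (d 0 i == q%:R)%:R * q%:R :> algC.
    rewrite -mulr_suml -[LHS]mul1r; congr (_ * _).
    transitivity (a%:R : algC); first by rewrite a1.
    rewrite /a -sum1_card natr_sum big_mkcond /=; apply: eq_bigr => i _.
    by rewrite inE; case: eqP.
  rewrite -big_split /=; apply: eq_bigr => i _; rewrite /sg.
  case: eqP => [->|nq]; first by rewrite mul1r mul0r addr0.
  case: eqP => [->|ns]; first by rewrite mul0r add0r mul1r.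
  by case: (dcase i) => // ->; rewrite mul0r add0r mulN1r.
have E2 : (m ^+ 2 * (q - 1)%:Z)%:~R = (q ^ 2)%:Z%:~R :> algC.
  have qE : q%:R = - (m%:~R * s) by apply/eqP; rewrite -addr_eq0 E.
  rewrite intrM rmorphXn /= -!pmulrn natrX qE.
  by rewrite sqrrN exprMn s2.
move/intr_inj: E2 => /(congr1 absz); rewrite abszM abszX /=.
move: q2; move: (`|m|%N ^ 2)%N (q) => M p; clear => p2 E.
case: p p2 E => // p p2; rewrite subn1 expnS expn1 /= => E.
(* With [q = p + 1], the square [(p + 1)^2] lies strictly between [(p + 2) p] and [(p + 3) p]. *)
have [h|h] := leqP M (p + 2).
  have : (M * p <= (p + 2) * p)%N by rewrite leq_mul2r h orbT.
  by rewrite E; nia.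
have : ((p + 3) * p <= M * p)%N by rewrite leq_mul2r addn3 -addn2 h orbT.
by rewrite E; nia.
Qed.
End Friendship.

(** * A single 4-cycle *)

Section Wheel.
Variable R : archiRealFieldType.
Variables (V : finType) (r : R).
Hypotheses (Ext : spectral_max 2 1 V r) (r1 : 1 < r) (n3 : (3 <= #|V|)%N).
Local Notation n := #|V|.

Let rk (u : V) : nat := enum_rank u.
Let rkn u : (rk u < n)%N. Proof. exact: ltn_ord. Qed.
Let rk_inj u w : rk u = rk w -> u = w.
Proof. by move=> /val_inj /enum_rank_inj. Qed.
Let rk_surj i : (i < n)%N -> exists u, rk u = i.
Proof. by move=> lt; exists (enum_val (Ordinal lt)); rewrite /rk enum_valK. Qed.

(** A windmill whose centre has the last rank; the ranks [2 j] and [2 j + 1] form its triangles. For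
    even order the vertex of rank [n - 2] is pendant, since its partner would be the centre. *)
Definition wheel : rel V := fun u w =>
  (u != w) && [|| rk u == n.-1, rk w == n.-1 | (rk u)./2 == (rk w)./2].

Lemma wheel_sym : symmetric wheel.
Proof.
move=> u w; rewrite /wheel eq_sym; congr (_ && _); rewrite orbCA; congr [|| _, _ | _].
by rewrite eq_sym.
Qed.

Lemma wheel_irr : irreflexive wheel.
Proof. by move=> u; rewrite /wheel eqxx. Qed.

Lemma half_eq_neq i j k : i./2 = j./2 -> i./2 = k./2 -> i <> j -> i <> k -> j = k.
Proof.
by lia.
Qed.

Lemma wheel_free : ~ packing wheel (2 * 2) 1.
Proof.
have [c rc] : exists u, rk u = n.-1 by apply: rk_surj; rewrite prednK // (leq_trans _ n3).
apply: (@matching_free _ _ wheel_sym 1 [set c]); first by rewrite cards1.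
move=> u v w; rewrite !in_set1 /wheel => uc vc wc /andP [uv] + /andP [uw].
have nc z : z != c -> (rk z == n.-1) = false.
  by move=> zc; apply: contraNF zc => /eqP; rewrite -rc => /rk_inj ->.
rewrite !nc //= => /eqP h1 /eqP h2; apply: rk_inj.
by apply: (half_eq_neq h1 h2) => /rk_inj; apply/eqP.
Qed.

Definition wheel_partner (u : V) : pred V :=
  fun w => [&& w != u, rk w != n.-1 & (rk u)./2 == (rk w)./2].

(** The trial vector solves the eigenvalue equation off the centre: [1 / (r - 1)] on triangles,
    [1 / r] at a pendant vertex, [1] at the centre. The Rayleigh inequality then says that the sum
    [Y] over the neighbours of the centre is at most [r]. *)
Lemma wheel_lower : (n%:R - 1) * r - 1 <= r ^+ 2 * (r - 1) /\
  (odd n -> n%:R - 1 <= r * (r - 1)).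
Proof.
have [c rc] : exists u, rk u = n.-1 by apply: rk_surj; rewrite prednK // (leq_trans _ n3).
have nc z : (rk z == n.-1) = (z == c).
  by apply/eqP/eqP => [|-> //]; rewrite -rc => /rk_inj.
have r0 : 0 < r := lt_trans ltr01 r1.
have rm0 : 0 < r - 1 by rewrite subr_gt0.
pose p u := [exists w, wheel_partner u w].
pose g u := if p u then (r - 1)^-1 else r^-1.
have g0 u : 0 <= g u by rewrite /g; case: ifP => _; rewrite invr_ge0 ltW.
pose y u := if u == c then 1 else g u.
have yc : y c = 1 by rewrite /y eqxx.
have yn u : u != c -> y u = g u by rewrite /y => /negPf ->.
have y0 u : 0 <= y u by rewrite /y; case: ifP.
pose Y := \sum_(u | u != c) g u.
have nbc : Y <= nbsum wheel y c.
  rewrite le_eqVlt; apply/orP; left; apply/eqP; apply: eq_big => [u|u uc].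
    by rewrite /wheel rc eqxx /= andbT eq_sym.
  by rewrite yn.
have nbu u : u != c -> 1 + (p u)%:R * g u <= nbsum wheel y u.
  move=> uc; rewrite /nbsum (bigD1 c) /=; last by rewrite /wheel uc rc eqxx orbT.
  rewrite yc lerD2l; case pu : (p u); last by rewrite mul0r sumr_ge0.
  have /existsP [w /and3P [wu wn hw]] := pu.
  rewrite (bigD1 w) /=; last by rewrite /wheel eq_sym wu hw !orbT /= -nc wn.
  rewrite mul1r yn; last by rewrite -nc.
  have pw : p w.
    by apply/existsP; exists u; rewrite /wheel_partner eq_sym wu nc uc eq_sym.
  by rewrite /g pu pw lerDl sumr_ge0.
have H := Ext wheel_sym wheel_irr wheel_free y.
have Yr : Y <= r.
  move: H; rewrite /quad /sqnorm (bigD1 c) //= [X in _ <= _ * X](bigD1 c) //= yc expr1n mul1r.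
  have : \sum_(u | u != c) (g u * (1 + (p u)%:R * g u)) <= \sum_(u | u != c) y u * nbsum wheel y u.
    by apply: ler_sum => u uc; rewrite yn // ler_wpM2l ?nbu.
  have -> : \sum_(u | u != c) y u ^+ 2 = \sum_(u | u != c) g u ^+ 2.
    by apply: eq_bigr => u uc; rewrite yn.
  have : r * (\sum_(u | u != c) g u ^+ 2) = \sum_(u | u != c) (g u * (1 + (p u)%:R * g u)).
    rewrite mulr_sumr; apply: eq_bigr => u _; rewrite /g; case: (p u).
      by rewrite mul1r; field; rewrite lt0r_neq0.
    by rewrite mul0r addr0 mulr1; field; rewrite lt0r_neq0.
  by rewrite mulrDr mulr1; lra.
have part u : u != c -> ~~ p u -> (rk u).+2 = n /\ ~~ odd n.
  move=> uc; rewrite -nc in uc => npu; have := rkn u.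
  pose i := rk u; have : ((if odd i then i.-1 else i.+1) < n.-1)%N -> False.
    move=> lt; have lt' : ((if odd i then i.-1 else i.+1) < n)%N by lia.
    have [w rw] := rk_surj lt'; case/negP: npu; apply/existsP; exists w.
    rewrite /wheel_partner rw; apply/and3P; split.
    - by apply/eqP => wu; move: rw; rewrite wu -/i; case: (odd i) (odd_gt0 (n := i)); lia.
    - by lia.
    - by rewrite -/i; case oi : (odd i); apply/eqP; lia.
  by move: uc n3; rewrite -/i; clear; case oi : (odd i); lia.
have cn (A : {pred V}) : (#|A|%:R : R) * (r - 1)^-1 = \sum_(u in A) (r - 1)^-1.
  by rewrite sumr_const mulr_natl.
have n1R : #|predC1 c|%:R = n%:R - 1 :> R.
  by rewrite cardC1 -subn1 natrB // (leq_trans _ n3).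
have [allp|] := boolP [forall u, (u != c) ==> p u].
  have YE : Y = (n%:R - 1) * (r - 1)^-1.
    rewrite -n1R cn; apply: eq_bigr => u uc; rewrite /g.
    by move: allp => /forallP /(_ u); rewrite uc /= => ->.
  have h : n%:R - 1 <= r * (r - 1) by rewrite -ler_pdivrMr // -YE.
  split=> //; have : (n%:R - 1) * r <= r * (r - 1) * r by rewrite ler_wpM2r // ltW.
  by rewrite expr2; lra.
rewrite negb_forall => /existsP [z]; rewrite negb_imply => /andP [zc npz].
have [rz no] := part z zc npz.
have other u : u != c -> u != z -> p u.
  move=> uc uz; apply: contraNT uz => npu; have [ru _] := part u uc npu.
  by apply/eqP/rk_inj; apply/eqP; rewrite -(eqn_add2r 2) !addn2 ru rz.
split; last by move=> on; rewrite on in no.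
have YE : Y = r^-1 + (n%:R - 1 - 1) * (r - 1)^-1.
  rewrite /Y (bigD1 z) //= {1}/g (negPf npz); congr (_ + _).
  rewrite (eq_bigr (fun=> (r - 1)^-1)); last first.
    by move=> u /andP [uc uz]; rewrite /g other.
  have := cn (predC1 c); rewrite n1R (bigD1 z) //= => E.
  by rewrite mulrBl mul1r E addrAC subrr add0r.
have : Y * (r * (r - 1)) <= r * (r * (r - 1)) by rewrite ler_wpM2r // mulr_ge0 // ltW.
have -> : Y * (r * (r - 1)) = (r - 1) + (n%:R - 1 - 1) * r.
  by rewrite YE; field; rewrite !lt0r_neq0.
by rewrite expr2; lra.
Qed.

End Wheel.

Section FourCycleFree.
Variable R : archiRealFieldType.
Variables (V : finType) (e : rel V).
Hypotheses (esym : symmetric e) (eirr : irreflexive e).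
Hypothesis np : ~ packing e (2 * 2) 1.
Variables (r : R) (x : V -> R).
Hypothesis Px : perron e r x.
Local Notation n := (#|V|%:R : R).

Definition defect (A : {set V}) : R := \sum_(z in A) (1 - x z).
Definition nonnbrs (w : V) : {set V} := ~: (w |: nbrs e w).
Definition far (w : V) : {set V} := [set z | (z != w) && (nbrs e w :&: nbrs e z == set0)].
(** It vanishes for the windmill of odd order, where [r^2 - r = n - 1]. *)
Definition excess : R := n - 1 - (r ^+ 2 - r).

Lemma defect1_ge0 z : 0 <= 1 - x z. Proof. by rewrite subr_ge0 (perron_le1 Px). Qed.

Lemma defect_ge0 A : 0 <= defect A.
Proof. by apply: sumr_ge0 => z _; exact: defect1_ge0. Qed.

Lemma defect_sub (A B : {set V}) : A \subset B -> defect A <= defect B.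
Proof.
move=> sAB; rewrite /defect [leRHS](big_setID A) /= (setIidPr sAB) lerDl.
exact: defect_ge0.
Qed.

Lemma defectU (A B : {set V}) : defect (A :|: B) <= defect A + defect B.
Proof.
rewrite /defect (big_setID A) /= setUK setDUl setDv set0U lerD2l.
exact: defect_sub (subsetDl _ _).
Qed.

Lemma defect_mem z (A : {set V}) : z \in A -> 1 - x z <= defect A.
Proof.
move=> zA; rewrite /defect (bigD1 z) //= lerDl.
by apply: sumr_ge0 => u _; exact: defect1_ge0.
Qed.

Lemma sum_defect (A : {set V}) : \sum_(z in A) x z = #|A|%:R - defect A.
Proof. by rewrite /defect sumrB sumr_const opprB addrC subrK. Qed.

Lemma deg_defect w : #|nbrs e w|%:R = r * x w + defect (nbrs e w).
Proof. by rewrite -(perron_eig Px) sum_defect subrK. Qed.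

Lemma codegree1 w z : w != z -> (#|nbrs e w :&: nbrs e z| <= 1)%N.
Proof.
move=> wz; have H : cycle_hits e (2 * 2) set0.
  move=> c s1 s2 s3; have := @packing_hits _ e (2 * 2) 0 [::] np erefl isT isT c s1 s2 s3.
  by case/hasP=> u _; rewrite /= inE.
have w0 : w \notin (set0 : {set V}) by rewrite inE.
have zw : z \notin w |: set0 by rewrite in_setU1 in_set0 orbF eq_sym.
apply: leq_trans (codegree_le1 esym eirr H w0 zw).
by apply/subset_leq_card/subsetP => u; rewrite !inE (esym z).
Qed.

Lemma two_walk_codegree w : r ^+ 2 * x w = \sum_z #|nbrs e w :&: nbrs e z|%:R * x z.
Proof.
rewrite (two_walks Px) /wsum (exchange_big_dep predT) //=; apply: eq_bigr => z _.
rewrite sumr_const mulr_natl; congr (_ *+ _); apply: eq_card => u.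
by rewrite unfold_in !inE andbT (esym z).
Qed.

Lemma card_nonnbrs w : #|nonnbrs w|%:R = n - 1 - #|nbrs e w|%:R.
Proof.
have -> : #|nonnbrs w| = (#|V| - #|nbrs e w|.+1)%N.
  by rewrite /nonnbrs cardsCs setCK cardsU1 in_nbrs eirr add1n.
have h : (#|nbrs e w|.+1 <= #|V|)%N.
  by have := max_card [in w |: nbrs e w]; rewrite cardsU1 in_nbrs eirr add1n.
by rewrite natrB // -natr1; ring.
Qed.

(** Codegrees are [0] or [1], so [r^2 x_w] is [deg w x_w] plus the sum of all other entries, minus
    those of [far w]; the entries on the neighbourhood of [w] add up to [r x_w]. *)
Lemma defect_identity w : \sum_(z in far w) x z + defect (nonnbrs w) =
  excess + (n - 1 - excess - #|nbrs e w|%:R) * (1 - x w).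
Proof.
have E1 : r ^+ 2 * x w + \sum_(z in far w) x z = #|nbrs e w|%:R * x w + \sum_(z | z != w) x z.
  rewrite two_walk_codegree (bigD1 w) //= setIid -addrA; congr (_ + _).
  have -> : \sum_(z in far w) x z = \sum_(z | z != w) (z \in far w)%:R * x z.
    rewrite big_mkcond [RHS]big_mkcond /=; apply: eq_bigr => z _; rewrite inE.
    by case: (z != w) => //=; case: (_ == set0); rewrite ?mul1r ?mul0r.
  rewrite -big_split /=; apply: eq_bigr => z zw; rewrite inE zw /= -mulrDl.
  have := codegree1 (w := w) (z := z); rewrite eq_sym zw => /(_ isT).
  rewrite -cards_eq0; case: #|_| => [|[|//]] _ /=; first by rewrite add0r mul1r.
  by rewrite addr0 mul1r.
have E2 : \sum_(z | z != w) x z = r * x w + \sum_(z in nonnbrs w) x z.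
  rewrite -(perron_eig Px) (bigID [in nbrs e w]) /=; congr (_ + _); apply: eq_bigl => z.
    rewrite in_nbrs; case: (boolP (e w z)) => [ewz|]; rewrite ?andbF // andbT.
    by apply: contraTneq ewz => ->; rewrite eirr.
  by rewrite !inE negb_or.
by rewrite E2 (sum_defect (nonnbrs w)) card_nonnbrs in E1; rewrite /excess; lra.
Qed.

Lemma small_defect (A : {set V}) (m s : R) : 0 < m -> m <= #|A|%:R -> defect A <= s ->
  exists2 z, z \in A & m * (1 - x z) <= s.
Proof.
move=> m0 mA hs.
have [/existsP [z /andP [zA hz]]|] := boolP [exists z, (z \in A) && (m * (1 - x z) <= s)].
  by exists z.
rewrite negb_exists => /forallP H; exfalso.
have s0 : 0 <= s := le_trans (defect_ge0 A) hs.
have A0 : (0 < #|A|)%N by rewrite -(ltr0n R); exact: lt_le_trans mA.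
have [z0 zA0] := card_gt0P A0.
have : \sum_(z in A) s < \sum_(z in A) m * (1 - x z).
  apply: ltr_sum => [|z zA]; first by apply/hasP; exists z0; rewrite ?mem_index_enum.
  by have := H z; rewrite zA /= -ltNge.
rewrite -mulr_sumr -/(defect A) sumr_const -mulr_natl => h.
have : m * s <= #|A|%:R * s by rewrite ler_wpM2r.
have : m * defect A <= m * s by rewrite ler_wpM2l // ltW.
lra.
Qed.

Lemma defect_le_card (A : {set V}) : defect A <= #|A|%:R.
Proof.
rewrite -sum1_card natr_sum; apply: ler_sum => z _.
by rewrite lerBlDr lerDl (perron_ge0 Px).
Qed.

Hypothesis hr : 100%:R <= r.
Hypothesis hlow : (n - 1) * r - 1 <= r ^+ 2 * (r - 1).
Hypothesis hodd : odd #|V| -> n - 1 <= r * (r - 1).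
Variables (v w0 : V).
Hypotheses (xv : x v = 1) (w0v : w0 \in nonnbrs v).

Lemma excess_le : r * excess <= 1.
Proof. by move: hlow; rewrite /excess !expr2; lra. Qed.

Lemma excess_identity : \sum_(z in far v) x z + defect (nonnbrs v) = excess.
Proof. by rewrite defect_identity xv subrr mulr0 addr0. Qed.

Lemma far_ge0 w : 0 <= \sum_(z in far w) x z.
Proof. by apply: sumr_ge0 => z _; exact: perron_ge0 Px z. Qed.

Lemma excess_ge0 : 0 <= excess.
Proof. by rewrite -excess_identity addr_ge0 ?far_ge0 ?defect_ge0. Qed.

Lemma excess_small : 100%:R * excess <= 1.
Proof.
by apply: le_trans excess_le; rewrite ler_wpM2r ?excess_ge0.
Qed.

Lemma n_bounds : r ^+ 2 - r + 1 <= n <= r ^+ 2.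
Proof.
have := excess_ge0; have := excess_small; move: hr; rewrite /excess => h1 h2 h3.
by apply/andP; split; lra.
Qed.

Lemma identity_le w : \sum_(z in far w) x z + defect (nonnbrs w) <= excess + r ^+ 2 * (1 - x w).
Proof.
rewrite defect_identity lerD2l ler_wpM2r ?defect1_ge0 //.
have /andP [_ h] := n_bounds; have := excess_ge0; have : 0 <= #|nbrs e w|%:R :> R by rewrite ler0n.
lra.
Qed.

Lemma nonnbrs_sym u w : (u \in nonnbrs w) = (w \in nonnbrs u).
Proof. by rewrite !inE esym eq_sym. Qed.

(** At [v] the identity bounds the defect of the non-neighbours by the excess. The non-neighbour
    [w0] keeps [deg v] near [2 r], so averaging finds a non-neighbour [w1] with nearly maximal
    entry. The non-neighbours of [v] and [w1] miss only [v] and at most one common neighbour, which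
    is treated in the same way. *)
Lemma total_defect : defect setT <= 13%:R * excess.
Proof.
have th0 := excess_ge0; have th1 := excess_small; have rth := excess_le.
have /andP [nl nu] := n_bounds.
have J := excess_identity; have fv := far_ge0 v.
have r2 : 100%:R * r <= r ^+ 2 by rewrite expr2 ler_wpM2r //; move: hr; lra.
have r0 : 0 <= r by move: hr; lra.
have degv : #|nbrs e v|%:R <= 2%:R * r + 3%:R.
  have h0 := defect_mem w0v.
  have h1 := identity_le w0; have f0 := far_ge0 w0.
  have h2 : defect (nbrs e v) <= defect (nonnbrs w0) + 1.
    have s : nbrs e v \subset nonnbrs w0 :|: (nbrs e v :&: nbrs e w0).
      apply/subsetP => z; rewrite !inE => evz; rewrite evz /= negb_or.
      have -> : z != w0 by apply: contraTneq w0v => <-; rewrite !inE evz orbT.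
      by rewrite orNb.
    apply: le_trans (defect_sub s) _; apply: le_trans (defectU _ _) _; rewrite lerD2l.
    apply: le_trans (defect_le_card _) _; rewrite lern1 codegree1 //.
    by apply: contraTneq w0v => <-; rewrite !inE eqxx.
  have h3 : r ^+ 2 * (1 - x w0) <= r ^+ 2 * excess by rewrite ler_wpM2l ?sqr_ge0 //; lra.
  have h4 : r * (r * excess) <= r * 1 by rewrite ler_wpM2l.
  have := deg_defect v; rewrite xv; move: h3 h4; rewrite expr2; lra.
have big u : #|nbrs e u|%:R <= 2%:R * r + 3%:R -> r ^+ 2 / 2%:R <= #|nonnbrs u|%:R.
  by rewrite card_nonnbrs; move: hr; lra.
have m0 : 0 < r ^+ 2 / 2%:R by move: hr; lra.
have [w1 w1v hw1] := small_defect m0 (big v degv) (lexx (defect (nonnbrs v))).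
have d1 : defect (nonnbrs w1) <= 3%:R * excess.
  by have := identity_le w1; have := far_ge0 w1; lra.
pose C := nbrs e v :&: nbrs e w1.
have vw1 : v != w1 by apply: contraTneq w1v => <-; rewrite !inE eqxx.
have C1 := codegree1 vw1; rewrite -/C in C1.
have dC : defect (~: C) <= 4%:R * excess.
  have s : ~: C \subset [set v] :|: (nonnbrs v :|: nonnbrs w1).
    apply/subsetP => z; rewrite !inE; case: (z == v) => //=; case evz : (e v z) => //= ez.
    rewrite negb_or ez andbT; apply: contraTneq w1v => <-.
    by rewrite !inE evz orbT.
  apply: le_trans (defect_sub s) _; apply: le_trans (defectU _ _) _.
  have -> : defect [set v] = 0 by rewrite /defect big_set1 xv subrr.
  by rewrite add0r; apply: le_trans (defectU _ _) _; lra.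
(* Some [w] not adjacent to [u] has [r^2 (1 - x w)] at most 8 times the excess, and [u] is counted
   in the defect of [nonnbrs w]; together with the 4 of [dC] this makes 13. *)
have dCu : defect C <= 9%:R * excess.
  have [->|[u uC]] := set_0Vmem C; first by rewrite /defect big_set0 mulr_ge0 ?ler0n.
  have Cu : C = [set u].
    by apply/eqP; rewrite eq_sym eqEcard sub1set uC cards1.
  have du : #|nbrs e u|%:R <= 2%:R * r + 3%:R.
    rewrite deg_defect; have : defect (nbrs e u) <= 4%:R * excess.
      by apply: le_trans dC; apply: defect_sub; rewrite Cu; apply/subsetP => z; rewrite !inE => euz; apply: contraTneq euz => ->; rewrite eirr.
    have : r * x u <= r * 1 by rewrite ler_wpM2l // (perron_le1 Px).
    by lra.
  have dn : defect (nonnbrs u) <= 4%:R * excess.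
    by apply: le_trans dC; apply: defect_sub; rewrite Cu; apply/subsetP => z; rewrite !inE negb_or => /andP [].
  have [w wu hw] := small_defect m0 (big u du) dn.
  have := identity_le w; have := far_ge0 w.
  rewrite nonnbrs_sym in wu; have := defect_mem wu.
  by rewrite Cu /defect big_set1 -/(defect _); lra.
have := defectU C (~: C); rewrite setUCr; lra.
Qed.

Lemma nonnbr_false : False.
Proof.
have th0 := excess_ge0; have th1 := excess_small; have rth := excess_le.
have /andP [nl nu] := n_bounds; have D := total_defect.
have dA (A : {set V}) : defect A <= 13%:R * excess by apply: le_trans D; exact: defect_sub (subsetT A).
have r0 : 0 <= r by move: hr; lra.
pose q := #|nbrs e v|.
have qE : q%:R = r + defect (nbrs e v) by rewrite /q deg_defect xv mulr1.
have q0 := defect_ge0 (nbrs e v); have q1 := dA (nbrs e v).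
have rx w : r * x w <= r by rewrite -[leRHS]mulr1 ler_wpM2l // (perron_le1 Px).
(* Every degree is at most [r] plus an error far below [1], and [q] is at least [r]. *)
have dq w : (#|nbrs e w| <= q)%N.
  rewrite -ltnS -(ltr_nat R) -[q.+1%:R]natr1 qE deg_defect.
  by have := dA (nbrs e w); have := rx w; lra.
pose N' := [set w | (#|nbrs e w| < q)%N].
have defN w : w \in N' -> 2%:R^-1 <= r * (1 - x w).
  rewrite inE -(ler_nat R) -natr1 deg_defect qE; have := defect_ge0 (nbrs e w).
  by have := dA (nbrs e v); lra.
have cN : #|N'|%:R <= 26%:R :> R.
  have : 2%:R^-1 * #|N'|%:R <= r * defect N'.
    rewrite -sum1_card natr_sum !mulr_sumr; apply: ler_sum => w wN; rewrite mulr1; exact: defN.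
  have : r * defect N' <= r * (13%:R * excess) by rewrite ler_wpM2l.
  by lra.
(* Off [Bad] the identity leaves too little weight for even one vertex in [far], as every entry is
   close to [1]. *)
pose Bad := [set w | 1 <= 2%:R * r ^+ 2 * (1 - x w)].
have cB : #|Bad|%:R <= 26%:R * r.
  have : #|Bad|%:R <= 2%:R * r ^+ 2 * defect Bad.
    rewrite -sum1_card natr_sum !mulr_sumr; apply: ler_sum => w; rewrite inE => h; exact: h.
  have : 2%:R * r ^+ 2 * defect Bad <= 2%:R * r ^+ 2 * (13%:R * excess).
    by rewrite ler_wpM2l // mulr_ge0 ?ler0n ?sqr_ge0.
  have : r * (r * excess) <= r * 1 by rewrite ler_wpM2l.
  by rewrite expr2; lra.
pose Q := \bigcup_(u in N') nbrs e u.
have cQ : #|Q|%:R <= 26%:R * q%:R :> R.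
  apply: (@le_trans _ _ (#|N'| * q)%:R); last by rewrite natrM ler_wpM2r ?ler0n.
  rewrite ler_nat -sum_nat_const /Q.
  elim/big_rec2: _ => [|a S c _ h]; first by rewrite cards0.
  by rewrite (leq_trans (leq_card_setU _ _)) // leq_add.
(* The three exceptional sets have [O(r)] vertices in all, against about [r^2]; hence the assumption
   [100 <= r]. *)
have [w wNot] : exists w, w \notin (Bad :|: N') :|: Q.
  have lt : (#|(Bad :|: N') :|: Q| < #|V|)%N.
    rewrite -(ltr_nat R); apply: (@le_lt_trans _ _ (#|Bad|%:R + #|N'|%:R + #|Q|%:R)).
      rewrite -!natrD ler_nat (leq_trans (leq_card_setU _ _)) // leq_add2r.
      exact: leq_card_setU.
    have r2 : 100%:R * r <= r ^+ 2 by rewrite expr2 ler_wpM2r //; move: hr; lra.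
    by move: hr; lra.
  have : (0 < #|~: ((Bad :|: N') :|: Q)|)%N.
    by move: lt; rewrite -(cardsC ((Bad :|: N') :|: Q)); clear; lia.
  by case/card_gt0P => w; rewrite in_setC => ?; exists w.
move: wNot; rewrite !in_setU !negb_or !inE -ltNge -leqNgt => /andP [/andP [wB wN] wQ].
have nbq u : u \in nbrs e w -> #|nbrs e u| = q.
  rewrite in_nbrs => ewu; apply/eqP; rewrite eqn_leq dq /= leqNgt; apply: contra wQ => lt.
  by apply/bigcupP; exists u; rewrite ?inE // esym.
have far_empty u : r ^+ 2 * (1 - x u) < 2%:R^-1 -> far u = set0.
  move=> h; apply/eqP/set0Pn => -[z zf]; have := identity_le u.
  have : x z <= \sum_(z in far u) x z.
    by rewrite (bigD1 z) //= lerDl; apply: sumr_ge0 => a _; exact: perron_ge0 Px a.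
  have := defect_ge0 (nonnbrs u); have := defect_mem (in_setT z).
  by lra.
have codeg u z : far u = set0 -> u != z -> #|nbrs e u :&: nbrs e z| = 1%N.
  move=> fu uz; have := codegree1 uz; rewrite leq_eqVlt ltnS leqn0 => /predU1P [//|].
  by rewrite cards_eq0 => h; have := in_set0 z; rewrite -fu inE eq_sym uz h.
have fw : far w = set0 by apply: far_empty; lra.
have nq : (q * q = q + #|V|.-1)%N.
  have E : (\sum_(u in nbrs e w) #|nbrs e u| = \sum_(z : V) #|nbrs e w :&: nbrs e z|)%N.
    under eq_bigr => u _ do rewrite -sum1_card.
    rewrite (exchange_big_dep predT) //=; apply: eq_bigr => z _.
    by rewrite -sum1_card; apply: eq_bigl => u; rewrite !inE (esym z).
  have wq : #|nbrs e w| = q by apply/eqP; rewrite eqn_leq dq wN.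
  move: E; rewrite (eq_bigr (fun=> q)) // sum_nat_const wq (bigD1 w) //= setIid wq.
  rewrite (eq_bigr (fun=> 1%N)); last by move=> z zw; rewrite codeg // eq_sym.
  by rewrite sum1_card (cardC1 w).
have V0 : (0 < #|V|)%N by apply/card_gt0P; exists w.
(* [q^2] and [q] have the same parity, so [n - 1] is even and the sharper bound of the odd case
   forces excess zero. *)
have oddn : odd #|V|.
  rewrite -(prednK V0) /=; have := congr1 odd nq; rewrite oddM oddD andbb.
  by case: (odd q) => //=; case: odd.
have th : excess = 0.
  by apply/eqP; rewrite eq_le th0 andbT /excess; have := hodd oddn; rewrite expr2; lra.
have x1 z : x z = 1.
  have := defect_mem (in_setT z); have := perron_le1 Px z; rewrite th mulr0 in D.
  by move=> h1 h2; apply/eqP; rewrite eq_le h1; lra.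
have dfe A : defect A = 0.
  by apply/eqP; rewrite eq_le defect_ge0 andbT; have := dA A; rewrite th mulr0.
have qr : q%:R = r by rewrite qE dfe addr0.
apply: (@friendship_false V e q esym eirr _ _ _ v).
- by move=> u; apply/eqP; rewrite -(eqr_nat R) deg_defect x1 dfe qr mulr1 addr0.
- move=> u z uz; apply: codeg uz; apply: far_empty; rewrite x1 subrr mulr0.
  by rewrite invr_gt0 ltr0n.
- by rewrite -(ltr_nat R) qr; move: hr; lra.
Qed.

End FourCycleFree.

(** * One dominating set for all cases *)

Section Structure.
Variable R : archiRealFieldType.
Hypothesis hasP : has_perron R.

Lemma c4_core : exists N : nat,
  forall (V : finType) (e : rel V), symmetric e -> irreflexive e ->
  ~ packing e (2 * 2) 1 -> forall (r : R) x, perron e r x ->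
  (N <= #|V|)%N -> spectral_max 2 1 V r ->
  exists2 K : {set V}, #|K| = 1%N &
    (forall a u, a \in K -> u \notin K -> e a u) /\ (exists2 a, a \in K & 0 < x a).
Proof.
have [N HN] := nat_above ((100%:R : R) ^+ 2 + 1).
exists N => V e esym eirr np r x Px nN Ext.
have nR : (100%:R : R) ^+ 2 + 1 <= #|V|%:R by apply: le_trans HN _; rewrite ler_nat.
have n100 : 100%:R <= #|V|%:R :> R by move: nR; rewrite expr2; lra.
rewrite ler_nat in n100.
have n2 : ((2 * 1).-1 < #|V|)%N by apply: leq_trans n100.
have [r0 hr2] := spectral_max_lower (l := 2) (t := 0) isT (perron_r_ge0 Px) Ext n2.
have t1 : tight R 2 1 = 1 by rewrite /tight; ring.
rewrite t1 mul1r in hr2.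
have hr : 100%:R <= r.
  rewrite -ler_sqr ?nnegrE ?ler0n ?(ltW r0) //; lra.
have r1 : 1 < r by lra.
have n3 : (3 <= #|V|)%N by apply: leq_trans n100.
have [hlow hodd] := wheel_lower Ext r1 n3.
have [_ [v xv] _ _] := Px.
have dom u : u != v -> e v u.
  move=> uv; apply/idPn => nvu.
  apply: (nonnbr_false esym eirr np Px hr hlow hodd xv (w0 := u)).
  by rewrite !inE negb_or uv.
exists [set v]; first by rewrite cards1.
split; last by exists v; rewrite ?inE ?eqxx // xv ltr01.
by move=> a u; rewrite !inE => /eqP -> /dom.
Qed.

Lemma dominating_core l t : (1 < l)%N -> exists N : nat,
  forall (V : finType) (e : rel V), symmetric e -> irreflexive e ->
  ~ packing e (2 * l) t.+1 -> forall (r : R) x, perron e r x ->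
  (N <= #|V|)%N -> spectral_max l t.+1 V r ->
  exists2 K : {set V}, #|K| = (l * t.+1).-1 &
    (forall a u, a \in K -> u \notin K -> e a u) /\ (exists2 a, a \in K & 0 < x a).
Proof.
move=> l1; have [h|h] := leqP 3 (l * t.+1); first exact: extremal_core.
(* The only case with [k < 2] is a single 4-cycle. *)
have [-> ->] : l = 2%N /\ t = 0%N.
  move: h l1; rewrite mulnS; case: t => [|t]; first by rewrite muln0; clear; lia.
  by rewrite mulnS; clear; lia.
exact: c4_core.
Qed.

Lemma extremal_structure l t : (1 < l)%N -> exists N : nat,
  forall (V : finType) (e : rel V), symmetric e -> irreflexive e ->
  ~ packing e (2 * l) t.+1 -> forall (r : R) x, perron e r x ->
  (N <= #|V|)%N -> spectral_max l t.+1 V r ->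
  exists K : {set V}, [/\ #|K| = (l * t.+1).-1,
    forall a b, a \in K -> b != a -> e a b,
    l = 2%N ->
      (forall w u u', w \notin K -> u \notin K -> u' \notin K -> e w u -> e w u' -> u = u') /\
      (forall u u', u \notin K -> u' \notin K -> u != u' ->
         (forall v, v \notin K -> ~~ e u v) -> (forall v, v \notin K -> ~~ e u' v) -> False) &
    (2 < l)%N -> exists u0 v0, [/\ u0 \notin K, v0 \notin K, u0 != v0 &
      forall u v, u \notin K -> v \notin K ->
        e u v = (u == u0) && (v == v0) || (u == v0) && (v == u0)]].
Proof.
move=> l1; have [N HN] := dominating_core t l1.
exists (maxn N ((l * t.+1).-1 + (l * t.+1 + 4))) => V e esym eirr np r x Px.
rewrite geq_max => /andP [nN nbig] Ext.
have [K cK [KU posK]] := HN V e esym eirr np r x Px nN Ext.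
have cU : (l * t.+1 + 4 <= #|~: K|)%N by rewrite cardsCs setCK cK leq_subRL ?(leq_trans (leq_addr _ _) nbig).
exists K; split=> //.
- by move=> a b; exact: (clique_K esym eirr Px l1 Ext np cK KU cU posK).
- move=> l2; split.
    move=> w u u' wK uK u'K; apply: (outside_degree_le1 esym eirr l1 np cK KU cU wK); by rewrite inE.
  move=> u u' uK u'K uu' iu iu'.
  by apply: (outside_maximal esym eirr Px l1 Ext np cK KU cU posK uK u'K uu' iu iu'); rewrite l2.
- exact: (outside_single_edge esym eirr Px l1 Ext np cK KU cU posK).
Qed.

End Structure.

(** * Isomorphisms and existence of extremal graphs *)

Local Open Scope nat_scope.

Lemma sg_iso_sym (G H : sgraph) : sg_iso G H -> sg_iso H G.
Proof.
case=> f [g fK gK] fe; exists g; first by exists f.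
by move=> x y; rewrite -fe !gK.
Qed.

Lemma sg_iso_card (G H : sgraph) : sg_iso G H -> #|G| = #|H|.
Proof. by case=> f fb _; exact: bij_eq_card fb. Qed.

Lemma sg_iso_free (F G H : sgraph) : sg_iso G H -> sg_free F G -> sg_free F H.
Proof.
move=> /sg_iso_sym [g gb ge] fG [h hi hF]; apply: fG; exists (g \o h).
  by apply: inj_comp => //; exact: bij_inj.
by move=> x y /hF; rewrite /= ge.
Qed.

Lemma sg_iso_rho (G H : sgraph) : 0 < #|G| -> sg_iso G H -> rho G = rho H.
Proof.
move=> G0 GH; have H0 : 0 < #|H| by rewrite -(sg_iso_card GH).
have [x Px] := rho_perron G0; have [y Py] := rho_perron H0.
case: GH => f fb fe.
by have /(congr1 algRval) := perron_uniq Px (perron_bij fb fe Py).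
Qed.

(** Every function codes a graph after symmetrising and removing loops, so the graphs on ['I_n] are
    indexed by a finite type and a maximum of [rho] is attained. *)
Definition graph_of n (f : {ffun 'I_n * 'I_n -> bool}) : rel 'I_n :=
  fun u w => (u != w) && (f (u, w) || f (w, u)).

Lemma graph_of_sym n (f : {ffun 'I_n * 'I_n -> bool}) : symmetric (graph_of f).
Proof. by move=> u w; rewrite /graph_of eq_sym orbC. Qed.

Lemma graph_of_irr n (f : {ffun 'I_n * 'I_n -> bool}) : irreflexive (graph_of f).
Proof. by move=> u; rewrite /graph_of eqxx. Qed.

Definition sgraph_of n (f : {ffun 'I_n * 'I_n -> bool}) : sgraph :=
  SGraph (graph_of_sym f) (graph_of_irr f).

Lemma sgraph_of_iso (H : sgraph) : exists f, sg_iso H (@sgraph_of #|H| f).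
Proof.
exists [ffun p => adj (enum_val p.1 : H) (enum_val p.2)].
exists enum_rank; first exact: enum_rank_bij.
move=> x y; rewrite /= /graph_of !ffunE /= !enum_rankK [adj y x]adj_sym orbb.
rewrite (inj_eq enum_rank_inj).
by have [->|] := eqVneq x y; rewrite ?adj_irrefl.
Qed.

Definition containsb (G F : sgraph) : bool :=
  [exists h : {ffun F -> G}, injectiveb h && [forall x, forall y, adj x y ==> adj (h x) (h y)]].

Lemma containsP (G F : sgraph) : reflect (sg_contains G F) (containsb G F).
Proof.
apply: (iffP existsP) => [[h /andP [/injectiveP hi /forallP hF]]|[h hi hF]].
  by exists h => // x y xy; have /forallP /(_ y) := hF x; rewrite xy.
exists [ffun x => h x]; apply/andP; split; first by apply/injectiveP => x y; rewrite !ffunE => /hi.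
by apply/forallP => x; apply/forallP => y; apply/implyP; rewrite !ffunE => /hF.
Qed.

Lemma extremal_exists n (F G : sgraph) : #|G| = n -> sg_free F G -> exists H, extremal n F H.
Proof.
move=> cG fG; have [f0 If0] := sgraph_of_iso G; rewrite cG in f0 If0.
have P0 : ~~ containsb (sgraph_of f0) F.
  by apply/negP => /containsP; exact: (sg_iso_free If0 fG).
pose T := {ffun 'I_n * 'I_n -> bool}.
pose P (f : T) := ~~ containsb (sgraph_of f) F; pose v (f : T) := rhoR (sgraph_of f).
have [f1 freeF maxF] : exists2 f1, P f1 & forall f, P f -> (v f <= v f1)%R.
  by case: (@Order.TotalTheory.arg_maxP _ _ _ f0 P v P0) => f Pf Mf; exists f.
have cf (f : T) : #|sgraph_of f| = n by rewrite card_ord.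
have free1 : sg_free F (sgraph_of f1) by move=> /containsP; apply/negP.
exists (sgraph_of f1); split=> //; split; first by exists (sgraph_of f1).
move=> H cH fH; have [f If] := sgraph_of_iso H; rewrite cH in f If.
(* Order zero is separate, because the invariance of [rho] is proved through Perron vectors. *)
have [n0|n0] := posnP n.
  have E (L : sgraph) : #|L| = 0 -> rho L = 0%R.
    move=> cL; rewrite /rho /spectral_radius; case: (bigmax_norm_spec (spectrum (adjmx L))) => _ _ _.
    suff -> : spectrum (adjmx L) = [::] by rewrite big_nil.
    case Es : (spectrum _) => [|z s] //; have : z \in spectrum (adjmx L) by rewrite Es mem_head.
    rewrite mem_spectrum => /eigenvalueP [u _ /eqP []]; apply/rowP => i; exfalso.
    by move: i; rewrite cL; case.
  by rewrite !E ?lexx ?cH ?cf.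
rewrite (sg_iso_rho _ If) ?cH //; apply: maxF.
by apply/negP => /containsP; exact: (sg_iso_free If fH).
Qed.

Section JoinIso.
Variables (G : sgraph) (K : {set G}) (s : seq G).
Hypotheses (us : uniq s) (ms : s =i ~: K).
Hypothesis cliq : forall a b : G, a \in K -> b != a -> adj a b.

Lemma join_iso k m (h : rel 'I_m) (hs : symmetric h) (hi : irreflexive h) (x0 : G) :
  #|K| = k -> size s = m ->
  (forall i j : 'I_m, adj (nth x0 s i) (nth x0 s j) = h i j) ->
  sg_iso G (join (complete_graph k) (SGraph hs hi)).
Proof.
move=> cK sm hE; apply: sg_iso_sym.
pose g (p : join (complete_graph k) (SGraph hs hi)) : G :=
  match p with inl i => nth x0 (enum K) i | inr j => nth x0 s j end.
have sK : size (enum K) = k by rewrite -cardE.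
have gK (i : 'I_k) : nth x0 (enum K) i \in K by rewrite -mem_enum mem_nth // sK.
have gS (j : 'I_m) : nth x0 s j \notin K by rewrite -in_setC -ms mem_nth // sm.
have KK (i i' : 'I_k) : nth x0 (enum K) i = nth x0 (enum K) i' -> i = i'.
  by move/eqP; rewrite nth_uniq ?sK ?enum_uniq // => /eqP /val_inj.
have SS (j j' : 'I_m) : nth x0 s j = nth x0 s j' -> j = j'.
  by move/eqP; rewrite nth_uniq ?sm // => /eqP /val_inj.
have gi : injective g.
  move=> [i|j] [i'|j'] /= E; first by rewrite (KK _ _ E).
  - by have := gS j'; rewrite -E gK.
  - by have := gS j; rewrite E gK.
  - by rewrite (SS _ _ E).
exists g.
  apply: inj_card_bij => //; rewrite card_sum !card_ord.
  rewrite -(cardsC K) cK leq_add2l -sm.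
  have -> : #|~: K| = #|s| by apply: eq_card => z; rewrite ms.
  exact: card_size.
move=> [i|j] [i'|j'] /=.
- have [E|ne] := eqVneq i i'; first by rewrite E adj_irrefl /complete_adj eqxx.
  rewrite /complete_adj ne cliq //; apply: contraNneq ne => /KK -> //.
- by apply: cliq => //; apply: contraNneq (gS j') => ->.
- by rewrite adj_sym; apply: cliq => //; apply: contraNneq (gS j) => ->.
- exact: hE.
Qed.

End JoinIso.

Section MatchingList.
Variables (V : finType) (e : rel V) (x0 : V).
Hypotheses (esym : symmetric e) (eirr : irreflexive e).

(** Peel off adjacent pairs and put them in front, which shifts the other indices by two and
    preserves their halves. At most one isolated vertex remains, in the last position. *)
Lemma matching_list (A : {set V}) :
  (forall w u u', w \in A -> u \in A -> u' \in A -> e w u -> e w u' -> u = u') ->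
  (forall u u', u \in A -> u' \in A -> u != u' ->
     (forall v, v \in A -> ~~ e u v) -> (forall v, v \in A -> ~~ e u' v) -> False) ->
  exists s, [/\ uniq s, s =i A & forall i j, i < size s -> j < size s ->
    e (nth x0 s i) (nth x0 s j) = (i != j) && (i./2 == j./2)].
Proof.
have [m] := ubnP #|A|; elim: m A => // m IH A /ltnSE le_m H1 H2.
have [/existsP [a /existsP [b /and3P [aA bA eab]]]|none] :=
   boolP [exists a, exists b, [&& a \in A, b \in A & e a b]].
  have ab : a != b by apply: contraTneq eab => ->; rewrite eirr.
  pose A' := A :\ a :\ b.
  have A'A z : z \in A' -> [&& z \in A, z != a & z != b].
    by rewrite !in_setD1 => /and3P [-> -> ->].
  have nab z : z \in A' -> (e a z = false) * (e b z = false).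
    move=> /A'A /and3P [zA za zb]; split; apply/negP => ez.
      by case/eqP: zb; apply: (H1 a).
    by case/eqP: za; apply: (H1 b) => //; rewrite esym.
  have [|||s [us ms hs]] := IH A'.
  - apply: leq_trans le_m; rewrite (cardsD1 a A) aA ltnS.
    by apply: subset_leq_card; apply: subsetDl.
  - by move=> w u u' /A'A /and3P [wA _ _] /A'A /and3P [uA _ _] /A'A /and3P [u'A _ _]; exact: H1.
  - move=> u u' uA' u'A' uu' iu iu'.
    have ext z : z \in A' -> (forall v, v \in A' -> ~~ e z v) -> forall v, v \in A -> ~~ e z v.
      move=> zA' iz v vA; have [->|va] := eqVneq v a; first by rewrite esym nab.
      have [->|vb] := eqVneq v b; first by rewrite esym nab.
      by apply: iz; rewrite !in_setD1 vb va.
    have /and3P [uA _ _] := A'A u uA'; have /and3P [u'A _ _] := A'A u' u'A'.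
    exact: (H2 u u' uA u'A uu' (ext u uA' iu) (ext u' u'A' iu')).
  exists [:: a, b & s]; split.
  - rewrite /= inE negb_or ab us !ms !in_setD1 !eqxx /= andbF.
    by [].
  - move=> z; rewrite !inE ms !in_setD1.
    have [->|za] := eqVneq z a; first by rewrite aA.
    by have [->|zb] := eqVneq z b; rewrite ?bA.
  - have nA i : i < size s -> nth x0 s i \in A' by move=> lt; rewrite -ms mem_nth.
    have S1 i : i < size s -> (e a (nth x0 s i) = false) * (e b (nth x0 s i) = false) by move=> /nA /nab.
    move=> [|[|i]] [|[|j]] //=; rewrite ?eirr ?eab // ?(esym b) ?eab //.
    + by move=> _ /S1 [-> _].
    + by move=> _ /S1 [_ h]; rewrite esym h.
    + by move=> /S1 [h _] _; rewrite esym h.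
    + by move=> /S1 [_ h] _; rewrite esym h.
    + by move=> li lj; rewrite hs // !eqSS.
have iso z : z \in A -> forall v, v \in A -> ~~ e z v.
  move=> zA v vA; apply: contraNN none => ezv.
  by apply/existsP; exists z; apply/existsP; exists v; rewrite zA vA.
have [A0|[a aA]] := set_0Vmem A.
  by exists [::]; split=> // z; rewrite A0 !inE.
exists [:: a]; split=> //.
  move=> z; rewrite inE; apply/eqP/idP => [-> //|zA]; apply/eqP/idPn => za.
  exact: (H2 z a zA aA za (iso z zA) (iso a aA)).
by move=> [|//] [|//] _ _ /=; rewrite eirr.
Qed.

End MatchingList.

Lemma algR_has_perron : has_perron algR.
Proof.
by move=> V e esym eirr V0; exists (rhoR (SGraph esym eirr)); exact: (@rho_perron (SGraph esym eirr)).
Qed.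

Lemma free_packing (G : sgraph) t m : 2 < m ->
  sg_free (copies t (cycle_graph m)) G <-> ~ packing (@adj G) m t.
Proof. by move=> m2; rewrite /sg_free contains_packing. Qed.

Lemma extremal_spectral_max n l t (G : sgraph) : 1 < l -> 0 < n ->
  extremal n (copies t (cycle_graph (2 * l))) G -> spectral_max l t G (rhoR G).
Proof.
move=> l1 n0 [cG fG [_ mG]] e esym eirr np y.
pose H := SGraph esym eirr; have l2 : 2 < 2 * l by move: l1; clear; lia.
have H0 : 0 < #|H| by rewrite -cG in n0.
have [x [_ _ _ Hx]] := rho_perron H0.
apply: (Order.POrderTheory.le_trans (Hx y)); rewrite ler_wpM2r ?sqnorm_ge0 //.
by apply: (mG H) => //; apply/free_packing.
Qed.

Lemma empty_graph_free n l t : 0 < l -> 0 < t ->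
  exists2 G : sgraph, #|G| = n & sg_free (copies t (cycle_graph (2 * l))) G.
Proof.
move=> l0 t0; pose e : rel 'I_n := fun _ _ => false.
have es : symmetric e by []. have ei : irreflexive e by [].
exists (SGraph es ei); first by rewrite card_ord.
case=> f _ fe; have lt0 : 0 < 2 * l by rewrite muln_gt0.
pose i0 : 'I_t := Ordinal t0; pose a : 'I_(2 * l) := Ordinal lt0.
have lt1 : 1 < 2 * l by move: l0; clear; lia.
pose b : 'I_(2 * l) := Ordinal lt1.
have E : 1 %% (2 * l) = 1 by rewrite modn_small.
suff /fe : @adj (copies t (cycle_graph (2 * l))) (i0, a) (i0, b) by [].
apply/andP; split; first exact: eqxx.
by apply/andP; split; rewrite //= E eqxx.
Qed.

(** Freeness and extremality of [S] are transported from an extremal graph, so [S] itself is never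
    shown to be free directly. *)
Lemma unique_extremal_of n (F S : sgraph) : 0 < n -> (exists G, extremal n F G) ->
  (forall G, extremal n F G -> sg_iso G S) -> unique_extremal n F S.
Proof.
move=> n0 [G eG] H; split=> //; have GS := H G eG.
case: eG => cG fG [_ mG]; have G0 : 0 < #|G| by rewrite cG.
have cS : #|S| = n by rewrite -(sg_iso_card GS).
have fS := sg_iso_free GS fG.
split=> //; split; first by exists S.
by move=> L cL fL; rewrite -(sg_iso_rho G0 GS); exact: mG.
Qed.

Lemma extremal_dominating l t : 1 < l -> exists2 N : nat, 0 < N & forall n, N <= n ->
  (exists G, extremal n (copies t.+1 (cycle_graph (2 * l))) G) /\
  forall G, extremal n (copies t.+1 (cycle_graph (2 * l))) G ->
  exists K : {set G}, [/\ #|K| = (l * t.+1).-1,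
    forall a b : G, a \in K -> b != a -> adj a b,
    l = 2%N ->
      (forall w u u' : G, w \notin K -> u \notin K -> u' \notin K -> adj w u -> adj w u' -> u = u') /\
      (forall u u' : G, u \notin K -> u' \notin K -> u != u' ->
         (forall v : G, v \notin K -> ~~ adj u v) -> (forall v : G, v \notin K -> ~~ adj u' v) -> False) &
    2 < l -> exists u0 v0 : G, [/\ u0 \notin K, v0 \notin K, u0 != v0 &
      forall u v : G, u \notin K -> v \notin K ->
        adj u v = (u == u0) && (v == v0) || (u == v0) && (v == u0)]].
Proof.
move=> l1; have [N HN] := extremal_structure algR_has_perron t l1.
exists N.+1 => // n nN; have n0 : 0 < n by apply: leq_trans nN.
have l0 : 0 < l by apply: ltnW.
split; first by have [G cG fG] := empty_graph_free n l0 (ltn0Sn t); exact: extremal_exists cG fG.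
move=> G eG; have sm := extremal_spectral_max l1 n0 eG.
case: eG => cG fG _; have G0 : 0 < #|G| by rewrite cG.
have [x Px] := rho_perron G0.
apply: (HN G (@adj G) (@adj_sym G) (@adj_irrefl G) _ (rhoR G) x Px _ sm).
  by apply/free_packing => //; move: l1; clear; lia.
by rewrite cG ltnW.
Qed.

Lemma dominating_Splusplus (G : sgraph) (K : {set G}) n k : #|G| = n -> #|K| = k -> 0 < n ->
  (forall a b : G, a \in K -> b != a -> adj a b) ->
  (forall w u u' : G, w \notin K -> u \notin K -> u' \notin K -> adj w u -> adj w u' -> u = u') ->
  (forall u u' : G, u \notin K -> u' \notin K -> u != u' ->
     (forall v : G, v \notin K -> ~~ adj u v) -> (forall v : G, v \notin K -> ~~ adj u' v) -> False) ->
  sg_iso G (Splusplus n k).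
Proof.
move=> cG cK n0 cl H1 H2; have [x0 _] : exists x : G, x \in G by apply/card_gt0P; rewrite cG.
have [||s [us ms hs]] := @matching_list G (@adj G) x0 (@adj_sym G) (@adj_irrefl G) (~: K).
- by move=> w u u'; rewrite !inE; exact: H1.
- move=> u u'; rewrite !inE => uK u'K uu' iu iu'.
  by apply: (H2 u u') => // v vK; [apply: iu | apply: iu']; rewrite inE.
have sm : size s = n - k.
  rewrite -cG -cK -(card_uniqP us); have -> : #|s| = #|~: K| by apply: eq_card => z; rewrite ms.
  by rewrite cardsCs setCK.
apply: (join_iso us ms cl (x0 := x0) (matching_adj_sym (m := n - k)) (matching_adj_irrefl (m := n - k)) cK sm).
by move=> i j; rewrite hs ?sm // /matching_adj.
Qed.

Lemma dominating_Splus (G : sgraph) (K : {set G}) n k (u0 v0 : G) : #|G| = n -> #|K| = k ->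
  (forall a b : G, a \in K -> b != a -> adj a b) ->
  u0 \notin K -> v0 \notin K -> u0 != v0 ->
  (forall u v : G, u \notin K -> v \notin K ->
     adj u v = (u == u0) && (v == v0) || (u == v0) && (v == u0)) ->
  sg_iso G (Splus n k).
Proof.
move=> cG cK cl u0K v0K uv H.
pose s := [:: u0, v0 & enum (~: K :\ u0 :\ v0)].
have us : uniq s.
  by rewrite /= inE negb_or uv enum_uniq !mem_enum !in_setD1 !eqxx andbF.
have ms : s =i ~: K.
  move=> z; rewrite !inE mem_enum !in_setD1 in_setC.
  have [->|zu] := eqVneq z u0; first by rewrite u0K.
  by have [->|zv] := eqVneq z v0; rewrite ?v0K.
have sm : size s = n - k.
  rewrite -cG -cK -(card_uniqP us); have -> : #|s| = #|~: K| by apply: eq_card => z; rewrite ms.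
  by rewrite cardsCs setCK.
apply: (join_iso us ms cl (x0 := u0) (one_edge_adj_sym (m := n - k)) (one_edge_adj_irrefl (m := n - k)) cK sm).
move=> i j; have out (a : 'I_(n - k)) : nth u0 s a \notin K by rewrite -in_setC -ms mem_nth // sm.
have s2 : 1 < size s by [].
have n0 a : a < size s -> (nth u0 s a == u0) = (a == 0).
  by move=> la; rewrite -[X in _ == X]/(nth u0 s 0) nth_uniq.
have n1 a : a < size s -> (nth u0 s a == v0) = (a == 1).
  by move=> la; rewrite -[X in _ == X]/(nth u0 s 1) nth_uniq.
rewrite H ?out // !n0 ?n1 ?sm // /one_edge_adj.
by clear; case: (val i) (val j) => [|[|a]] [|[|b]].
Qed.

Theorem theorem1p3 (t l : nat) (ht : 0 < t) (hl : 0 < l) :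
  exists N : nat, forall n : nat, N <= n ->
    unique_extremal n (copies t (cycle_graph 4)) (Splusplus n (2 * t - 1)) /\
    (3 <= l ->
     unique_extremal n (copies t (cycle_graph (2 * l))) (Splus n (l * t - 1))).
Proof.
case: t ht => // t _; have [N1 N10 H1] := extremal_dominating t (isT : 1 < 2).
have [N2 N20 H2] : exists2 N2 : nat, 0 < N2 & 3 <= l -> forall n, N2 <= n ->
    unique_extremal n (copies t.+1 (cycle_graph (2 * l))) (Splus n (l * t.+1 - 1)).
  have [l3|_] := leqP 3 l; last by exists 1.
  have [N2 N20 H2] := extremal_dominating t (ltnW l3).
  exists N2 => // _ n nN; have [ex uq] := H2 n nN.
  apply: unique_extremal_of => //; first exact: leq_trans nN.
  move=> G eG; have [K [cK cl _ /(_ l3) [u0 [v0 [u0K v0K uv hK]]]]] := uq G eG.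
  case: eG => cG _ _; rewrite subn1.
  exact: (dominating_Splus cG cK cl u0K v0K uv hK).
exists (maxn N1 N2) => n; rewrite geq_max => /andP [n1 n2]; split; last by move=> l3; exact: H2.
have n0 : 0 < n by apply: leq_trans n1.
have [ex uq] := H1 n n1; apply: unique_extremal_of => // G eG.
have [K [cK cl /(_ erefl) [h1 h2] _]] := uq G eG.
by case: eG => cG _ _; rewrite subn1; exact: (dominating_Splusplus cG cK n0 cl h1 h2).
Qed.
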